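(* Let $\mathbb{K}$ be a field with $|\mathbb{K}|>2$ and let $(X,Z,\Xi,\Theta)$ be a duo-symplectic dual split Veronese set (so (S1)–(S3) hold) with parameters $(1,v,r',v')$, such that every point of $X$ lies in at least two members of $\Theta$ and no point of $Y$ is collinear with all points of $X$. Then $r'=2$ (and $v=v'=1$), and $X$ is projectively equivalent to the point set of the dual Segre variety $\mathcal{DS}_{2,2}(\mathbb{K})$, with $Y$ corresponding to the subspace $Y$ of that construction and $Z$ to $Z_1\cup Z_2$.
   Context: Let $\mathbb{K}$ be a field. For integers $R\ge1$, $V\ge -1$, an $(R,V)$-cone is a cone with a $V$-dimensional vertex (empty if $V=-1$) over a non-degenerate hyperbolic quadric in $\mathbb{P}^{2R+1}(\mathbb{K})$; the $(R,V)$-tube is the cone minus its vertex. Let $r,v,r',v'\ge -1$ be integers with $r'>r\ge1$, $d=2r+v+1$, $d'=2r'+v'+1$. Let $X,Z$ be point sets with $X\cup Z$ spanning $\mathbb{P}^N(\mathbb{K})$, $Y:=\langle Z\rangle$; $\Xi$ a family of $(d+1)$-dimensional subspaces with $|\Xi|>1$, $\Theta$ a possibly empty family of $(d'+1)$-dimensional subspaces such that: for $\xi\in\Xi$, $(X\cup Y)\cap\xi$ is an $(r,v)$-cone with vertex $Y\cap\xi$ and $X\cap\xi$ is its tube; for $\theta\in\Theta$, $(X\cup Y)\cap\theta$ is an $(r',v')$-cone $C_\theta$, $Y\cap\theta$ is a generator $M$ of $C_\theta$, $Z\cap\theta$ is the disjoint union of the vertex $V_\theta$ and an $r'$-space of $M$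 complementary to $V_\theta$, and $X\cap\theta=C_\theta\setminus M$. A subspace is singular if all its points lie in $X\cup Y$; two points are collinear if the joining line is singular. For $x\in X$, $T_x$ is the span of all singular lines through $x$ and $T_x(\zeta)$ the span of those in $\zeta\in\Xi\cup\Theta$. Axioms: (S1) any two distinct points of $X\cup Z$ lie in a common member of $\Xi\cup\Theta$; (S2) the intersection of two distinct members of $\Xi\cup\Theta$ is singular; (S3) for each $x\in X$ there are $\xi_1,\xi_2\in\Xi$ with $T_x=\langle T_x(\xi_1),T_x(\xi_2)\rangle$. A dual split Veronese set with parameters $(r,v,r',v')$ satisfies (S1)–(S3); duo-symplectic means $\Theta\ne\emptyset$. Dual Segre variety $\mathcal{DS}_{\ell,k}(\mathbb{K})$: with $m=(\ell+1)(k+1)-1$, in $\mathbb{P}^{m+\ell+k+2}(\mathbb{K})$ take the Segre variety $S=\mathcal{S}_{\ell,k}(\mathbb{K})$ spanning an $m$-space, and a complementary $(\ell+k+1)$-space $Y$ containing disjoint subspaces $Z_1,Z_2$ of dimensions $\ell,k$; take an $\ell$-dimensional singular subspace $S_1$ and a $k$-dimensional singular subspace $S_2$ of $S$ meeting in one point, and linear dualities $\chi_{S_i}$ from the points of $S_i$ to the hyperplanes of $Z_i$; for $x\in S$ put $\chi(x)=\langle\chi_{S_1}(x_1),\chi_{S_2}(x_2)\rangle$, where $x_i=x$ if $x\in S_i$ and otherwise $x_i$ is the unique point of $S_i$ collinear with $x$ in $S$; the point set is $\bigcup_{x\in S}(\langle x,\chi(x)\rangle\setminus\chi(x))$. *)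

(* Defs.v *)
(* Projective space P^N(K) over a field K is modelled on the
   vector space 'rV[K]_(N.+1): a point is a nonzero row vector (up to nonzero
   scalars); a projective subspace is the row space of a matrix (mxalgebra);
   a subspace of projective dimension d is a row space of rank d+1. *)
From HB Require Import structures.
From mathcomp Require Import all_boot all_order all_algebra.
Set Implicit Arguments. Unset Strict Implicit. Unset Printing Implicit Defensive.
Import GRing.Theory Num.Theory.
Local Open Scope ring_scope.

Section Geometry.
Variables (K : fieldType) (N : nat).
Local Notation vec := 'rV[K]_(N.+1).
Local Notation sub := 'M[K]_(N.+1).

Definition is_ptset (P : vec -> Prop) : Prop :=
  (forall u, P u -> u != 0) /\ (forall (c : K) u, c != 0 -> P u -> P (c *: u)).

Definition is_span (P : vec -> Prop) (S : sub) : Prop :=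
  (forall u, P u -> (u <= S)%MS) /\
  (forall T : sub, (forall u, P u -> (u <= T)%MS) -> (S <= T)%MS).

Definition XuY (X : vec -> Prop) (Y : sub) (u : vec) : Prop :=
  X u \/ (u != 0 /\ (u <= Y)%MS).

Definition singular (X : vec -> Prop) (Y : sub) m (S : 'M[K]_(m, N.+1)) : Prop :=
  forall u : vec, u != 0 -> (u <= S)%MS -> XuY X Y u.

Definition collinear (X : vec -> Prop) (Y : sub) (p q : vec) : Prop :=
  singular X Y (col_mx p q).

Definition sing_line_pts (X : vec -> Prop) (Y : sub) (x : vec) (zeta : sub)
  (u : vec) : Prop :=
  exists L : sub, [/\ \rank L = 2%N, (x <= L)%MS, (L <= zeta)%MS,
                      singular X Y L & (u <= L)%MS].

(* v + 1 as a natural number, for an integer v >= -1 *)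
Definition natp1 (v : int) : nat := absz (v + 1).

(* C is an (R,V)-cone spanning the subspace xi with vertex W: in suitable
   coordinates (x, y, w) of xi, with x, y in K^(R+1) (base P^(2R+1)) and
   w in K^(V+1) (vertex), C is the set of points with
   x_0 y_0 + ... + x_R y_R = 0, the vertex being w-space. *)
Definition is_cone (R : nat) (V : int) (xi : sub) (C : vec -> Prop) (W : sub)
  : Prop :=
  (forall u, C u -> (u <= xi)%MS) /\
  exists B : 'M[K]_(R.+1 + R.+1 + natp1 V, N.+1),
    [/\ row_free B, (B == xi)%MS, (W == dsubmx B)%MS &
        forall (x y : 'rV[K]_R.+1) (w : 'rV[K]_(natp1 V)),
          row_mx (row_mx x y) w != 0 ->
          (C (row_mx (row_mx x y) w *m B) <-> (x *m y^T) 0 0 = 0)].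

Definition generator (C : vec -> Prop) (theta M : sub) : Prop :=
  [/\ (M <= theta)%MS,
      (forall u : vec, u != 0 -> (u <= M)%MS -> C u) &
      (forall M' : sub, (M <= M')%MS -> (M' <= theta)%MS ->
         (forall u : vec, u != 0 -> (u <= M')%MS -> C u) -> (M' <= M)%MS)].

Definition dual_split_veronese (X Z : vec -> Prop) (Y : sub)
  (Xi Theta : sub -> Prop) (r : nat) (v : int) (r' : nat) (v' : int) : Prop :=
  [/\ [/\ (1 <= r)%N, (r < r')%N, -1 <= v & -1 <= v'] /\
      [/\ is_ptset X, is_ptset Z,
          is_span (fun u => X u \/ Z u) 1%:M & is_span Z Y],
      (exists xi1 xi2, [/\ Xi xi1, Xi xi2 & ~ (xi1 == xi2)%MS]),
      (forall xi, Xi xi ->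
         [/\ \rank xi = (r.+1 + r.+1 + natp1 v)%N,
             is_cone r v xi (fun u => XuY X Y u /\ (u <= xi)%MS) (Y :&: xi)%MS &
             forall u, (X u /\ (u <= xi)%MS) <->
                       [/\ XuY X Y u, (u <= xi)%MS & ~ (u <= Y :&: xi)%MS]]),
      (forall theta, Theta theta ->
         \rank theta = (r'.+1 + r'.+1 + natp1 v')%N /\
         exists Vt M S : sub,
           let C := fun u => XuY X Y u /\ (u <= theta)%MS in
           [/\ is_cone r' v' theta C Vt,
               generator C theta M /\ (Y :&: theta == M)%MS,
               [/\ (S <= M)%MS, \rank S = r'.+1, (S :&: Vt == (0 : sub))%MS
                 & (S + Vt == M)%MS],
               (forall u, (Z u /\ (u <= theta)%MS) <->
                          (u != 0 /\ ((u <= Vt)%MS \/ (u <= S)%MS))) &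
               (forall u, (X u /\ (u <= theta)%MS) <->
                          (C u /\ ~ (u <= M)%MS))]) &
      [/\
          (forall p q, X p \/ Z p -> X q \/ Z q -> \rank (col_mx p q) = 2%N ->
             exists zeta, (Xi zeta \/ Theta zeta) /\
                          (p <= zeta)%MS /\ (q <= zeta)%MS),
          (forall zeta zeta', Xi zeta \/ Theta zeta -> Xi zeta' \/ Theta zeta' ->
             ~ (zeta == zeta')%MS -> singular X Y (zeta :&: zeta')%MS) &
          (forall x, X x -> exists xi1 xi2 T1 T2,
             [/\ Xi xi1, Xi xi2, is_span (sing_line_pts X Y x xi1) T1,
                 is_span (sing_line_pts X Y x xi2) T2 &
                 is_span (sing_line_pts X Y x 1%:M) (T1 + T2)%MS])]].

End Geometry.

(* The dual Segre variety DS_{l,k}(K), in coordinates of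
   K^((l+1)(k+1)) (+) K^(l+k+2): the Segre variety S_{l,k} is the set of
   points mxvec (a^T b) of the first block (spanning an m-space), Y is the
   second block.  Z1, Z2 are the row spaces of Z1b, Z2b (disjoint, of
   dimensions l and k: col_mx Z1b Z2b invertible).  With S1 = {a (x) b0},
   S2 = {a0 (x) b}, the linear dualities are
     chi_S1 (a (x) b0) = { c *m Z1b | c *m D1 *m a^T = 0 },
     chi_S2 (a0 (x) b) = { c *m Z2b | c *m D2 *m b^T = 0 }
   with D1, D2 invertible; for x = a (x) b one has x1 = a (x) b0,
   x2 = a0 (x) b.  The points of <x, chi(x)> \ chi(x) are the
   mxvec(a^T b) + z, z in chi(x) (scalars absorbed in a). *)
Section DualSegre.
Variables (K : fieldType) (l k : nat).
Local Notation amb := 'rV[K]_(l.+1 * k.+1 + (l.+1 + k.+1)).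

Definition DS_data (Z1b : 'M[K]_(l.+1, l.+1 + k.+1))
  (Z2b : 'M[K]_(k.+1, l.+1 + k.+1)) (D1 : 'M[K]_l.+1) (D2 : 'M[K]_k.+1) : Prop :=
  [/\ col_mx Z1b Z2b \in unitmx, D1 \in unitmx & D2 \in unitmx].

Definition DS_pts (Z1b : 'M[K]_(l.+1, l.+1 + k.+1))
  (Z2b : 'M[K]_(k.+1, l.+1 + k.+1)) (D1 : 'M[K]_l.+1) (D2 : 'M[K]_k.+1)
  (w : amb) : Prop :=
  exists (a : 'rV[K]_l.+1) (b : 'rV[K]_k.+1) (c1 : 'rV[K]_l.+1) (c2 : 'rV[K]_k.+1),
    [/\ a != 0, b != 0, c1 *m D1 *m a^T = 0, c2 *m D2 *m b^T = 0 &
        w = row_mx (mxvec (a^T *m b)) (c1 *m Z1b + c2 *m Z2b)].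

Definition DS_Y (w : amb) : Prop := exists y, w = row_mx 0 y.

Definition DS_Z (Z1b : 'M[K]_(l.+1, l.+1 + k.+1))
  (Z2b : 'M[K]_(k.+1, l.+1 + k.+1)) (w : amb) : Prop :=
  w != 0 /\ ((exists c1, w = row_mx 0 (c1 *m Z1b)) \/
              (exists c2, w = row_mx 0 (c2 *m Z2b))).

End DualSegre.

(* Main.v *)
(* The bilinear form of each member of the two families lets one recognise
   collinearity, and the member through two non-collinear points of X contains
   every point collinear with both.  The points of X over x modulo Y form an
   affine space x + ch x.  In the residue at x (singular lines on x modulo Y)
   "lying on a common member of Theta" is an equivalence relation with
   projective subspaces as classes, two inequivalent lines spanning a member of
   Xi.  By (S3) the residue lies in a 3-space, and a rank count shows that two
   members of Theta on x share no line modulo Y.  Hence r' = 2 and the residue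
   is a pair of skew lines.  Comparing the traces of Z on ch x in these two
   members gives v = v' = 1, that there are no other members of Theta on x, and
   that Z is a union of two disjoint planes Z1 and Z2, each member of Theta
   inducing one of them.  A point of X modulo Y is then given by the two
   functionals a, b cutting ch x out on Z1 and Z2, and members of Theta are the
   fibres of either coordinate; this identifies X modulo Y with rank one
   tensors.  Finally the position of X above a tensor is measured by two scalar
   functions, the first quadratic in a and linear in b, the second conversely,
   so that a bilinear change of section makes both vanish. *)
Require Import Defs.
From HB Require Import structures.
From mathcomp Require Import all_boot all_order all_algebra.
From mathcomp Require Import zify ring.
From Stdlib Require Import Classical.
Set Implicit Arguments. Unset Strict Implicit. Unset Printing Implicit Defensive.
Import GRing.Theory Num.Theory.
Local Open Scope ring_scope.

(* In the scope of mxalgebra [+] is the sum of subspaces; this notation keeps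
   the vector on the left in ring_scope. *)
Notation "u <=m S" := (submx u%R S%MS) (at level 70, no associativity).

(** * Quadratic forms and subspaces *)

(** No form is given globally: each member carries its own quadratic form, which sees collinearity
    only inside that member. So every argument has to bring its points into one member.
    Non-collinear points do this: they lie in a unique member by (S1) and (S2), and it absorbs all
    points collinear with both. The main source of such pairs is a point d of ch x outside ch l, for
    collinear x and l in X: then x + d and l are not collinear, and the member through them contains
    x, l and d. It belongs to Theta, because in a member of Xi all points of Y lie in the vertex.
    Hence inclusions between the sets ch x and ch l decide which family joins two lines on x, and
    the ranks of their intersections carry the parameters of one family over to the other. A scalar
    other than 0 and 1 is what makes ch x closed under addition and allows leaving Y along a line.
    Characteristic 2 is covered because forms are given by arbitrary square matrices. *)

Section Forms.
Variables (K : fieldType) (n : nat).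
Implicit Types (u v w : 'rV[K]_n) (H : 'M[K]_n).

Definition qf H u : K := (u *m H *m u^T) 0 0.
Definition bf H u v : K := (u *m (H + H^T) *m v^T) 0 0.

Lemma mx11D (A B : 'M[K]_1) : (A + B) 0 0 = A 0 0 + B 0 0.
Proof. by rewrite mxE. Qed.

Lemma bfC H u v : bf H u v = bf H v u.
Proof.
rewrite /bf -[in LHS]trace_mx11 -mxtrace_tr !trmx_mul trmxK linearD /= trmxK addrC.
by rewrite mulmxA trace_mx11.
Qed.

Lemma bfDl H u1 u2 v : bf H (u1 + u2) v = bf H u1 v + bf H u2 v.
Proof. by rewrite /bf !mulmxDl mx11D. Qed.
Lemma bfDr H u v1 v2 : bf H u (v1 + v2) = bf H u v1 + bf H u v2.
Proof. by rewrite bfC bfDl !(bfC H _ u). Qed.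
Lemma bfZl H c u v : bf H (c *: u) v = c * bf H u v.
Proof. by rewrite /bf -!scalemxAl mxE. Qed.
Lemma bfZr H c u v : bf H u (c *: v) = c * bf H u v.
Proof. by rewrite bfC bfZl bfC. Qed.
Lemma bfNl H u v : bf H (- u) v = - bf H u v.
Proof. by rewrite -scaleN1r bfZl mulN1r. Qed.
Lemma bfNr H u v : bf H u (- v) = - bf H u v.
Proof. by rewrite bfC bfNl bfC. Qed.
Lemma bf0l H v : bf H 0 v = 0.
Proof. by rewrite -(scale0r (0 : 'rV_n)) bfZl mul0r. Qed.
Lemma bf0r H v : bf H v 0 = 0.
Proof. by rewrite bfC bf0l. Qed.

Lemma qfD H u v : qf H (u + v) = qf H u + qf H v + bf H u v.
Proof.
rewrite /qf /bf linearD /= !(mulmxDl, mulmxDr) !mx11D.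
have -> : (u *m H^T *m v^T) 0 0 = (v *m H *m u^T) 0 0.
  by rewrite -[in LHS]trace_mx11 -mxtrace_tr !trmx_mul !trmxK mulmxA trace_mx11.
by ring.
Qed.
Lemma qfZ H c u : qf H (c *: u) = c ^+ 2 * qf H u.
Proof.
by rewrite /qf -!scalemxAl linearZ /= -scalemxAr scalerA mxE expr2.
Qed.
Lemma qfN H u : qf H (- u) = qf H u.
Proof. by rewrite -scaleN1r qfZ sqrrN expr1n mul1r. Qed.
Lemma qf0 H : qf H 0 = 0.
Proof. by rewrite -(scale0r (0 : 'rV_n)) qfZ expr0n mul0r. Qed.
Lemma bf_diag H u : bf H u u = qf H u *+ 2.
Proof.
have := qfD H u u; rewrite -mulr2n -scaler_nat qfZ => E.
have -> : bf H u u = 2%:R ^+ 2 * qf H u - (qf H u + qf H u) by rewrite E; ring.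
by ring.
Qed.

Definition formE := (qfD, qfZ, qfN, bfDl, bfDr, bfZl, bfZr, bfNl, bfNr, qf0, bf0l, bf0r).

End Forms.

Section Subspaces.
Variables (K : fieldType).

(** A subspace inside [P] that misses a vector of [P] can be enlarged by it; the induction is on a
    bound [k] for the corank. *)
Lemma subspace_of_pred n (P : 'rV[K]_n -> Prop) :
  P 0 -> (forall u v, P u -> P v -> P (u + v)) ->
  (forall c u, P u -> P (c *: u)) ->
  exists S : 'M[K]_n, forall u, (u <= S)%MS <-> P u.
Proof.
move=> P0 PD PZ.
have step (k : nat) (S : 'M[K]_n) : (forall u, (u <= S)%MS -> P u) ->
    (n - \rank S <= k)%N ->
    exists S' : 'M[K]_n, forall u, (u <= S')%MS <-> P u.
  elim: k S => [|k IH] S HS Hk.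
    exists S => u; split; first exact: HS.
    have /eqP rS : (\rank S == n) by rewrite eqn_leq rank_leq_row; lia.
    by move=> _; apply: submx_full; rewrite /row_full rS.
  case: (classic (exists u, P u /\ ~~ (u <= S)%MS)) => [[u [Pu nu]]|H].
    apply: (IH (S + u)%MS).
      move=> w /sub_addsmxP [[a b] ->] /=.
      apply: PD; first by apply: HS; exact: submxMl.
      by rewrite (mx11_scalar b) mul_scalar_mx; apply: PZ.
    have : (S < S + u)%MS.
      by rewrite ltmxE addsmxSl addsmx_sub submx_refl.
    move=> /rank_ltmx => H; lia.
  exists S => u; split; first exact: HS.
  by move=> Pu; apply: NNPP => nu; apply: H; exists u; split => //; apply/negP.
apply: (step n 0) => [u|]; last by lia.
by rewrite submx0 => /eqP ->.
Qed.

(** The hypothesis makes the rows of [A *m G *m M^T] independent, so its transpose has full row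
    space. It serves to find vectors of a subspace, mostly [Y :&: th], with prescribed products. *)
Lemma pairing_onto n k m (A : 'M[K]_(k, n)) (G : 'M[K]_n) (M : 'M[K]_(m, n)) :
  (forall a : 'rV_k, a *m A *m G *m M^T = 0 -> a = 0) ->
  forall s : 'cV_k, exists2 y : 'rV_n, (y <= M)%MS & A *m G *m y^T = s.
Proof.
move=> inj s.
have fr : row_free (A *m G *m M^T).
  rewrite -kermx_eq0; apply/eqP/row_matrixP => i; rewrite row0.
  apply: inj; apply/eqP.
  by rewrite -2!mulmxA mulmxA -[_ *m _ *m _]mulmxA (mulmxA A) -sub_kermx row_sub.
have /row_fullP [B HB] : row_full (A *m G *m M^T)^T.
  by rewrite /row_full mxrank_tr.
exists (s^T *m B *m M); first exact: submxMl.
apply: (can_inj (@trmxK _ _ _)).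
rewrite !trmx_mul !trmxK.
move: HB; rewrite !trmx_mul !trmxK !mulmxA => HB.
have -> : s^T *m B *m M *m G^T *m A^T = s^T *m (B *m M *m G^T *m A^T).
  by rewrite !mulmxA.
by rewrite HB mulmx1.
Qed.

Lemma sub_addsv n m (u : 'rV[K]_n) (x : 'rV[K]_n) (S : 'M[K]_(m, n)) :
  (u <= x + S)%MS <-> exists s w, (w <= S)%MS /\ u = s *: x + w.
Proof.
split.
  move=> /sub_addsmxP [[a b] ->] /=; exists (a 0 0), (b *m S).
  split; first exact: submxMl.
  by rewrite {1}(mx11_scalar a) mul_scalar_mx.
move=> [s [w [wS ->]]]; apply: addmx_sub_adds => //.
by apply: scalemx_sub.
Qed.

Lemma sub_addsvv n m (u x y : 'rV[K]_n) (S : 'M[K]_(m, n)) :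
  (u <= x + (y + S))%MS <->
  exists s t w, (w <= S)%MS /\ u = s *: x + t *: y + w.
Proof.
split.
  move=> /sub_addsv [s [w [/sub_addsv [t [w' [w'S ->]]] ->]]].
  by exists s, t, w'; rewrite addrA.
move=> [s [t [w [wS ->]]]]; apply/sub_addsv; exists s, (t *: y + w).
by rewrite addrA; split => //; apply/sub_addsv; exists t, w.
Qed.

End Subspaces.

(** * Cones as zero sets of quadratic forms *)

Section Cones.
Variables (K : fieldType) (N : nat).
Local Notation vec := 'rV[K]_(N.+1).
Local Notation sub := 'M[K]_(N.+1).

(** The coordinates of the cone are used only here; afterwards the form [H] replaces them. The first
    clause gives, for a point [u] of the cone off the vertex, a line of the cone on [u] that misses
    the vertex. It needs [0 < R], since [R + 1] coordinates must leave room for a nonzero vector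
    orthogonal to a given one. *)
Lemma cone_form (R : nat) (V : int) (xi : sub) (C : vec -> Prop) (W : sub) :
  is_cone R V xi C W ->
  exists H : sub,
    (forall u, (0 < R)%N -> (u <= xi)%MS -> ~ (u <= W)%MS -> exists l,
       [/\ (l <= xi)%MS, qf H l = 0, bf H u l = 0 &
          forall s t, (s *: u + t *: l)%R <=m W -> s = 0 /\ t = 0]) /\
    [/\ forall u, (u <= xi)%MS -> u != 0 -> (C u <-> qf H u = 0),
        forall u, (u <= xi)%MS -> (forall w, (w <= xi)%MS -> bf H u w = 0) ->
          (u <= W)%MS,
        forall u w, (u <= W)%MS -> (w <= xi)%MS -> bf H u w = 0,
        (W <= xi)%MS & \rank W = natp1 V].
Proof.
move=> [Csub [B [fB eB eW HC]]].
set E1 : 'M[K]_(R.+1 + R.+1 + natp1 V, R.+1) := col_mx (col_mx 1%:M 0) 0.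
set E2 : 'M[K]_(R.+1 + R.+1 + natp1 V, R.+1) := col_mx (col_mx 0 1%:M) 0.
have e1 x y w : row_mx (row_mx x y) w *m E1 = x :> 'rV_R.+1.
  by rewrite /E1 !mul_row_col !mulmx0 mulmx1 !addr0.
have e2 x y w : row_mx (row_mx x y) w *m E2 = y :> 'rV_R.+1.
  by rewrite /E2 !mul_row_col !mulmx0 mulmx1 add0r addr0.
set P := pinvmx B.
have PK c : c *m B *m P = c :> 'rV_(R.+1 + R.+1 + natp1 V).
  by rewrite -mulmxA mulmxVp // mulmx1.
(* [P] recovers the coordinates of a vector of [xi], so [H] is the pullback of the form
   [x *m y^T]. *)
set H := P *m (E1 *m E2^T) *m P^T.
have qE x y w : qf H (row_mx (row_mx x y) w *m B) = (x *m y^T) 0 0.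
  rewrite /qf /H.
  set c := row_mx _ _.
  have -> : c *m B *m (P *m (E1 *m E2^T) *m P^T) *m (c *m B)^T
     = (c *m B *m P *m E1) *m (c *m B *m P *m E2)^T.
    by rewrite !trmx_mul !mulmxA.
  by rewrite PK e1 e2.
have bE x y w x' y' w' : bf H (row_mx (row_mx x y) w *m B) (row_mx (row_mx x' y') w' *m B)
   = (x *m y'^T) 0 0 + (x' *m y^T) 0 0.
  have := qfD H (row_mx (row_mx x y) w *m B) (row_mx (row_mx x' y') w' *m B).
  rewrite -mulmxDl !add_row_mx !qE linearD /= mulmxDl !mulmxDr !mx11D.
  set q := bf _ _ _; set a := (x *m y^T) 0 0; set b := (x *m y'^T) 0 0.
  set c := (x' *m y^T) 0 0; set d := (x' *m y'^T) 0 0 => E.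
  have -> : q = (a + d + q) - a - d by ring.
  by rewrite -E; ring.
have repr u : (u <= xi)%MS -> exists x y w, u = row_mx (row_mx x y) w *m B.
  rewrite -(eqmxP eB) => /submxP [c ->].
  by exists (lsubmx (lsubmx c)), (rsubmx (lsubmx c)), (rsubmx c); rewrite !hsubmxK.
have inxi c : (c *m B <= xi)%MS by rewrite -(eqmxP eB) submxMl.
have eWi : (W :=: dsubmx B)%MS by exact/eqmxP.
have dsE w : row_mx 0 w *m B = w *m dsubmx B.
  by rewrite -{1}(vsubmxK B) mul_row_col mul0mx add0r.
have inW x y w : (row_mx (row_mx x y) w *m B <= W)%MS -> x = 0 :> 'rV_R.+1 /\ y = 0 :> 'rV_R.+1.
  rewrite eWi => /submxP [c]; rewrite -dsE => /(row_free_inj fB).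
  by move=> /eq_row_mx [+ _]; rewrite -[0 in RHS]row_mx0 => /eq_row_mx.
have orth (x : 'rV[K]_R.+1) : (0 < R)%N -> exists2 z : 'rV_R.+1, z != 0 & (z *m x^T) 0 0 = 0.
  move=> R0; have : kermx x^T != 0.
    by rewrite -mxrank_eq0 mxrank_ker; have := rank_leq_col x^T; lia.
  move=> /rowV0Pn [z /sub_kermxP zx z0]; exists z => //.
  by rewrite zx mxE.
have in0 (x y : 'rV[K]_R.+1) : (x = 0) -> y = 0 -> forall w, (row_mx (row_mx x y) w *m B <= W)%MS.
  by move=> -> -> w; rewrite row_mx0 dsE eWi submxMl.
have comb s t (c c' : 'rV_(R.+1 + R.+1 + natp1 V)) :
    s *: (c *m B) + t *: (c' *m B) = (s *: c + t *: c') *m B.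
  by rewrite mulmxDl -!scalemxAl.
have sq (a b : 'rV[K]_R.+1) : (a *m b^T) 0 0 = (b *m a^T) 0 0.
  by rewrite -[in LHS]trace_mx11 -mxtrace_tr trmx_mul trmxK trace_mx11.
exists H; split.
  move=> u R0 /repr [x [y [w ->]]] nW.
  (* The witness has only its [y] part nonzero, or only its [x] part if [x = 0]; so it is isotropic
     and independent of [u] modulo the vertex. *)
  have [x0|xn0] := eqVneq x 0.
    have yn0 : y != 0 by apply/eqP => y0; apply: nW; apply: in0.
    have [z z0 zy] := orth y R0.
    exists (row_mx (row_mx z 0) 0 *m B); split; first exact: inxi.
    - by rewrite qE trmx0 mulmx0 mxE.
    - by rewrite bE trmx0 mulmx0 [X in X + _]mxE add0r.
    move=> s t; rewrite comb !scale_row_mx !add_row_mx !scaler0 !addr0 x0.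
    move=> /inW; rewrite scaler0 add0r => -[/eqP + /eqP].
    by rewrite !scaler_eq0 (negPf z0) (negPf yn0) !orbF => /eqP -> /eqP ->.
  have [z z0 zx] := orth x R0.
  exists (row_mx (row_mx 0 z) 0 *m B); split; first exact: inxi.
  - by rewrite qE mul0mx mxE.
  - by rewrite bE mul0mx [X in _ + X]mxE addr0 sq.
  move=> s t; rewrite comb !scale_row_mx !add_row_mx !scaler0 !addr0.
  move=> /inW [/eqP + ]; rewrite scaler_eq0 (negPf xn0) orbF => /eqP ->.
  by rewrite scale0r add0r => /eqP; rewrite scaler_eq0 (negPf z0) orbF => /eqP ->.
split.
- move=> u /repr [x [y [w ->]]] nz; rewrite qE; apply: HC.
  by apply: contraNneq nz => ->; rewrite mul0mx.
- move=> u /repr [x [y [w ->]]] hb.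
  have x0 : x = 0.
    apply/rowP => j; have := hb (row_mx (row_mx 0 (delta_mx 0 j)) 0 *m B) (inxi _ _).
    by rewrite bE mul0mx [X in _ + X]mxE addr0 trmx_delta -colE !mxE => ->.
  have y0 : y = 0.
    apply/rowP => j; have := hb (row_mx (row_mx (delta_mx 0 j) 0) 0 *m B) (inxi _ _).
    by rewrite bE trmx0 mulmx0 [X in X + _]mxE add0r -rowE !mxE => ->.
  by rewrite x0 y0 row_mx0 dsE eWi submxMl.
- move=> u w; rewrite eWi => /submxP [c ->] /repr [x' [y' [w' ->]]].
  rewrite -dsE -(@row_mx0 _ 1 R.+1 R.+1) bE mul0mx trmx0 mulmx0.
  by rewrite mxE addr0.
- rewrite eWi -(eqmxP eB); apply/row_subP => i.
  by rewrite rowE -dsE submxMl.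
- rewrite eWi; apply/eqP; rewrite -/(row_free (dsubmx B)) -kermx_eq0.
  apply/eqP/row_matrixP => i; rewrite row0.
  set k := row i _.
  have : row_mx 0 k *m B = 0 *m B by rewrite mul0mx dsE /k -row_mul mulmx_ker row0.
  by move=> /(row_free_inj fB); rewrite -[RHS]row_mx0 => /eq_row_mx [].
Qed.

End Cones.

(** * Collinearity *)

Lemma oppmx_sub (K : fieldType) m n (u : 'rV[K]_n) (S : 'M[K]_(m, n)) :
  u <=m S -> - u <=m S.
Proof. by rewrite eqmx_opp. Qed.

Lemma subZi (K : fieldType) m n c (u : 'rV[K]_n) (S : 'M[K]_(m, n)) :
  c != 0 -> c *: u <=m S -> u <=m S.
Proof. by move=> c0; rewrite (eqmx_scale u c0). Qed.

Ltac insub := repeat first [assumption | apply: addmx_sub | apply: scalemx_sub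
  | apply: oppmx_sub | apply: sub0mx].

Section Geometry.
Variables (K : fieldType) (N : nat).
Local Notation vec := 'rV[K]_(N.+1).
Local Notation sub := 'M[K]_(N.+1).
Variables (X Z : vec -> Prop) (Y : sub) (Xi Theta : sub -> Prop).
Variables (mv mv' r' : nat).

(** Unlike [XuY] this admits the zero vector, so that it is the zero set of the form on a whole
    member. *)
Definition XY (u : vec) : Prop := X u \/ u <=m Y.
Local Notation C := XY.
Definition quad (z H : sub) : Prop := forall u, u <=m z -> (C u <-> qf H u = 0).
Definition member (z : sub) : Prop := Xi z \/ Theta z.

Record xi_data (xi H : sub) : Prop := XiData {
  xi_quad : quad xi H;
  xi_rad : forall u, u <=m xi -> (forall w, w <=m xi -> bf H u w = 0) -> u <=m Y;
  xi_vertex : forall u w, u <=m xi -> u <=m Y -> w <=m xi -> bf H u w = 0;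
  xi_rankV : \rank (Y :&: xi)%MS = mv;
  xi_rank : \rank xi = (4 + mv)%N;
  xi_tangent : forall u, u <=m xi -> ~ u <=m Y -> exists l : vec,
    [/\ l <=m xi, qf H l = 0, bf H u l = 0 &
        forall s t, s *: u + t *: l <=m Y -> s = 0 /\ t = 0] }.

(** [th_max] is the form in which the maximality of the generator gets used: [Y :&: th] contains its
    orthogonal complement in [th]. *)
Record theta_data (th H V S : sub) : Prop := ThetaData {
  th_quad : quad th H;
  th_rad : forall u, u <=m th -> (forall w, w <=m th -> bf H u w = 0) -> u <=m V;
  th_vertex : forall u w, u <=m V -> w <=m th -> bf H u w = 0;
  th_max : forall u, u <=m th ->
     (forall w, w <=m th -> w <=m Y -> bf H u w = 0) -> u <=m Y;
  th_subY : (S + V == Y :&: th)%MS;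
  th_capSV : (S :&: V == (0 : sub))%MS;
  th_rankS : \rank S = r'.+1;
  th_rankV : \rank V = mv';
  th_rank : \rank th = (r'.+1 + r'.+1 + mv')%N;
  th_Z : forall u, u <=m th -> (Z u <-> u != 0 /\ (u <=m V \/ u <=m S)) }.

(* The ranks mv, mv' stand for v + 1 and v' + 1. *)
Record geom : Prop := Geom {
  g_K : exists a : K, a != 0 /\ a != 1;
  g_r : (1 < r')%N;
  g_XZ : forall c u, c != 0 -> X u -> X (c *: u);
  g_XY : forall u, X u -> ~ u <=m Y;
  g_xi : forall xi, Xi xi -> exists H, xi_data xi H;
  g_th : forall th, Theta th -> exists H V S, theta_data th H V S;
  g_S1 : forall p q, X p -> X q \/ Z q ->
     exists z, [/\ member z, p <=m z & q <=m z];
  g_S2 : forall z z', member z -> member z' -> ~ (z == z')%MS ->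
     forall u, u <=m z -> u <=m z' -> C u;
  g_S3 : forall x, X x -> exists xi1 xi2 T1 T2,
     [/\ Xi xi1, Xi xi2, is_span (sing_line_pts X Y x xi1) T1,
         is_span (sing_line_pts X Y x xi2) T2 &
         is_span (sing_line_pts X Y x 1%:M) (T1 + T2)%MS] }.

Hypothesis G : geom.
Implicit Types (u w x y p q l d m e : vec) (s t c : K) (z H : sub).

Lemma XCn u : C u -> ~ u <=m Y -> X u.
Proof. by case. Qed.
Lemma X_C u : X u -> C u. Proof. by left. Qed.
Lemma Y_C u : u <=m Y -> C u. Proof. by right. Qed.

Lemma XZi c u : c != 0 -> X (c *: u) -> X u.
Proof.
by move=> c0 h; rewrite -[u]scale1r -(mulVf c0) -scalerA; apply: (g_XZ G) => //; rewrite invr_eq0.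
Qed.

Lemma member_quad z : member z -> exists H, quad z H.
Proof.
case=> [/(g_xi G) [H hH]|/(g_th G) [H [V [S hH]]]]; exists H.
  exact: xi_quad hH.
exact: th_quad hH.
Qed.

Lemma uniq_member z z' p q : member z -> member z' -> p <=m z -> q <=m z ->
  p <=m z' -> q <=m z' -> ~ C (p + q) -> (z == z')%MS.
Proof.
move=> mz mz' pz qz pz' qz' nC; apply/negPn/negP => ne; apply: nC.
by apply: (g_S2 G mz mz') => //; [apply/negP | insub | insub].
Qed.

(** In a member on [p] and [q] the form takes the value [s * t * bf H p q] at this combination, so
    the single point [p + q] decides about the whole line. This is why collinearity is written
    [C (p + q)] throughout. *)
Lemma colX p q s t : X p -> X q -> C (p + q) -> C (s *: p + t *: q).
Proof.
move=> Xp Xq Cpq; have [z [mz pz qz]] := g_S1 G Xp (or_introl Xq).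
have [H hq] := member_quad mz.
have h1 : qf H p = 0 by apply/hq => //; left.
have h2 : qf H q = 0 by apply/hq => //; left.
have h3 : bf H p q = 0.
  have /hq : (p + q <=m z) by insub.
  by case=> /(_ Cpq) + _; rewrite qfD h1 h2 !add0r.
by apply/hq; [insub | rewrite !formE h1 h2 h3; ring].
Qed.

Lemma colXY x y t : X x -> y <=m Y -> X (x + y) -> X (x + t *: y).
Proof.
move=> Xx Yy Xxy; apply: XCn; last first.
  move=> h; apply: (g_XY G Xx); rewrite -[x](addrK (t *: y)); insub.
have -> : x + t *: y = (1 - t) *: x + t *: (x + y).
  by rewrite scalerDr addrA -scalerDl subrK scale1r.
apply: colX => //.
have [z [mz pz qz]] := g_S1 G Xx (or_introl Xxy).
have [H hq] := member_quad mz.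
have h1 : qf H x = 0 by apply/hq => //; left.
have yz : y <=m z by rewrite -(addKr x y) addrC; insub.
have h2 : qf H y = 0 by apply/hq => //; right.
have h3 : bf H x y = 0.
  by move: (hq _ qz) => -[/(_ (X_C Xxy)) + _]; rewrite qfD h1 h2 !add0r.
by apply/hq; [insub | rewrite !formE bf_diag h1 h2 h3; ring].
Qed.

(* x + ch x is the fibre of X over x in the projection from Y. *)
Definition ch x u : Prop := u <=m Y /\ X (x + u).

Lemma ch_Y x u : ch x u -> u <=m Y. Proof. by case. Qed.
Lemma ch0 x : X x -> ch x 0.
Proof. by move=> Xx; split; [exact: sub0mx | rewrite addr0]. Qed.
Lemma chZ c x u : X x -> ch x u -> ch x (c *: u).
Proof. by move=> Xx [uY Xu]; split; [insub | apply: colXY]. Qed.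
Lemma chN x u : X x -> ch x u -> ch x (- u).
Proof. by move=> Xx; rewrite -scaleN1r; apply: chZ. Qed.
Lemma chD x u w : X x -> ch x u -> ch x w -> ch x (u + w).
Proof.
move=> Xx hu hw; split; first by insub; [case: hu | case: hw].
(* [x + u + w] is a point of the line joining [x + u'] and [x + w'], where [u' = u / (1 - a)] and
   [w' = w / a]. *)
have [a [a0 a1]] := g_K G.
have b0 : 1 - a != 0 by rewrite subr_eq0 eq_sym.
have /= [hu1 hu2] := chZ (1 - a)^-1 Xx hu.
have /= [hw1 hw2] := chZ a^-1 Xx hw.
set u' := _ *: u in hu1 hu2; set w' := _ *: w in hw1 hw2.
have : X ((x + u') + a *: (w' - u')).
  apply: colXY => //; first by insub.
  by rewrite [w' - u']addrC addrA addrK.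
have -> : u = (1 - a) *: u' by rewrite scalerA mulfV // scale1r.
have -> : w = a *: w' by rewrite scalerA mulfV // scale1r.
congr (X _); rewrite -addrA; congr (_ + _).
by rewrite scalerBl scale1r scalerBr addrCA addrC.
Qed.

Lemma chi_mx x : X x -> exists E : sub, forall u, u <=m E <-> ch x u.
Proof.
move=> Xx; apply: subspace_of_pred.
- exact: ch0.
- by move=> u w; apply: chD.
- by move=> c u; apply: chZ.
Qed.

Lemma ch_scale s x u : s != 0 -> X x -> (ch (s *: x) u <-> ch x u).
Proof.
move=> s0 Xx; split=> -[uY Xu].
  have := chZ s Xx; move=> h.
  have : ch x (s^-1 *: u).
    split; first by insub.
    apply: (XZi s0); by rewrite scalerDr scalerA mulfV // scale1r.
  by move=> /h; rewrite scalerA mulfV // scale1r.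
split=> //; have [_ h] : ch x (s^-1 *: u) by apply: chZ.
have := g_XZ G s0 h; by rewrite scalerDr scalerA mulfV // scale1r.
Qed.

Lemma ch_shift x w u : X x -> ch x w -> (ch (x + w) u <-> ch x u).
Proof.
move=> Xx hw; split=> -[uY Xu].
  have : ch x (w + u) by split; [case: hw => *; insub | rewrite addrA].
  by move=> /(chD Xx (chN Xx hw)); rewrite addKr.
by split=> //; rewrite -addrA; have [] := chD Xx hw (conj uY Xu).
Qed.

Lemma ch_C x u : X x -> u <=m Y -> C (x + u) -> ch x u.
Proof.
move=> Xx uY [] // h; case: (g_XY G Xx).
by rewrite -[x](addrK u); insub.
Qed.

(* If a member of the family contains x and y in X that are not collinear, it
   is closed under taking points collinear with both: joining points of the
   lines px and py meets the line xy in a third point, which is not in XY. *)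
Lemma convex z x y p : member z -> X x -> X y -> ~ C (x + y) ->
  x <=m z -> y <=m z -> C p -> C (p + x) -> C (p + y) -> p <=m z.
Proof.
move=> mz Xx Xy nC xz yz Cp Cpx Cpy.
have [H hq] := member_quad mz.
have hx : qf H x = 0 by apply/hq => //; left.
have hy : qf H y = 0 by apply/hq => //; left.
have hb : bf H x y != 0.
  apply/eqP => h; apply: nC; apply/hq; first by insub.
  by rewrite qfD hx hy h !addr0.
(* If [p] is in [X], the points [q + p] and [q + a p] cannot both lie in [Y], as their difference is
   a multiple of [p]. *)
have move_off q : X q -> C (p + q) -> exists s, s != 0 /\ X (q + s *: p).
  move=> Xq Cpq; case: Cp => [Xp|Yp].
    have [a [a0 a1]] := g_K G.
    have Cs s : C (q + s *: p).
      by rewrite -[q]scale1r; apply: colX => //; rewrite addrC.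
    case: (Cs 1) => [h|h1]; first by exists 1; rewrite oner_eq0.
    case: (Cs a) => [h|h2]; first by exists a.
    case: (g_XY G Xp); apply: (@subZi _ _ _ (a - 1)); first by rewrite subr_eq0.
    have -> : (a - 1) *: p = (q + a *: p) - (q + 1 *: p).
      by rewrite opprD addrACA subrr add0r scalerBl.
    by insub.
  exists 1; rewrite oner_eq0 scale1r; split=> //.
  by have [] : ch q p by apply: ch_C; rewrite // addrC.
have [s [s0 Xs]] := move_off x Xx Cpx; have [t [t0 Xt]] := move_off y Xy Cpy.
have [z' [mz' sz' tz']] := g_S1 G Xs (or_introl Xt).
have [/andP [_ e]|ne] := boolP (z == z')%MS.
  have sz := submx_trans sz' e.
  by apply: (subZi s0); rewrite -(addKr x (s *: p)) addrC; insub.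
have /hq : t *: x - s *: y <=m z by insub.
case=> + _.
have h : C (t *: x - s *: y).
  apply: (g_S2 G mz mz') => //; [exact/negP | by insub |].
  have -> : t *: x - s *: y = t *: (x + s *: p) - s *: (y + t *: p).
    rewrite !scalerDr opprD !scalerA (mulrC t s) addrACA.
    by rewrite subrr addr0.
  by insub.
move=> /(_ h); rewrite !formE hx hy !mulr0 !add0r => /eqP.
by rewrite ?mulrN ?mulNr oppr_eq0 !mulf_eq0 (negPf hb) (negPf s0) (negPf t0).
Qed.

(* Collinear points of X that remain distinct in the projection from Y. *)
Definition adj x l : Prop :=
  [/\ X x, X l, C (x + l) & forall s t, s *: x + t *: l <=m Y -> s = 0 /\ t = 0].

Lemma adj_sym x l : adj x l -> adj l x.
Proof.
case=> Xx Xl c i; split=> //; first by rewrite addrC.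
by move=> s t; rewrite addrC => /i [].
Qed.

Lemma adj_X x l s t : adj x l -> (s != 0) || (t != 0) -> X (s *: x + t *: l).
Proof.
case=> Xx Xl c i h; apply: XCn; first exact: colX.
by move=> /i [s0 t0]; move: h; rewrite s0 t0 eqxx.
Qed.

Lemma adj_comb x l s t s' t' : adj x l -> s * t' - t * s' != 0 ->
  adj (s *: x + t *: l) (s' *: x + t' *: l).
Proof.
move=> a d; have [Xx Xl c i] := a; split.
- apply: adj_X => //; apply: contraNT d; rewrite negb_or !negbK => /andP [/eqP -> /eqP ->].
  by rewrite !mul0r subrr.
- apply: adj_X => //; apply: contraNT d; rewrite negb_or !negbK => /andP [/eqP -> /eqP ->].
  by rewrite !mulr0 subrr.
- by rewrite addrACA -!scalerDl; apply: colX.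
move=> p q; rewrite !scalerDr !scalerA addrACA -!scalerDl => /i [h1 h2].
have hp : p * (s * t' - t * s') = 0.
  have -> : p * (s * t' - t * s') = t' * (p * s + q * s') - s' * (p * t + q * t') by ring.
  by rewrite h1 h2; ring.
have hq : q * (s * t' - t * s') = 0.
  have -> : q * (s * t' - t * s') = s * (p * t + q * t') - t * (p * s + q * s') by ring.
  by rewrite h1 h2; ring.
move/eqP: hp; move/eqP: hq; rewrite !mulf_eq0 (negPf d) !orbF.
by move=> /eqP -> /eqP ->.
Qed.

(** The sum is [2 x + d]: a multiple of a point of the fibre if 2 is invertible, and the point [d]
    of [Y] in characteristic 2. *)
Lemma ch_self x d : X x -> ch x d -> C (x + (x + d)).
Proof.
move=> Xx hd; rewrite addrA -mulr2n -scaler_nat.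
have [e2|n2] := eqVneq (2%:R : K) 0.
  by right; rewrite e2 scale0r add0r; case: hd.
left; have [_ h] := chZ (2%:R)^-1 Xx hd.
by have := g_XZ G n2 h; rewrite scalerDr scalerA mulfV // scale1r.
Qed.

(** Assuming the contrary makes [x + d] and [l] non-collinear, and it is this that brings [x], [l]
    and [d] into one member by [convex]. There all values and products of the three vectors vanish,
    so [C (x + l + d)] holds after all. *)
Lemma ch_triangle1 x l d : adj x l -> ch x d -> ch l d -> ch (x + l) d.
Proof.
move=> a hx hl; have [Xx Xl c i] := a.
have dY := ch_Y hx.
have Xxl : X (x + l) by rewrite -[x]scale1r -[l]scale1r; apply: adj_X => //; rewrite oner_eq0.
apply: ch_C => //.
apply: NNPP => nC; apply: (nC).
have [_ Xxd] := hx; have [_ Xld] := hl.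
have nC' : ~ C (x + d + l) by rewrite -addrA [d + l]addrC addrA.
have [z [mz pz lz]] := g_S1 G Xxd (or_introl Xl).
have xz : x <=m z.
  apply: (convex mz Xxd Xl nC') => //; first by left.
  exact: ch_self.
have dz : d <=m z by rewrite -(addKr x d) addrC; insub.
have [H hq] := member_quad mz.
have h1 : qf H x = 0 by apply/hq => //; left.
have h2 : qf H l = 0 by apply/hq => //; left.
have h3 : qf H d = 0 by apply/hq => //; right.
have h4 : bf H x d = 0.
  by move: (hq _ pz) => -[/(_ (X_C Xxd)) + _]; rewrite qfD h1 h3 !add0r.
have h5 : bf H l d = 0.
  have /hq [/(_ (X_C Xld)) + _] : l + d <=m z by insub.
  by rewrite qfD h2 h3 !add0r.
have h6 : bf H x l = 0.
  have /hq [/(_ (X_C Xxl)) + _] : x + l <=m z by insub.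
  by rewrite qfD h1 h2 !add0r.
by apply/hq; [insub | rewrite !formE h1 h2 h3 h4 h5 h6 !addr0].
Qed.

Lemma ch_triangle x l d s t : adj x l -> ch x d -> ch l d ->
  (s != 0) || (t != 0) -> ch (s *: x + t *: l) d.
Proof.
move=> a hx hl; have [Xx Xl _ i] := a.
have [->|s0] := eqVneq s 0.
  by rewrite /= scale0r add0r => t0; apply/ch_scale.
have [->|t0] := eqVneq t 0.
  by rewrite /= scale0r addr0 => _; apply/ch_scale.
move=> _; apply: ch_triangle1; try by apply/ch_scale.
have := @adj_comb x l s 0 0 t a; rewrite !scale0r addr0 add0r; apply.
by rewrite mul0r subr0 mulf_neq0.
Qed.

Lemma ch_line x l d s t : adj x l -> ch l d -> s != 0 ->
  ch (s *: x + t *: l) d -> ch x d.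
Proof.
move=> a hl s0 hu; have [Xx Xl _ i] := a.
have a' : adj (s *: x + t *: l) l.
  have := @adj_comb x l s t 0 1 a; rewrite scale0r add0r scale1r; apply.
  by rewrite mulr1 mulr0 subr0.
have := @ch_triangle _ _ d s^-1 (- (s^-1 * t)) a' hu hl.
rewrite invr_eq0 s0 scalerDr !scalerA mulVf // scale1r scaleNr addrK.
exact.
Qed.

(** The argument of [ch_triangle1], with a third point [m] of [X] in place of [d]. *)
Lemma tri_C x l m : adj x l -> X m -> C (x + m) -> C (l + m) -> C (x + l + m).
Proof.
move=> a Xm Cxm Clm; have [Xx Xl c i] := a.
apply: NNPP => nC; apply: (nC).
have Xxl : X (x + l) by rewrite -[x]scale1r -[l]scale1r; apply: adj_X => //; rewrite oner_eq0.
have [z [mz pz qz]] := g_S1 G Xxl (or_introl Xm).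
have xz : x <=m z.
  apply: (convex mz Xxl Xm nC) => //; first by left.
  rewrite addrA -[x + x]mulr2n -scaler_nat -[l]scale1r; exact: colX.
have lz : l <=m z by rewrite -(addKr x l) addrC; insub.
have [H hq] := member_quad mz.
have h1 : qf H x = 0 by apply/hq => //; left.
have h2 : qf H l = 0 by apply/hq => //; left.
have h3 : qf H m = 0 by apply/hq => //; left.
have h4 : bf H x m = 0.
  have /hq [/(_ Cxm) + _] : x + m <=m z by insub.
  by rewrite qfD h1 h3 !add0r.
have h5 : bf H l m = 0.
  have /hq [/(_ Clm) + _] : l + m <=m z by insub.
  by rewrite qfD h2 h3 !add0r.
have h6 : bf H x l = 0.
  have /hq [/(_ (X_C Xxl)) + _] : x + l <=m z by insub.
  by rewrite qfD h1 h2 !add0r.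
by apply/hq; [insub | rewrite !formE h1 h2 h3 h4 h5 h6 !addr0].
Qed.

End Geometry.

(** * Members of the two families *)

Section Independence.
Variables (K : fieldType) (n : nat).
Implicit Types (x l m u : 'rV[K]_n) (S : 'M[K]_n).

Definition ind2 S x l := forall s t : K, s *: x + t *: l <=m S -> s = 0 /\ t = 0.
Definition ind3 S x l m := forall s t k : K,
  s *: x + t *: l + k *: m <=m S -> [/\ s = 0, t = 0 & k = 0].

Lemma rank_indep k k' (A : 'M[K]_(k, n)) (V : 'M[K]_(k', n)) :
  (forall a : 'rV_k, a *m A <=m V -> a = 0) -> \rank (A + V)%MS = (k + \rank V)%N.
Proof.
move=> h.
have fA : \rank A = k.
  apply/eqP; rewrite -/(row_free A) -kermx_eq0; apply/eqP/row_matrixP => i; rewrite row0.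
  by apply: h; rewrite -row_mul mulmx_ker row0 sub0mx.
have c0 : (A :&: V)%MS = 0.
  apply/eqP; rewrite -submx0; apply/rV_subP => u; rewrite sub_capmx => /andP [].
  by move=> /submxP [a ->] /h ->; rewrite mul0mx sub0mx.
by have := mxrank_sum_cap A V; rewrite c0 mxrank0 addn0 fA.
Qed.

Lemma scalar_mx_0 k : 0%:M = 0 :> 'M[K]_k.
Proof. by apply/matrixP => i j; rewrite !mxE mul0rn. Qed.

Lemma ind2_col S x l : ind2 S x l ->
  forall a : 'rV_(1 + 1), a *m col_mx x l <=m S -> a = 0.
Proof.
move=> h a; rewrite -[a]hsubmxK mul_row_col.
rewrite [lsubmx a]mx11_scalar [rsubmx a]mx11_scalar !mul_scalar_mx => /h [h0 h1].
by rewrite h0 h1 !scalar_mx_0 row_mx0.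
Qed.


Lemma solve1 (H M : 'M[K]_n) x :
  (forall s, (forall w, w <=m M -> bf H (s *: x) w = 0) -> s = 0) ->
  forall a, exists y, y <=m M /\ bf H x y = a.
Proof.
move=> h a.
have [|y yM e] := @pairing_onto K n 1 n x (H + H^T) M _ (a%:M).
  move=> b hb; rewrite (mx11_scalar b) (h (b 0 0)) ?scalar_mx_0 //.
  move=> w /submxP [c ->]; rewrite /bf.
  rewrite -mul_scalar_mx -mx11_scalar trmx_mul !mulmxA hb mul0mx mxE //.
by exists y; split; rewrite // /bf e mxE eqxx.
Qed.

Lemma solve2 (H M : 'M[K]_n) x l :
  (forall s t, (forall w, w <=m M -> bf H (s *: x + t *: l) w = 0) -> s = 0 /\ t = 0) ->
  forall a b, exists y, [/\ y <=m M, bf H x y = a & bf H l y = b].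
Proof.
move=> h a b.
have [|y yM e] := @pairing_onto K n (1 + 1) n (col_mx x l) (H + H^T) M _ (col_mx a%:M b%:M).
  move=> c; rewrite -[c]hsubmxK mul_row_col.
  rewrite [lsubmx c]mx11_scalar [rsubmx c]mx11_scalar !mul_scalar_mx => hb.
  have [|-> ->] := h (lsubmx c 0 0) (rsubmx c 0 0).
    by move=> w /submxP [d ->]; rewrite /bf trmx_mul !mulmxA hb mul0mx mxE.
  by rewrite !scalar_mx_0 row_mx0.
move: e; rewrite !mul_col_mx => /eq_col_mx [e1 e2].
by exists y; rewrite /bf e1 e2 !mxE eqxx.
Qed.

Lemma solve3 (H M : 'M[K]_n) x l m :
  (forall s t k, (forall w, w <=m M -> bf H (s *: x + t *: l + k *: m) w = 0) ->
     [/\ s = 0, t = 0 & k = 0]) ->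
  forall a b c, exists y, [/\ y <=m M, bf H x y = a, bf H l y = b & bf H m y = c].
Proof.
move=> h a b c.
have [|y yM e] := @pairing_onto K n (1 + (1 + 1)) n (col_mx x (col_mx l m)) (H + H^T) M _
  (col_mx a%:M (col_mx b%:M c%:M)).
  move=> d; rewrite -[d]hsubmxK -[rsubmx d]hsubmxK !mul_row_col.
  rewrite [lsubmx d]mx11_scalar [lsubmx (rsubmx d)]mx11_scalar.
  rewrite [rsubmx (rsubmx d)]mx11_scalar !mul_scalar_mx addrA => hb.
  have [|-> -> ->] := h (lsubmx d 0 0) (lsubmx (rsubmx d) 0 0) (rsubmx (rsubmx d) 0 0).
    by move=> w /submxP [f ->]; rewrite /bf trmx_mul !mulmxA hb mul0mx mxE.
  by rewrite !scalar_mx_0 !row_mx0.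
move: e; rewrite !mul_col_mx => /eq_col_mx [e1 /eq_col_mx [e2 e3]].
by exists y; rewrite /bf e1 e2 e3 !mxE eqxx.
Qed.
End Independence.

(** * Points with prescribed products inside one member *)

Section Members.
Variables (K : fieldType) (N : nat).
Local Notation vec := 'rV[K]_(N.+1).
Local Notation sub := 'M[K]_(N.+1).
Variables (X Z : vec -> Prop) (Y : sub) (Xi Theta : sub -> Prop).
Variables (mv mv' r' : nat).
Hypothesis G : geom X Z Y Xi Theta mv mv' r'.
Local Notation C := (XY X Y).
Local Notation ch := (ch X Y).
Local Notation adj := (adj X Y).
Local Notation theta_data := (theta_data X Z Y mv' r').
Local Notation xi_data := (xi_data X Y mv).
Implicit Types (u w x y p q l d m e : vec) (s t c k : K) (z H th xi V S : sub).

Lemma ind3_13 x l m : ind3 Y x l m -> ind2 Y x m.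
Proof.
by move=> h s t hs; case: (h s 0 t); rewrite ?scale0r ?addr0.
Qed.
Lemma ind3_23 x l m : ind3 Y x l m -> ind2 Y l m.
Proof.
by move=> h s t hs; case: (h 0 s t); rewrite ?scale0r ?add0r.
Qed.
Lemma ind3_perm x l m : ind3 Y x l m -> ind3 Y x m l.
Proof. by move=> h s t k; rewrite addrAC => /h []. Qed.
Lemma adj_ind x l : adj x l -> ind2 Y x l.
Proof. by case. Qed.

Section Theta.
Variables (th H V S : sub).
Hypothesis D : theta_data th H V S.

Lemma th_YY u w : u <=m th -> w <=m th -> u <=m Y -> w <=m Y -> bf H u w = 0.
Proof.
move=> ut wt uY wY.
have q0 v : v <=m th -> v <=m Y -> qf H v = 0.
  by move=> vt vY; apply/(th_quad D) => //; right.
have := q0 (u + w); rewrite qfD !q0 // !add0r; apply; insub.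
Qed.
Lemma th_YQ u : u <=m th -> u <=m Y -> qf H u = 0.
Proof. by move=> ut uY; apply/(th_quad D) => //; right. Qed.
Lemma th_XQ u : u <=m th -> X u -> qf H u = 0.
Proof. by move=> ut uX; apply/(th_quad D) => //; left. Qed.

Lemma th_capY : (forall w, w <=m (Y :&: th)%MS -> w <=m th /\ w <=m Y).
Proof. by move=> w; rewrite sub_capmx => /andP []. Qed.

Lemma th_max_cap u : u <=m th -> (forall w, w <=m (Y :&: th)%MS -> bf H u w = 0) -> u <=m Y.
Proof.
move=> ut h; apply: (th_max D) => // w wt wY; apply: h.
by rewrite sub_capmx wt wY.
Qed.

(** By [th_max] no vector of [th] outside [Y] is orthogonal to [Y :&: th], so the products with
    vectors independent modulo [Y] are free. The values 0 and 1 give a point of [ch x] off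
    [ch l]. *)
Lemma th_solve2 x l : x <=m th -> l <=m th -> ind2 Y x l -> forall a b,
  exists y, [/\ y <=m th, y <=m Y, bf H x y = a & bf H l y = b].
Proof.
move=> xt lt i a b; have [|y [/th_capY [yt yY] e1 e2]] := @solve2 K _ H (Y :&: th)%MS x l _ a b.
  by move=> s t h; apply: i; apply: th_max_cap => //; insub.
by exists y.
Qed.

Lemma th_solve3 x l m : x <=m th -> l <=m th -> m <=m th -> ind3 Y x l m -> forall a b c,
  exists y, [/\ y <=m th /\ y <=m Y, bf H x y = a, bf H l y = b & bf H m y = c].
Proof.
move=> xt lt mt i a b c.
have [|y [/th_capY [yt yY] e1 e2 e3]] := @solve3 K _ H (Y :&: th)%MS x l m _ a b c.
  by move=> s t k h; apply: i; apply: th_max_cap => //; insub.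
by exists y.
Qed.

Lemma th_solve1 x : x <=m th -> ~ x <=m Y -> forall a,
  exists y, [/\ y <=m th, y <=m Y & bf H x y = a].
Proof.
move=> xt i a.
have [|y [/th_capY [yt yY] e1]] := @solve1 K _ H (Y :&: th)%MS x _ a.
  move=> s h; apply/eqP/negPn/negP => s0; apply: i; apply: (subZi s0).
  by apply: th_max_cap => //; insub.
by exists y.
Qed.

Lemma th_X u : u <=m th -> ~ u <=m Y -> qf H u = 0 -> X u.
Proof. by move=> ut uY /(th_quad D ut) []. Qed.

Lemma th_ch x d : X x -> x <=m th -> d <=m th -> d <=m Y -> ch x d <-> bf H x d = 0.
Proof.
move=> Xx xt dt dY; split=> [[_ h]|h].
  have xdt : x + d <=m th by insub.
  by move: (th_XQ xdt h); rewrite qfD (th_XQ xt Xx) (th_YQ dt dY) !add0r.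
apply: (ch_C G) => //; apply/(th_quad D); first by insub.
by rewrite qfD (th_XQ xt Xx) (th_YQ dt dY) h !addr0.
Qed.

Lemma th_col p q : C p -> C q -> p <=m th -> q <=m th -> C (p + q) <-> bf H p q = 0.
Proof.
move=> Cp Cq pt qt.
have pqt : p + q <=m th by insub.
have hp : qf H p = 0 by apply/(th_quad D).
have hq : qf H q = 0 by apply/(th_quad D).
by rewrite (th_quad D pqt) qfD hp hq !add0r.
Qed.

Lemma ind2_shift x u y : y <=m Y -> ind2 Y x u -> ind2 Y x (u + y).
Proof.
move=> yY i s t h; apply: i.
have -> : s *: x + t *: u = s *: x + t *: (u + y) - t *: y by rewrite scalerDr addrA addrK.
insub.
Qed.

Lemma ind2_r x u : ind2 Y x u -> ~ u <=m Y.
Proof. by move=> i h; case: (i 0 1); rewrite ?scale0r ?scale1r ?add0r // => _ /eqP; rewrite oner_eq0. Qed.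

(** Since [Y :&: th] is totally isotropic, adding [y] changes [qf H u] by [bf H u y] and [bf H x u]
    by [bf H x y]. Two linear conditions on [y] therefore put [u + y] on the quadric and make it
    orthogonal to [x]. *)
Lemma th_adj x u : x <=m th -> u <=m th -> X x -> ind2 Y x u ->
  exists y, [/\ y <=m th, y <=m Y & adj x (u + y)].
Proof.
move=> xt ut Xx i.
have [y [yt yY e1 e2]] := th_solve2 xt ut i (- bf H x u) (- qf H u).
have i' := ind2_shift yY i.
have q0 : qf H (u + y) = 0 by rewrite qfD (th_YQ yt yY) e2 addr0 subrr.
have Xu : X (u + y) by apply: th_X => //; [insub | exact: ind2_r i'].
exists y; split=> //; split=> //.
apply/th_col => //; try by left.
  by insub.
by rewrite bfDr e1 subrr.
Qed.

Lemma th_adj2 x m u : x <=m th -> m <=m th -> u <=m th -> X x -> X m -> ind3 Y x m u ->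
  exists y, [/\ y <=m th, y <=m Y, adj x (u + y) & adj m (u + y)].
Proof.
move=> xt mt ut Xx Xm i.
have [y [[yt yY] e1 e2 e3]] := th_solve3 xt mt ut i (- bf H x u) (- bf H m u) (- qf H u).
have i' := ind2_shift yY (ind3_13 i).
have i'' := ind2_shift yY (ind3_23 i).
have q0 : qf H (u + y) = 0 by rewrite qfD (th_YQ yt yY) e3 addr0 subrr.
have ut' : u + y <=m th by insub.
have Xu : X (u + y) by apply: th_X => //; exact: ind2_r i'.
exists y; split=> //; split=> //.
  by apply/th_col => //; [left | left | rewrite bfDr e1 subrr].
by apply/th_col => //; [left | left | rewrite bfDr e2 subrr].
Qed.

Lemma th_noncol x l : x <=m th -> l <=m th -> X x -> X l -> ind2 Y x l ->
  exists d, [/\ d <=m th, ch x d & ~ ch l d].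
Proof.
move=> xt lt Xx Xl i.
have [y [yt yY e1 e2]] := th_solve2 xt lt i 0 1.
exists y; split=> //; first exact/th_ch.
by move/(th_ch Xl lt yt yY)/eqP; rewrite e2 oner_eq0.
Qed.

Lemma th_noncol1 l : l <=m th -> X l -> exists d, [/\ d <=m th, d <=m Y & ~ ch l d].
Proof.
move=> lt Xl; have [y [yt yY e]] := th_solve1 lt (g_XY G Xl) 1.
exists y; split=> //.
by move/(th_ch Xl lt yt yY)/eqP; rewrite e oner_eq0.
Qed.

End Theta.

Section XiLemmas.
Variables (xi H : sub).
Hypothesis D : xi_data xi H.

Lemma xi_XQ u : u <=m xi -> C u -> qf H u = 0.
Proof. by move=> ut uX; apply/(xi_quad D). Qed.

Lemma xi_col p q : C p -> C q -> p <=m xi -> q <=m xi -> C (p + q) <-> bf H p q = 0.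
Proof.
move=> Cp Cq pt qt.
have pqt : p + q <=m xi by insub.
have hp : qf H p = 0 by apply/(xi_quad D).
have hq : qf H q = 0 by apply/(xi_quad D).
by rewrite (xi_quad D pqt) qfD hp hq !add0r.
Qed.

(** Here [Y] meets the member in the radical of its form. The contrast with [th_noncol] is what
    tells the two families apart. *)
Lemma xi_ch x d : X x -> x <=m xi -> d <=m xi -> d <=m Y -> ch x d.
Proof.
move=> Xx xt dt dY; apply: (ch_C G) => //; apply/xi_col => //; [by left | by right |].
by rewrite bfC; apply: (xi_vertex D).
Qed.

(** Together with some [m0] such that [bf H x m0 = 1], the vectors [x], [l], [n] and the vertex have
    rank [4 + mv], that of [xi]; the coefficient of [m0] in [u] is [bf H x u]. *)
Lemma xi_perp x l n u : x <=m xi -> l <=m xi -> n <=m xi -> adj x l -> adj x n ->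
  ~ C (l + n) -> u <=m xi -> bf H x u = 0 ->
  exists s t k w, w <=m Y /\ u = s *: x + t *: l + k *: n + w.
Proof.
move=> xt lt nt al an nC ut xu.
have [Xx Xl cl il] := al; have [_ Xn cn jn] := an.
have bxl : bf H x l = 0 by apply/xi_col => //; left.
have bxn : bf H x n = 0 by apply/xi_col => //; left.
have bln : bf H l n != 0 by apply/eqP => /xi_col h; apply: nC; apply: h => //; left.
have bxx : bf H x x = 0 by rewrite bf_diag xi_XQ ?mul0rn //; left.
have bll : bf H l l = 0 by rewrite bf_diag xi_XQ ?mul0rn //; left.
have bnn : bf H n n = 0 by rewrite bf_diag xi_XQ ?mul0rn //; left.
have [m0 [mt xm]] : exists m0, m0 <=m xi /\ bf H x m0 = 1.
  apply: solve1 => s h; apply/eqP/negPn/negP => s0; apply: (g_XY G Xx).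
  apply: (subZi s0); apply: (xi_rad D) => //; insub.
have bV w v : w <=m (Y :&: xi)%MS -> v <=m xi -> bf H w v = 0.
  by rewrite sub_capmx => /andP [wY wt] vt; apply: (xi_vertex D).
have ind : forall a : 'rV_(1 + (1 + (1 + 1))),
    a *m col_mx x (col_mx l (col_mx n m0)) <=m (Y :&: xi)%MS -> a = 0.
  move=> a; rewrite -[a]hsubmxK -[rsubmx a]hsubmxK -[rsubmx (rsubmx a)]hsubmxK !mul_row_col.
  rewrite [lsubmx a]mx11_scalar [lsubmx (rsubmx a)]mx11_scalar.
  rewrite [lsubmx (rsubmx (rsubmx a))]mx11_scalar.
  rewrite [rsubmx (rsubmx (rsubmx a))]mx11_scalar !mul_scalar_mx !addrA.
  move: (_ 0 0) (_ 0 0) (_ 0 0) (_ 0 0) => f k t s h.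
  have f0 : f = 0.
    have := bV _ _ h xt; rewrite !formE bxx (bfC H l) (bfC H n) (bfC H m0) bxl bxn xm => E0; rewrite -E0.  ring.
  move: h; rewrite f0 scale0r addr0 => h.
  have k0 : k = 0.
    have /eqP := bV _ _ h lt; rewrite !formE bxl bll (bfC H n) !mulr0 !add0r.
    by rewrite mulf_eq0 (negPf bln) orbF => /eqP.
  move: h; rewrite k0 scale0r addr0 => h.
  have [-> ->] := il s t (submx_trans h (capmxSl _ _)).
  by rewrite !scalar_mx_0 !row_mx0.
have sub1 : (col_mx x (col_mx l (col_mx n m0)) + (Y :&: xi) <= xi)%MS.
  by rewrite addsmx_sub !col_mx_sub xt lt nt mt capmxSr.
have rk := rank_indep ind.
have full : (xi <= col_mx x (col_mx l (col_mx n m0)) + (Y :&: xi))%MS.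
  by rewrite -(geq_leqif (mxrank_leqif_sup sub1)) rk (xi_rank D) (xi_rankV D).
have /sub_addsmxP [[a b] /=] := submx_trans ut full.
rewrite -[a]hsubmxK -[rsubmx a]hsubmxK -[rsubmx (rsubmx a)]hsubmxK !mul_row_col.
rewrite [lsubmx a]mx11_scalar [lsubmx (rsubmx a)]mx11_scalar.
rewrite [lsubmx (rsubmx (rsubmx a))]mx11_scalar.
rewrite [rsubmx (rsubmx (rsubmx a))]mx11_scalar !mul_scalar_mx !addrA.
move: (_ 0 0) (_ 0 0) (_ 0 0) (_ 0 0) => f k t s E.
have bY : b *m (Y :&: xi)%MS <=m (Y :&: xi)%MS by exact: submxMl.
exists s, t, k, (b *m (Y :&: xi)%MS); split; first exact: submx_trans bY (capmxSl _ _).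
suff f0 : f = 0 by rewrite E f0 scale0r addr0.
rewrite -xu E !formE bxx bxl bxn xm (bfC H x) bV //; ring.
Qed.

End XiLemmas.
End Members.

(** * The residue at a point *)

Section Residue.
Variables (K : fieldType) (N : nat).
Local Notation vec := 'rV[K]_(N.+1).
Local Notation sub := 'M[K]_(N.+1).
Variables (X Z : vec -> Prop) (Y : sub) (Xi Theta : sub -> Prop).
Variables (mv mv' r' : nat).
Hypothesis G : geom X Z Y Xi Theta mv mv' r'.
Local Notation C := (XY X Y).
Local Notation ch := (ch X Y).
Local Notation adj := (adj X Y).
Local Notation member := (member Xi Theta).
Local Notation theta_data := (theta_data X Z Y mv' r').
Implicit Types (u w x y p q l d m n e g : vec) (s t c k : K) (z H th xi V S : sub).

Definition on_theta x l n := exists th, [/\ Theta th, x <=m th, l <=m th & n <=m th].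
Definition on_xi x l n := exists xi,
  [/\ Xi xi, x <=m xi, l <=m xi & n <=m xi] /\ ~ C (l + n).

(** Otherwise [d] would be in [ch (x + l)] and in [ch x], hence by [ch_line] in [ch l]. *)
Lemma nC_ch x l d : adj x l -> ch x d -> ~ ch l d -> ~ C (x + d + l).
Proof.
move=> a hx hl h; apply: hl; have [Xx Xl c i] := a.
have a1 : adj l (x + l).
  have := @adj_comb _ _ _ _ _ _ _ _ _ _ G x l 0 1 1 1 a.
  rewrite !scale1r scale0r add0r; apply.
  by rewrite mul0r mul1r sub0r oppr_eq0 oner_eq0.
have Xxl : X (x + l) by case: a1.
have hxl : ch (x + l) d by apply: (ch_C G) => //; [case: hx | rewrite addrAC].
apply: (ch_line G (adj_sym a) hx (oner_neq0 _) (t := 1)).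
by rewrite !scale1r addrC.
Qed.

Lemma ch_theta x l d : adj x l -> ch x d -> ~ ch l d ->
  exists th, [/\ Theta th, x <=m th, l <=m th & d <=m th].
Proof.
move=> a hx hl; have [Xx Xl c i] := a; have [dY Xxd] := hx.
have nC := nC_ch a hx hl.
have [z [mz pz lz]] := g_S1 G Xxd (or_introl Xl).
have xz : x <=m z by apply: (convex G mz Xxd Xl nC) => //; [left | apply: (ch_self G)].
have dz : d <=m z by rewrite -(addKr x d) addrC; insub.
exists z; split=> //; case: mz => // Xiz; case: hl.
have [H D] := g_xi G Xiz; exact: (xi_ch G D).
Qed.

Lemma uniq_ch z z' l d : member z -> member z' -> X l -> d <=m Y -> ~ ch l d ->
  l <=m z -> d <=m z -> l <=m z' -> d <=m z' -> (z == z')%MS.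
Proof.
move=> mz mz' Xl dY nd lz dz lz' dz'; apply: (uniq_member G mz mz' lz dz lz' dz').
by move=> h; apply: nd; apply: (ch_C G).
Qed.

Lemma xi_not_theta xi th x : Xi xi -> Theta th -> (xi == th)%MS -> x <=m xi -> X x -> False.
Proof.
move=> hxi hth /eqmxP e xi_x Xx.
have [H D] := g_xi G hxi; have [H' [V [S D']]] := g_th G hth.
have xth : x <=m th by rewrite -e.
have [d [dth dY nd]] := th_noncol1 G D' xth Xx; apply: nd.
by apply: (xi_ch G D) => //; rewrite e.
Qed.

(** With a point [e] of [th] in [ch x] off [ch l], the points [x + e] and [l] of [th] are not
    collinear, while [d] is collinear with both. *)
Lemma ch_sub_theta th x l d : Theta th -> x <=m th -> l <=m th -> adj x l ->
  ch x d -> ch l d -> d <=m th.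
Proof.
move=> hth xt lt a hx hl; have [Xx Xl c i] := a.
have [H [V [S D]]] := g_th G hth.
have [e [et hxe hle]] := th_noncol G D xt lt Xx Xl i.
have [eY Xxe] := hxe.
apply: (convex G (or_intror hth) Xxe Xl (nC_ch a hxe hle)) => //; first by insub.
- by right; case: hx.
- by left; rewrite addrC; have [] : ch (x + e) d by apply/(ch_shift G).
- by left; rewrite addrC; case: hl.
Qed.

(** The lines [xl] and [xp] have the same image in the projection from [Y], that is, they are the
    same point of the residue at [x]. *)
Definition same_dir x l p := exists s t, t != 0 /\ p - (s *: x + t *: l) <=m Y.

Lemma adj_same_dir x l s t : adj x l -> t != 0 -> adj x (s *: x + t *: l).
Proof.
move=> a t0; have := @adj_comb _ _ _ _ _ _ _ _ _ _ G x l 1 0 s t a.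
by rewrite scale1r scale0r addr0; apply; rewrite mul1r mul0r subr0.
Qed.

(** [x + l + (l' - l)] is the sum of the collinear points [x] and [l'], so the difference lies in
    [ch (x + l)] as well as in [ch l]. *)
Lemma adj_diff x l l' : adj x l -> adj x l' -> l' - l <=m Y ->
  ch x (l' - l) /\ ch l (l' - l).
Proof.
move=> a a' hY; have [Xx Xl c i] := a; have [_ Xl' c' i'] := a'.
have E : l + (l' - l) = l' by rewrite addrC subrK.
have hl : ch l (l' - l) by split; rewrite ?E.
split=> //.
have Xxl : X (x + l).
  by have := @adj_X _ _ _ _ _ _ _ _ _ _ G x l 1 1 a; rewrite !scale1r; apply; rewrite oner_eq0.
apply: (ch_line G a hl (oner_neq0 _) (t := 1)).
rewrite !scale1r; apply: (ch_C G) => //.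
by rewrite -addrA E.
Qed.

Lemma theta_same_dir th x l l' : Theta th -> x <=m th -> l <=m th -> adj x l -> adj x l' ->
  same_dir x l l' -> l' <=m th.
Proof.
move=> hth xt lt a a' [s [t [t0 hY]]].
have a2 := adj_same_dir s a t0.
have [h1 h2] := adj_diff a2 a' hY.
rewrite -(subrK (s *: x + t *: l) l'); apply: addmx_sub; last by insub.
by apply: (ch_sub_theta hth xt _ a2) => //; insub.
Qed.

(** Membership in [th] can be tested modulo [Y], and [u] need not be in [X]: [th_adj] moves it
    inside [th] to a point adjacent to [x]. *)
Lemma theta_modY th x p u : Theta th -> x <=m th -> adj x p -> u <=m th ->
  p - u <=m Y -> p <=m th.
Proof.
move=> hth xt a ut hY; have [Xx Xp c i] := a.
have [H [V [S D]]] := g_th G hth.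
have i' : ind2 Y x u.
  have -> : u = p + (- (p - u)) by rewrite opprB addrCA subrr addr0.
  by apply: ind2_shift => //; insub.
have [y [yt yY au]] := th_adj D xt ut Xx i'.
apply: (theta_same_dir hth xt _ au a); first by insub.
exists 0, 1; rewrite oner_eq0 scale0r add0r scale1r opprD addrA; split=> //; insub.
Qed.

Lemma no_theta xi x l n : Xi xi -> x <=m xi -> l <=m xi -> n <=m xi -> X x ->
  ~ C (l + n) -> ~ on_theta x l n.
Proof.
move=> hxi xt lt nt Xx nC [th [hth xth lth nth]].
by apply: (xi_not_theta hxi hth _ xt Xx);
   apply: (uniq_member G (or_introl hxi) (or_intror hth) lt nt lth nth nC).
Qed.

(** Writing [p = s x + t l + k n + w] by [xi_perp], the form gives [t * k * bf H l n = 0]: modulo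
    the vertex [xi] has only the two singular lines [xl] and [xn] on [x]. *)
Lemma xi_third xi x l n p : Xi xi -> x <=m xi -> l <=m xi -> n <=m xi -> p <=m xi ->
  adj x l -> adj x n -> ~ C (l + n) -> adj x p -> ind3 Y x l p -> ind3 Y x n p -> False.
Proof.
move=> hxi xt lt nt pt al an nC ap i3 j3.
have [H D] := g_xi G hxi.
have [Xx Xl _ _] := al; have [_ Xn _ _] := an; have [_ Xp cp _] := ap.
have bxp : bf H x p = 0 by apply/(xi_col D) => //; left.
have bxl : bf H x l = 0 by apply/(xi_col D) => //; [left|left|case: al].
have bxn : bf H x n = 0 by apply/(xi_col D) => //; [left|left|case: an].
have bln : bf H l n != 0 by apply/eqP => h; apply: nC; apply/(xi_col D) => //; left.
have [s [t [k [w [wY E]]]]] := xi_perp G D xt lt nt al an nC pt bxp.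
have wt : w <=m xi.
  have -> : w = p - (s *: x + t *: l + k *: n) by rewrite E addrAC subrr add0r.
  by insub.
have := xi_XQ D pt (X_C Y Xp).
rewrite E !formE bxl bxn (xi_XQ D xt (X_C _ Xx)) (xi_XQ D lt (X_C _ Xl)) (xi_XQ D nt (X_C _ Xn)) (xi_XQ D wt (Y_C _ wY)).
rewrite !(bfC H _ w) !(xi_vertex D wt wY) // !mulr0 !addr0 !add0r => /eqP.
rewrite !mulf_eq0 (negPf bln) orbF => /orP [/eqP k0|/eqP t0]; last first.
- have [] := j3 s k (-1) => [|_ _ /eqP].
    rewrite scaleN1r E t0 scale0r addr0 opprD addrA subrr add0r; insub.
  by rewrite oppr_eq0 oner_eq0.
- have [] := i3 s t (-1) => [|_ _ /eqP].
    rewrite scaleN1r E k0 scale0r addr0 opprD addrA subrr add0r; insub.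
  by rewrite oppr_eq0 oner_eq0.
Qed.

Lemma adj_shift x l d : adj x l -> ch x d -> ch l d -> adj x (l + d).
Proof.
move=> a hx hl; have [Xx Xl c i] := a; split=> //; first by case: hl.
  have [_] := ch_triangle1 G a hx hl; rewrite addrA; exact: X_C.
by apply: ind2_shift => //; case: hl.
Qed.

(* The points lying over l and n are never collinear.  If some were, ch l and
   ch n would meet ch x in the same set (xi_reps_sub), hence in the vertex of
   xi, and moving along the vertex does not affect collinearity. *)
Lemma xi_reps_sub xi x l n d d' g : Xi xi -> x <=m xi -> l <=m xi -> n <=m xi ->
  adj x l -> adj x n -> ~ C (l + n) -> ch x d -> ch l d -> ch x d' -> ch n d' ->
  C (l + d + (n + d')) -> ch x g -> ch l g -> ch n g.
Proof.
move=> hxi xt lt nt al an nC hxd hld hxd' hnd' cc hxg hlg; apply: NNPP => ng.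
have [Xx Xl _ _] := al; have [_ Xn _ _] := an.
have [H D] := g_xi G hxi.
have bln : bf H l n != 0 by apply/eqP => h; apply: nC; apply/(xi_col D) => //; left.
have al' := adj_shift al hxd hld; have an' := adj_shift an hxd' hnd'.
have [_ Xl' cxl' _] := al'; have [_ Xn' cxn' _] := an'.
have ll' : adj (l + d) (n + d').
  split=> // s t h.
  have [dY _] := hld; have [dY' _] := hnd'.
  have h' : s *: l + t *: n <=m Y.
    have -> : s *: l + t *: n = (s *: (l + d) + t *: (n + d')) - (s *: d + t *: d').
      by rewrite !scalerDr opprD addrACA !addrK.
    insub.
  have ht : s *: l + t *: n <=m xi by insub.
  have b1 := xi_vertex D ht h' nt; have b2 := xi_vertex D ht h' lt.
  move: b1 b2; rewrite !formE !bf_diag (xi_XQ D lt (X_C _ Xl)) (xi_XQ D nt (X_C _ Xn)) (bfC H n l).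
  rewrite mul0rn !mulr0 addr0 add0r => /eqP + /eqP.
  by rewrite !mulf_eq0 (negPf bln) !orbF => /eqP -> /eqP ->.
have hl'g : ch (l + d) g by apply/(ch_shift G).
have nn'g : ~ ch (n + d') g by move/(ch_shift G g Xn hnd').
have nC' := nC_ch ll' hl'g nn'g.
have [_ Xl'g] := hl'g; have [gY _] := hlg.
have [z [mz pz nz]] := g_S1 G Xl'g (or_introl Xn').
have xz : x <=m z.
  apply: (convex G mz Xl'g Xn' nC') => //; first by left.
  left; have [_] := ch_triangle1 G al' hxg hl'g; by rewrite !addrA.
have lz : l + d <=m z.
  by apply: (convex G mz Xl'g Xn' nC') => //; [left | apply: (ch_self G)].
have gz : g <=m z by rewrite -(addKr (l + d) g) addrC; insub.
case: (mz) => [hz|hz].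
  have [H' D'] := g_xi G hz.
  by apply: nn'g; apply: (xi_ch G D').
apply: (no_theta hxi xt lt nt Xx nC); exists z; split=> //.
  apply: (theta_modY hz xz al lz).
  by rewrite opprD addrA subrr sub0r; case: hld => *; insub.
apply: (theta_modY hz xz an nz).
by rewrite opprD addrA subrr sub0r; case: hnd' => *; insub.
Qed.

Lemma xi_reps0 xi x l n d d' : Xi xi -> x <=m xi -> l <=m xi -> n <=m xi ->
  adj x l -> adj x n -> ~ C (l + n) -> ch x d -> ch l d -> ch x d' -> ch n d' ->
  ~ C (l + d + (n + d')).
Proof.
move=> hxi xt lt nt al an nC hxd hld hxd' hnd' cc.
have [Xx Xl _ _] := al; have [_ Xn _ _] := an.
have [H D] := g_xi G hxi.
have hnd : ch n d := xi_reps_sub hxi xt lt nt al an nC hxd hld hxd' hnd' cc hxd hld.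
have nC' : ~ C (n + l) by rewrite addrC.
have cc' : C (n + d' + (l + d)) by rewrite addrC.
have hld' : ch l d' := xi_reps_sub hxi xt nt lt an al nC' hxd' hnd' hxd hld cc' hxd' hnd'.
have inxi g : ch l g -> ch n g -> g <=m xi.
  move=> hl hn; apply: (convex G (or_introl hxi) Xl Xn nC) => //.
  - by right; case: hl.
  - by rewrite addrC; left; case: hl.
  - by rewrite addrC; left; case: hn.
have dt := inxi _ hld hnd; have dt' := inxi _ hld' hnd'.
have [dY _] := hld; have [dY' _] := hnd'.
apply: nC; have e : l + d + (n + d') <=m xi by insub.
have lnt : l + n <=m xi by insub.
move: (xi_XQ D e cc).
have ddt : d + d' <=m xi by insub.
have ddY : d + d' <=m Y by insub.
rewrite addrACA qfD (bfC H (l + n)) (xi_vertex D ddt ddY lnt).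
rewrite (xi_XQ D ddt (Y_C _ ddY)) !addr0.
by move/(xi_quad D lnt).
Qed.

Lemma xi_reps xi x l n l' n' : Xi xi -> x <=m xi -> l <=m xi -> n <=m xi ->
  adj x l -> adj x n -> ~ C (l + n) -> adj x l' -> adj x n' ->
  same_dir x l l' -> same_dir x n n' -> ~ C (l' + n').
Proof.
move=> hxi xt lt nt al an nC al' an' [s [t [t0 hl]]] [s' [t' [t0' hn]]].
have [Xx Xl cl _] := al; have [_ Xn cn _] := an.
have bl := adj_same_dir s al t0; have bn := adj_same_dir s' an t0'.
have [h1 h2] := adj_diff bl al' hl; have [h3 h4] := adj_diff bn an' hn.
rewrite -(subrK (s *: x + t *: l) l') -(subrK (s' *: x + t' *: n) n').
rewrite [l' - _ + _]addrC [n' - _ + _]addrC.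
apply: (xi_reps0 hxi xt) => //; try by insub.
have [H D] := g_xi G hxi.
move=> h; apply: nC; apply/(xi_col D) => //; try by left.
have : s *: x + t *: l + (s' *: x + t' *: n) <=m xi by insub.
move=> /(xi_quad D) [/(_ h) + _].
have bxl : bf H x l = 0 by apply/(xi_col D) => //; left.
have bxn : bf H x n = 0 by apply/(xi_col D) => //; left.
rewrite !formE bf_diag (bfC H l x) bxl bxn (xi_XQ D xt (X_C _ Xx)) (xi_XQ D lt (X_C _ Xl)) (xi_XQ D nt (X_C _ Xn)) mul0rn.
rewrite !(mulr0, add0r, addr0) => /eqP.
by rewrite !mulf_eq0 (negPf t0) (negPf t0') !orFb => /eqP.
Qed.

Lemma dep3_same_dir x l m : ind2 Y x l -> ind2 Y x m -> ~ ind3 Y x l m -> same_dir x l m /\ same_dir x m l.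
Proof.
move=> il im ni.
have [s [t [k [hY h]]]] : exists s t k, s *: x + t *: l + k *: m <=m Y /\
    ~ [/\ s = 0, t = 0 & k = 0].
  apply: NNPP => h; apply: ni => s t k hY; apply: NNPP => h'; apply: h.
  by exists s, t, k.
have k0 : k != 0.
  apply/eqP => k0; apply: h; move: hY; rewrite k0 scale0r addr0 => /il [-> ->] //.
have t0 : t != 0.
  apply/eqP => t0; apply: h; move: hY; rewrite t0 scale0r addr0 => /im [-> ->] //.
split.
  exists (- (k^-1 * s)), (- (k^-1 * t)); rewrite oppr_eq0 mulf_neq0 ?invr_eq0 //; split=> //.
  have -> : m - (- (k^-1 * s) *: x + - (k^-1 * t) *: l) = k^-1 *: (s *: x + t *: l + k *: m).
    rewrite !scalerDr !scalerA mulVf // scale1r !scaleNr -opprD opprK addrC //.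
  insub.
exists (- (t^-1 * s)), (- (t^-1 * k)); rewrite oppr_eq0 mulf_neq0 ?invr_eq0 //; split=> //.
have -> : l - (- (t^-1 * s) *: x + - (t^-1 * k) *: m) = t^-1 *: (s *: x + t *: l + k *: m).
  rewrite !scalerDr !scalerA mulVf // scale1r !scaleNr -opprD opprK addrA.
  by rewrite [l + _]addrC.
insub.
Qed.

Lemma ind3_shift x l m y : y <=m Y -> ind3 Y x l m -> ind3 Y x l (m + y).
Proof.
move=> yY i s t k h; apply: i.
have -> : s *: x + t *: l + k *: m = s *: x + t *: l + k *: (m + y) - k *: y.
  by rewrite scalerDr addrA addrK.
insub.
Qed.

(* Otherwise a member of Xi through x would contain three singular lines on x
   modulo its vertex. *)
Lemma theta_chain x l m n : adj x l -> adj x m -> adj x n ->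
  on_theta x l m -> on_theta x m n -> ~ on_xi x l n.
Proof.
move=> al am an [th [hth xt lt mt]] [th' [hth' xt' mt' nt']] [xi [[hxi xxi lxi nxi] nC]].
have [Xx Xl cl il] := al; have [_ Xn cn i_n] := an; have [_ Xm cm im] := am.
have noth := no_theta hxi xxi lxi nxi Xx nC.
have [i1|/(dep3_same_dir im il) [c1 c2]] := classic (ind3 Y x m l); last first.
  by apply: noth; exists th'; split=> //; apply: (theta_same_dir hth' xt' mt' am).
have [i2|/(dep3_same_dir im i_n) [c1 c2]] := classic (ind3 Y x m n); last first.
  by apply: noth; exists th; split=> //; apply: (theta_same_dir hth xt mt am).
have [H [V [S D]]] := g_th G hth; have [H' [V' [S' D']]] := g_th G hth'.
(* [l] and [n] are replaced by points over the same lines that are also adjacent to [m]. They stay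
   non-collinear by [xi_reps], so the member through them contains both [x] and [m]. *)
have [y [yt yY a1 a2]] := th_adj2 D xt mt lt Xx Xm i1.
have [y' [yt' yY' b1 b2]] := th_adj2 D' xt' mt' nt' Xx Xm i2.
have nC' : ~ C (l + y + (n + y')).
  apply: (xi_reps hxi xxi lxi nxi al an nC a1 b1).
    by exists 0, 1; rewrite oner_eq0 scale0r scale1r add0r addrAC subrr add0r.
  by exists 0, 1; rewrite oner_eq0 scale0r scale1r add0r addrAC subrr add0r.
have [_ Xl' cl' _] := a1; have [_ Xn' cn' _] := b1.
have [z [mz lz nz]] := g_S1 G Xl' (or_introl Xn').
have xz : x <=m z by apply: (convex G mz Xl' Xn' nC') => //; left.
have mz' : m <=m z.
  by apply: (convex G mz Xl' Xn' nC') => //; [left | case: a2 | case: b2].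
case: mz => hz.
  apply: (xi_third hz xz lz nz mz' a1 b1 nC' am).
    by apply: ind3_perm; apply: ind3_shift.
  by apply: ind3_perm; apply: ind3_shift.
apply: noth; exists z; split=> //.
  by apply: (theta_modY hz xz al lz); rewrite opprD addrA subrr sub0r; insub.
by apply: (theta_modY hz xz an nz); rewrite opprD addrA subrr sub0r; insub.
Qed.

Lemma th_rankY th H V S : theta_data th H V S -> \rank (Y :&: th)%MS = (r'.+1 + mv')%N.
Proof.
move=> D; rewrite -(eqmxP (th_subY D)) -(th_rankS D) -(th_rankV D).
apply: mxrank_disjoint_sum; apply/eqP; rewrite -submx0.
by case/andP: (th_capSV D).
Qed.

(** The vectors of [th] orthogonal to [e] have corank at most one, so as [r' > 1] they are not all
    in the span of [x] and [Y :&: th]. Since [l] is not orthogonal to [e], a new vector [u] among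
    them is independent of [x] and [l] modulo [Y], and the correction of [u] by a vector of [Y]
    keeps its product with [e]. *)
Lemma th_pick th H V S x l e : theta_data th H V S -> x <=m th -> l <=m th -> e <=m th ->
  adj x l -> ch x e -> ~ ch l e ->
  exists k : vec, [/\ k <=m th, adj x k, adj l k, ch k e & ind3 Y x l k].
Proof.
move=> D xt lt et a hx hl; have [Xx Xl _ i] := a; have [eY _] := hx.
set A := (kermx ((H + H^T) *m e^T) :&: th)%MS.
have [u [uA nu]] : exists u : vec, u <=m A /\ ~ u <=m (x + (Y :&: th))%MS.
  apply: NNPP => h.
  have le : (A <= x + (Y :&: th))%MS.
    by apply/rV_subP => u uA; apply: NNPP => nu; apply: h; exists u.
  have := mxrankS le; have := mxrank_adds_leqif x (Y :&: th)%MS => -[+ _].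
  rewrite (th_rankY D) => h2 h1.
  have := rank_leq_row x => h3.
  have := mxrank_sum_cap (kermx ((H + H^T) *m e^T)) th.
  rewrite -/A mxrank_ker (th_rank D).
  have := rank_leq_col ((H + H^T) *m e^T) => h4.
  have := rank_leq_row (kermx ((H + H^T) *m e^T) + th)%MS => h5 h6.
  have := g_r G; lia.
move: uA; rewrite sub_capmx => /andP [/sub_kermxP uk ut].
have bue : bf H u e = 0 by rewrite /bf -mulmxA uk mxE.
have bxe : bf H x e = 0 by apply/(th_ch G D).
have ble : bf H l e != 0 by apply/eqP => h; apply: hl; apply/(th_ch G D).
have i3 : ind3 Y x l u.
  move=> s t k h.
  have ht : s *: x + t *: l + k *: u <=m th by insub.
  have := th_YY D ht et h eY; rewrite !formE bue bxe !mulr0 add0r addr0 => /eqP.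
  rewrite mulf_eq0 (negPf ble) orbF => /eqP t0; move: h ht; rewrite t0 scale0r addr0 => h ht.
  have k0 : k = 0.
    apply/eqP/negPn/negP => k0; apply: nu; apply/sub_addsv.
    exists (- (k^-1 * s)), (k^-1 *: (s *: x + k *: u)); split.
      by rewrite sub_capmx; apply/andP; split; insub.
    by rewrite scalerDr !scalerA mulVf // scale1r scaleNr addrA addNr add0r.
  move: h; rewrite k0 scale0r addr0 => h.
  by have [|-> _] := i s 0; rewrite ?scale0r ?addr0.
have [y [yt yY a1 a2]] := th_adj2 D xt lt ut Xx Xl i3.
exists (u + y); split=> //; first by insub.
  have [_ Xu _ _] := a1.
  apply/(th_ch G D) => //; first by insub.
  by rewrite bfDl bue (th_YY D) // addr0.
exact: ind3_shift.
Qed.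

(* If l and n are not collinear the member through them contains x. If they
   are, a member through x, l and a point d of ch x off ch l contains n,
   except when ch x meets ch l and ch n in the same set; then a further point k
   of the first member shows that it coincides with a member through x and n. *)
Lemma theta_or_xi x l n e : adj x l -> adj x n -> ch x e -> ~ ch l e ->
  on_theta x l n \/ on_xi x l n.
Proof.
move=> al an hxe hle.
have [Xx Xl cl il] := al; have [_ Xn cn i_n] := an.
have [th1 [hth1 xt1 lt1 et1]] := ch_theta al hxe hle.
have [i3|/(dep3_same_dir il i_n) [c1 _]] := classic (ind3 Y x l n); last first.
  by left; exists th1; split=> //; apply: (theta_same_dir hth1 xt1 lt1 al).
have [cln|nC] := classic (C (l + n)); last first.
  have [z [mz lz nz]] := g_S1 G Xl (or_introl Xn).
  have xz : x <=m z by apply: (convex G mz Xl Xn nC) => //; left.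
  by case: mz => hz; [right; exists z | left; exists z].
have ln : adj l n by split=> //; exact: (ind3_23 i3).
have case1 l1 n1 g : adj x l1 -> adj x n1 -> C (l1 + n1) -> ch x g -> ch l1 g -> ~ ch n1 g ->
    on_theta x l1 n1.
  move=> al1 an1 c1 hxg hlg nng.
  have [th [hth xt nt gt]] := ch_theta an1 hxg nng.
  exists th; split=> //.
  have [_ Xxg] := hxg.
  have [_ Xn1 _ _] := an1; have [_ Xl1 _ _] := al1.
  apply: (convex G (or_intror hth) Xxg Xn1 (nC_ch an1 hxg nng)) => //; first by insub.
    by left.
  have [_ h] := ch_triangle1 G al1 hxg hlg.
  by left; rewrite addrA [l1 + x]addrC.
have [[g [h1 h2 h3]]|no1] := classic (exists g, [/\ ch x g, ch l g & ~ ch n g]).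
  by left; apply: (case1 l n g).
have [[g [h1 h2 h3]]|no2] := classic (exists g, [/\ ch x g, ch n g & ~ ch l g]).
  have [|th [ht1 ht2 ht3 ht4]] := case1 n l g an al _ h1 h2 h3; first by rewrite addrC.
  by left; exists th.
have sub1 g : ch x g -> ch l g -> ch n g.
  by move=> h1 h2; apply: NNPP => h3; apply: no1; exists g.
have hne : ~ ch n e by move=> h; apply: no2; exists e.
have [H1 [V1 [S1 D1]]] := g_th G hth1.
have [k [kt axk alk hke ik]] := th_pick D1 xt1 lt1 et1 al hxe hle.
have [_ Xk cxk ixk] := axk.
have [jk|/(dep3_same_dir ixk i_n) [c1 _]] := classic (ind3 Y x k n); last first.
  by left; exists th1; split=> //; apply: (theta_same_dir hth1 xt1 kt axk).
have [ckn|nC] := classic (C (k + n)); last first.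
  have [z [mz kz nz]] := g_S1 G Xk (or_introl Xn).
  have xz : x <=m z by apply: (convex G mz Xk Xn nC) => //; left.
  have lz : l <=m z by apply: (convex G mz Xk Xn nC) => //; [left | case: alk].
  case: mz => hz; last by left; exists z.
  exfalso; apply: (xi_third hz xz kz nz lz axk an nC al); apply: ind3_perm => //.
have [th2 [hth2 xt2 kt2 nt2]] := case1 k n e axk an ckn hxe hke hne.
(* [y] is in [ch x] and [ch l], hence in [ch n] and in [th2]; being off [ch k], it determines
   together with [k] the member, so [th1] and [th2] agree. *)
have [y [[yt yY] b1 b2 b3]] := th_solve3 D1 xt1 lt1 kt ik 0 0 1.
have hxy : ch x y by apply/(th_ch G D1).
have hly : ch l y by apply/(th_ch G D1).
have hky : ~ ch k y by move/(th_ch G D1 Xk kt yt yY)/eqP; rewrite b3 oner_eq0.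
have yt2 : y <=m th2 by apply: (ch_sub_theta hth2 xt2 nt2 an hxy); apply: sub1.
have /eqmxP E := uniq_ch (or_intror hth1) (or_intror hth2) Xk yY hky kt yt kt2 yt2.
by left; exists th1; split=> //; rewrite E.
Qed.

End Residue.

Section Ranks.
Variables (K : fieldType) (N : nat).
Local Notation n := (N.+1).
Implicit Types (u x w : 'rV[K]_n) (S T : 'M[K]_n).

Lemma rank_addv u m (S : 'M[K]_(m, n)) : (\rank (u + S)%MS <= (\rank S).+1)%N.
Proof.
have [+ _] := mxrank_adds_leqif u S; have := rank_leq_row u; lia.
Qed.

Lemma rank_addv_gt u m (S : 'M[K]_(m, n)) : ~ u <=m S -> (\rank S < \rank (u + S)%MS)%N.
Proof.
move=> nu; apply: rank_ltmx; rewrite ltmxE addsmxSr addsmx_sub submx_refl andbT.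
exact/negP.
Qed.

Lemma nind2 S x u : ~ x <=m S -> ~ ind2 S x u -> exists s, u - s *: x <=m S.
Proof.
move=> xS ni.
have [s [t [hS h]]] : exists s t, s *: x + t *: u <=m S /\ ~ (s = 0 /\ t = 0).
  apply: NNPP => h; apply: ni => s t hS; apply: NNPP => h'; apply: h.
  by exists s, t.
have t0 : t != 0.
  apply/eqP => t0; apply: h; split=> //; apply/eqP/negPn/negP => s0.
  by apply: xS; apply: (subZi s0); move: hS; rewrite t0 scale0r addr0.
exists (- (t^-1 * s)).
have -> : u - (- (t^-1 * s)) *: x = t^-1 *: (s *: x + t *: u).
  by rewrite scalerDr !scalerA mulVf // scale1r scaleNr opprK addrC.
insub.
Qed.

Lemma ind2_notin S x u : ~ x <=m S -> ~ u <=m (x + S)%MS -> ind2 S x u.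
Proof.
move=> xS h; apply: NNPP => /(nind2 xS) [s hs]; apply: h; apply/sub_addsv.
by exists s, (u - s *: x); split; rewrite // [RHS]addrC subrK.
Qed.

Lemma ind2_modS S x u w : u - w <=m S -> ind2 S x u -> ind2 S x w.
Proof.
move=> hS i; have -> : w = u + - (u - w) by rewrite opprB addrCA subrr addr0.
by apply: ind2_shift => //; apply: oppmx_sub.
Qed.

End Ranks.

(** * Equivalence of lines on a point, and pairs of lines in members of Xi *)

Section Pairs.
Variables (K : fieldType) (N : nat).
Local Notation vec := 'rV[K]_(N.+1).
Local Notation sub := 'M[K]_(N.+1).
Variables (X Z : vec -> Prop) (Y : sub) (Xi Theta : sub -> Prop).
Variables (mv mv' r' : nat).
Hypothesis G : geom X Z Y Xi Theta mv mv' r'.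
Local Notation C := (XY X Y).
Local Notation ch := (ch X Y).
Local Notation adj := (adj X Y).
Local Notation on_theta := (on_theta Theta).
Implicit Types (u w x y p q l d m n e g : vec) (s t c k : K) (z H th xi V S W : sub).

Lemma on_theta_sym x l n : on_theta x l n -> on_theta x n l.
Proof. by move=> [th [h1 h2 h3 h4]]; exists th. Qed.

Lemma on_theta_ch x l n : adj x l -> on_theta x l n -> exists e, ch x e /\ ~ ch l e.
Proof.
move=> a [th [ht xt lt _]]; have [H [V [S D]]] := g_th G ht.
have [Xx Xl _ i] := a.
by have [d [_ h1 h2]] := th_noncol G D xt lt Xx Xl i; exists d.
Qed.

Lemma on_theta_trans x l m n : adj x l -> adj x m -> adj x n ->
  on_theta x l m -> on_theta x m n -> on_theta x l n.
Proof.
move=> al am an h1 h2; have [e [e1 e2]] := on_theta_ch al h1.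
have [//|h] := theta_or_xi G al an e1 e2.
by case: (theta_chain G al am an h1 h2).
Qed.

Lemma XuY_C u : XuY X Y u -> C u.
Proof. by case=> [|[_]]; [left | right]. Qed.
Lemma C_XuY u : u != 0 -> C u -> XuY X Y u.
Proof. by move=> u0 [] h; [left | right]. Qed.

Lemma xi_pair xi x : Xi xi -> x <=m xi -> X x -> exists l n : vec,
  [/\ l <=m xi, n <=m xi, adj x l, adj x n & ~ C (l + n)].
Proof.
move=> hxi xt Xx; have [H D] := g_xi G hxi.
have [l [lt ql bxl il]] := xi_tangent D xt (g_XY G Xx).
have rad s t : (forall w, w <=m xi -> bf H (s *: x + t *: l) w = 0) -> s = 0 /\ t = 0.
  by move=> h; apply: il; apply: (xi_rad D) => //; insub.
have [n0 [nt bxn bln]] := solve2 rad 0 1.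
have qx := xi_XQ D xt (X_C Y Xx).
have Xl : X l.
  by case: (proj2 (xi_quad D lt) ql) => // lY; case: (ind2_r il).
(* Since [bf H l n0 = 1] and [l] is isotropic, this multiple of [l] cancels [qf H n0] without
   affecting the products with [x] and [l]. *)
set n := n0 - qf H n0 *: l.
have nt' : n <=m xi by rewrite /n; insub.
have qn : qf H n = 0.
  by rewrite /n !formE ql (bfC H n0) bln; ring.
have bln' : bf H l n = 1 by rewrite /n !formE bln bf_diag ql mul0rn mulr0 oppr0 addr0.
have bxn' : bf H x n = 0 by rewrite /n !formE bxn bxl mulr0 oppr0 addr0.
clearbody n.
have Xn : X n.
  case: (proj2 (xi_quad D nt') qn) => // lY.
  by have /eqP := xi_vertex D nt' lY lt; rewrite bfC bln' oner_eq0.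
exists l, n; split=> //.
- split=> //; apply/(xi_quad D); first by insub.
  by rewrite qfD qx ql bxl !addr0.
- split=> //.
    apply/(xi_quad D); first by insub.
    by rewrite qfD qx qn bxn' !addr0.
  move=> s t h.
  have st : s *: x + t *: n <=m xi by insub.
  have := xi_vertex D st h lt; rewrite !formE bxl (bfC H n) bln' mulr0 add0r mulr1 => t0.
  move: h; rewrite t0 scale0r addr0 => h; split=> //; apply/eqP/negPn/negP => s0.
  by apply: (g_XY G Xx); apply: (subZi s0).
- move=> h; have ln : l + n <=m xi by insub.
  have /(_ h)/eqP := proj1 (xi_quad D ln).
  by rewrite qfD ql qn bln' !add0r oner_eq0.
Qed.

Lemma adj_sing_line x p : adj x p -> sing_line_pts X Y x 1%:M p.
Proof.
move=> a; have [Xx Xp c i] := a; exists (x + p)%MS; split.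
- have r : \rank (col_mx x p + (0 : sub))%MS = (1 + 1 + \rank (0%R : sub))%N.
    apply: rank_indep => b hb; apply: (ind2_col i).
    exact: submx_trans hb (sub0mx _ _).
  by rewrite addsmxE -(addsmx0 (N.+1)) r mxrank0.
- exact: addsmxSl.
- exact: submx1.
- move=> u u0 /sub_addsv [s [w [/sub_rVP [t ->] E]]].
  by apply: C_XuY => //; rewrite E; apply: (colX G).
- exact: addsmxSr.
Qed.
End Pairs.

(** * Two members of Theta on a point *)

Section Tangent.
Variables (K : fieldType) (N : nat).
Local Notation vec := 'rV[K]_(N.+1).
Local Notation sub := 'M[K]_(N.+1).
Variables (X Z : vec -> Prop) (Y : sub) (Xi Theta : sub -> Prop).
Variables (mv mv' r' : nat).
Hypothesis G : geom X Z Y Xi Theta mv mv' r'.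
Local Notation C := (XY X Y).
Local Notation ch := (ch X Y).
Local Notation adj := (adj X Y).
Local Notation on_xi := (on_xi X Y Xi).
Local Notation theta_data := (theta_data X Z Y mv' r').
Implicit Types (u w x y p q l d m n e g : vec) (s t c k : K) (z H th xi V S W T : sub).

Lemma sing_line_xi xi x l n u : Xi xi -> x <=m xi -> l <=m xi -> n <=m xi ->
  adj x l -> adj x n -> ~ C (l + n) -> sing_line_pts X Y x xi u ->
  u <=m (x + (l + (n + Y)))%MS.
Proof.
move=> hxi xt lt nt al an nC [L [rL xL Lxi sL uL]].
have [H D] := g_xi G hxi; have [Xx _ _ _] := al.
have CL w : w <=m L -> C w.
  have [->|w0] := eqVneq w 0; first by right; apply: sub0mx.
  by move=> wL; apply: XuY_C; apply: sL.
have ut := submx_trans uL Lxi.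
have bxu : bf H x u = 0.
  by apply/(xi_col D) => //; [left | exact: CL | apply: CL; insub].
have [s [t [k [w [wY ->]]]]] := xi_perp G D xt lt nt al an nC ut bxu.
apply/sub_addsv; exists s, (t *: l + k *: n + w); rewrite !addrA; split=> //.
by apply/sub_addsvv; exists t, k, w.
Qed.

(** (S3) does not state that its two members contain [x]. One that does not contributes the zero
    subspace, and then the pair of the other one is repeated; [m] excludes that both are zero. *)
Lemma tangent_pairs x m : adj x m -> exists l1 n1 l2 n2 : vec,
  [/\ adj x l1 /\ adj x n1, on_xi x l1 n1, adj x l2 /\ adj x n2, on_xi x l2 n2 &
   forall p, adj x p -> p <=m (x + (l1 + (n1 + (l2 + (n2 + Y)))))%MS].
Proof.
move=> am; have [Xx Xm _ _] := am.
have [xi1 [xi2 [T1 [T2 [hxi1 hxi2 [_ sp1] [_ sp2] [sp _]]]]]] := g_S3 G Xx.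
have tan xi T : Xi xi -> (forall T' : sub, (forall u, sing_line_pts X Y x xi u -> u <=m T') ->
      (T <= T')%MS) ->
    T = 0 \/ exists l n, [/\ adj x l /\ adj x n, on_xi x l n & (T <= x + (l + (n + Y)))%MS].
  move=> hxi h.
  have [xt|nxt] := classic (x <=m xi).
    have [l [n [lt nt al an nC]]] := xi_pair G hxi xt Xx.
    right; exists l, n; split=> //; first by exists xi.
    rewrite -(genmxE (x + (l + (n + Y)))%MS); apply: h => u hu.
    by rewrite genmxE; apply: (sing_line_xi hxi xt lt nt al an nC hu).
  left; apply/eqP; rewrite -submx0; apply: h => u [L [_ xL Lxi _ _]].
  by case: nxt; apply: submx_trans xL Lxi.
have inT p : adj x p -> p <=m (T1 + T2)%MS by move=> a; apply: sp; apply: (adj_sing_line G).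
have m0 : m != 0 by apply/eqP => m0; apply: (g_XY G Xm); rewrite m0; apply: sub0mx.
have [T10|[l1 [n1 [a1 o1 s1]]]] := tan _ _ hxi1 sp1;
have [T20|[l2 [n2 [a2 o2 s2]]]] := tan _ _ hxi2 sp2.
- have := inT _ am; rewrite T10 T20 addsmx0 submx0 => h.
  by rewrite h in m0.
- exists l2, n2, l2, n2; split=> // p /inT h.
  apply: submx_trans h _; rewrite addsmx_sub T10 sub0mx /=.
  apply: submx_trans s2 _; apply: addsmxS => //.
  by do 2 apply: (submx_trans _ (addsmxSr _ _)).
- exists l1, n1, l1, n1; split=> // p /inT h.
  apply: submx_trans h _; rewrite addsmx_sub T20 sub0mx andbT.
  apply: submx_trans s1 _; apply: addsmxS => //.
  by do 2 apply: (submx_trans _ (addsmxSr _ _)).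
- exists l1, n1, l2, n2; split=> // p /inT h.
  apply: submx_trans h _; rewrite addsmx_sub; apply/andP; split.
    apply: submx_trans s1 _; do 3 apply: addsmxS => //.
    by do 2 apply: (submx_trans _ (addsmxSr _ _)).
  apply: submx_trans s2 _; apply: addsmxS => //.
  by do 2 apply: (submx_trans _ (addsmxSr _ _)).
Qed.

(** A point of [ch l] and [ch n] is collinear with the non-collinear points [l] and [n], so [convex]
    puts it into [xi]. The vertex, and with it [mv], becomes expressible by the sets [ch], which
    members of Theta see too. *)
Lemma on_xi_vertex x l n : adj x l -> adj x n -> on_xi x l n ->
  exists2 V : sub, (forall u, u <=m V <-> [/\ ch x u, ch l u & ch n u]) & \rank V = mv.
Proof.
move=> al an [xi [[hxi xt lt nt] nC]]; have [H D] := g_xi G hxi.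
have [Xx Xl _ _] := al; have [_ Xn _ _] := an.
exists (Y :&: xi)%MS; last exact: xi_rankV D.
move=> u; rewrite sub_capmx; split.
  move=> /andP [uY ut]; split; exact: (xi_ch G D).
move=> [[uY _] [_ Xlu] [_ Xnu]]; rewrite uY /=.
apply: (convex G (or_introl hxi) Xl Xn nC) => //.
- by right.
- by left; rewrite addrC.
- by left; rewrite addrC.
Qed.


Lemma theta_sub th x T : Theta th -> x <=m th -> X x -> x <=m T -> (Y <= T)%MS ->
  (forall p, adj x p -> p <=m T) -> (th <= T)%MS.
Proof.
move=> hth xt Xx xT YT aT; apply/rV_subP => u ut.
have [H [V [S D]]] := g_th G hth.
have [i|/(nind2 (g_XY G Xx)) [s hs]] := classic (ind2 Y x u).
  have [y [yt yY a]] := th_adj D xt ut Xx i.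
  rewrite -(addrK y u); apply: addmx_sub; first exact: aT.
  by apply: oppmx_sub; apply: submx_trans YT.
rewrite -(subrK (s *: x) u); apply: addmx_sub; last by insub.
exact: submx_trans YT.
Qed.

Lemma th_third th H V S x m : theta_data th H V S -> x <=m th -> m <=m th -> adj x m ->
  exists k : vec, [/\ k <=m th, adj x k, adj m k & ind3 Y x m k].
Proof.
move=> D xt mt a; have [Xx Xm _ i] := a.
have [d [dt h1 h2]] := th_noncol G D xt mt Xx Xm i.
by have [k [h3 h4 h5 _ h6]] := th_pick G D xt mt dt a h1 h2; exists k.
Qed.

Lemma th_rank_sum th H V S : theta_data th H V S ->
  \rank (th + Y)%MS = (r'.+1 + \rank Y)%N.
Proof.
move=> D; have := mxrank_sum_cap th Y; rewrite capmxC (th_rankY D) (th_rank D); lia.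
Qed.

End Tangent.

Ltac vecring := apply/rowP => ?; rewrite !mxE; ring.

(** * Two members of Theta on x share no line modulo Y *)

Section Meet.
Variables (K : fieldType) (N : nat).
Local Notation vec := 'rV[K]_(N.+1).
Local Notation sub := 'M[K]_(N.+1).
Variables (X Z : vec -> Prop) (Y : sub) (Xi Theta : sub -> Prop).
Variables (mv mv' r' : nat).
Hypothesis G : geom X Z Y Xi Theta mv mv' r'.
Local Notation C := (XY X Y).
Local Notation ch := (ch X Y).
Local Notation adj := (adj X Y).
Local Notation on_theta := (on_theta Theta).
Local Notation on_xi := (on_xi X Y Xi).
Implicit Types (u w x y p q l d m n e g : vec) (s t c k : K) (z H th xi V S W T : sub).

Variables (x m : vec) (th1 th2 : sub).
Hypotheses (ht1 : Theta th1) (ht2 : Theta th2) (xt1 : x <=m th1) (xt2 : x <=m th2)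
  (mt1 : m <=m th1) (mt2 : m <=m th2) (am : adj x m) (ne : ~ (th1 == th2)%MS).

Let Wx : sub := (th1 + (th2 + Y))%MS.

Let Xx : X x. Proof. by case: am. Qed.
Let Xm : X m. Proof. by case: am. Qed.
Let xnY : ~ x <=m Y. Proof. exact: g_XY G _ Xx. Qed.
Let YW : (Y <= Wx)%MS.
Proof. exact: submx_trans (addsmxSr _ _) (addsmxSr _ _). Qed.

Let chm : exists e, ch x e /\ ~ ch m e.
Proof. by apply: (on_theta_ch G am (n := m)); exists th1. Qed.

Let theta_ch' q : adj x q -> (forall d, ch x d -> ch q d) -> forall n, ~ on_theta x q n.
Proof. by move=> aq h n /(on_theta_ch G aq) [e [/h]]. Qed.

(** Write [w = u1 + u2 + y]. If [u1] and [u2] are both independent of [x] modulo [Y], they are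
    represented by lines equivalent to [xm], so by transitivity a third member of Theta contains
    both, hence their sum. Otherwise [th1] or [th2] itself will do. *)
Let class_rep w : w <=m Wx -> ind2 Y x w ->
  exists w', [/\ adj x w', w' - w <=m Y & on_theta x m w'].
Proof.
move=> /sub_addsmxP [[a b] /= E] iw.
have [H1 [V1 [S1 D1]]] := g_th G ht1; have [H2 [V2 [S2 D2]]] := g_th G ht2.
set u1 := a *m th1 in E; have u1t : u1 <=m th1 by exact: submxMl.
have /sub_addsmxP [[c d] /= E2] : b *m (th2 + Y)%MS <=m (th2 + Y)%MS by exact: submxMl.
set u2 := c *m th2 in E2; have u2t : u2 <=m th2 by exact: submxMl.
have dY : d *m Y <=m Y by exact: submxMl.
rewrite E2 in E; clear E2; move: (d *m Y) dY E => y yY E; clearbody u1 u2.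
have fin th v : Theta th -> x <=m th -> v <=m th -> w - v <=m Y ->
    (forall w', adj x w' -> w' <=m th -> on_theta x m w') ->
    exists w', [/\ adj x w', w' - w <=m Y & on_theta x m w'].
  move=> hth xt vt hv hc; have [H [V [S D]]] := g_th G hth.
  have iv := ind2_modS hv iw.
  have [y' [yt' yY' a']] := th_adj D xt vt Xx iv.
  exists (v + y'); split=> //; last by apply: hc => //; insub.
  have -> : v + y' - w = y' - (w - v) by vecring.
  insub.
have [i1|/(nind2 xnY) [s hs]] := classic (ind2 Y x u1); last first.
  apply: (fin th2 (s *: x + u2)) => //; first by insub.
    have -> : w - (s *: x + u2) = (u1 - s *: x) + y.
      by rewrite E; vecring.
    insub.
  by move=> w' _ wt; exists th2.
have [i2|/(nind2 xnY) [s hs]] := classic (ind2 Y x u2); last first.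
  apply: (fin th1 (s *: x + u1)) => //; first by insub.
    have -> : w - (s *: x + u1) = (u2 - s *: x) + y.
      by rewrite E; vecring.
    insub.
  by move=> w' _ wt; exists th1.
have [y1 [yt1 yY1 al]] := th_adj D1 xt1 u1t Xx i1.
have [y2 [yt2 yY2 an]] := th_adj D2 xt2 u2t Xx i2.
have lt : u1 + y1 <=m th1 by insub.
have nt : u2 + y2 <=m th2 by insub.
have ol : on_theta x (u1 + y1) m by exists th1.
have on : on_theta x m (u2 + y2) by exists th2.
have [th [hth xt lt' nt']] := on_theta_trans G al am an ol on.
apply: (fin th (u1 + y1 + (u2 + y2))) => //; first by insub.
  have -> : w - (u1 + y1 + (u2 + y2)) = y - (y1 + y2).
    by rewrite E; vecring.
  insub.
move=> w' aw wt; apply: (on_theta_trans G am al aw); first exact: on_theta_sym.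
by exists th.
Qed.

Let class_in p : adj x p -> p <=m Wx -> on_theta x m p.
Proof.
move=> ap pW; have [w [aw hw [th [hth xt mt wt]]]] := class_rep pW (adj_ind ap).
exists th; split=> //; apply: (theta_modY G hth xt ap wt).
by rewrite -opprB; insub.
Qed.

Let no_xi_class l n : adj x l -> adj x n -> on_xi x l n -> l <=m Wx -> n <=m Wx -> False.
Proof.
move=> al an o lW nW; apply: (theta_chain G al am an _ _ o).
  exact/on_theta_sym/class_in.
exact: class_in.
Qed.

(** [th1 + Y] has rank at least 3 modulo [Y], and [th2] is not contained in it. Otherwise a third
    vector [k] of [th2] would lie in [th1], and so would a point [d] of [ch x] and [ch k] off
    [ch m]; but [m] and [d] determine the member. *)
Let rankW : (4 + \rank Y <= \rank Wx)%N.
Proof.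
have [H1 [V1 [S1 D1]]] := g_th G ht1; have [H2 [V2 [S2 D2]]] := g_th G ht2.
have [u [ut nu]] : exists u : vec, u <=m th2 /\ ~ u <=m (th1 + Y)%MS.
  apply: NNPP => h.
  have le u : u <=m th2 -> u <=m (th1 + Y)%MS.
    by move=> ut; apply: NNPP => nu; apply: h; exists u.
  have [k [kt ak _ ik]] := th_third G D2 xt2 mt2 am.
  have kt1 : k <=m th1.
    have /sub_addsmxP [[a b] /= E] := le k kt.
    apply: (theta_modY G ht1 xt1 ak (u := a *m th1)); first exact: submxMl.
    by rewrite E addrAC subrr add0r; exact: submxMl.
  have [d [[dt dY] b1 b2 b3]] := th_solve3 D2 xt2 mt2 kt ik 0 1 0.
  have [_ Xk _ _] := ak.
  have hx : ch x d by apply/(th_ch G D2).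
  have hk : ch k d by apply/(th_ch G D2).
  have hm : ~ ch m d by move/(th_ch G D2 Xm mt2 dt dY)/eqP; rewrite b2 oner_eq0.
  have dt1 := ch_sub_theta G ht1 xt1 kt1 ak hx hk.
  by apply: ne; apply: (uniq_ch G (or_intror ht1) (or_intror ht2) Xm dY hm).
have := rank_addv_gt nu; rewrite (th_rank_sum D1) => h.
have /mxrankS : (u + (th1 + Y) <= Wx)%MS.
  by rewrite /Wx !addsmx_sub addsmxSl YW andbT (submx_trans ut) //;
     apply: submx_trans (addsmxSl _ _) (addsmxSr _ _).
have := g_r G; move: h; clear; lia.
Qed.

Section Top.
Variables (T : sub).
Hypotheses (rankT : (\rank T <= 5 + \rank Y)%N) (aT : forall p, adj x p -> p <=m T)
  (YT : (Y <= T)%MS) (xT : x <=m T).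
Variables (l n : vec).
Hypotheses (al : adj x l) (an : adj x n) (oln : on_xi x l n).

Let WT : (Wx <= T)%MS.
Proof. by rewrite /Wx !addsmx_sub YT !(theta_sub G _ _ Xx xT YT aT). Qed.

Let add_T q : adj x q -> ~ q <=m Wx ->
  (T <= q + Wx)%MS /\ \rank T = (5 + \rank Y)%N /\ \rank Wx = (4 + \rank Y)%N.
Proof.
move=> aq nq; have h := rank_addv_gt nq.
have sub1 : (q + Wx <= T)%MS by rewrite addsmx_sub WT aT.
have h2 := mxrankS sub1; have h3 := rankW; have h4 := rankT.
have h5 := rank_addv q Wx.
split; last by move: h h2 h3 h4 h5; clear; lia.
by rewrite -(geq_leqif (mxrank_leqif_sup sub1)); move: h h2 h3 h4 h5; clear; lia.
Qed.

(** Otherwise a member of Theta contains [x] and [q]. Modulo [Y] it has rank at least 3, so it meets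
    the hyperplane [Wx] of [T] outside [x]; then [q], and with it every line on [x], is equivalent
    to [xm], against the pair [l], [n]. *)
Let chq q : adj x q -> ~ q <=m Wx -> forall d, ch x d -> ch q d.
Proof.
move=> aq nq d hx; apply: NNPP => hq.
have [TqW [rT rW]] := add_T aq nq.
have [th [hth xt qt dt]] := ch_theta G aq hx hq.
have [H [V [S D]]] := g_th G hth.
have [g [gth gW ng]] : exists g : vec,
    [/\ g <=m (th + Y)%MS, g <=m Wx & ~ g <=m (x + Y)%MS].
  apply: NNPP => h.
  have le : ((th + Y) :&: Wx <= x + Y)%MS.
    apply/rV_subP => u; rewrite sub_capmx => /andP [u1 u2].
    by apply: NNPP => nu; apply: h; exists u.
  have := mxrankS le; have := rank_addv x Y.
  have := mxrank_sum_cap (th + Y)%MS Wx; rewrite (th_rank_sum D) rW.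
  have sub1 : ((th + Y) + Wx <= T)%MS.
    rewrite addsmx_sub WT andbT addsmx_sub YT andbT.
    exact: (theta_sub G hth xt Xx xT YT aT).
  have := mxrankS sub1; have := g_r G; move: rT; clear; lia.
have ig := ind2_notin xnY ng.
have [g' [ag hg og]] := class_rep gW ig.
have gt' : g' <=m th.
  move: gth => /sub_addsmxP [[a b] /= E].
  apply: (theta_modY G hth xt ag (u := a *m th)); first exact: submxMl.
  have -> : g' - a *m th = (g' - g) + b *m Y by rewrite E; vecring.
  by apply: addmx_sub => //; exact: submxMl.
have oq : on_theta x m q.
  by apply: (on_theta_trans G am ag aq og); exists th.
have all p : adj x p -> on_theta x m p.
  move=> ap; have /sub_addsv [s [w [wW E]]] := submx_trans (aT ap) TqW.
  have [iw|/(nind2 xnY) [t ht]] := classic (ind2 Y x w).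
    have [w' [aw hw ow]] := class_rep wW iw.
    have oqw : on_theta x w' q by apply: (on_theta_trans G aw am aq) => //; apply: on_theta_sym.
    have [th' [hth' xt' wt' qt']] := oqw.
    have pt : p <=m th'.
      apply: (theta_modY G hth' xt' ap (u := s *: q + w')); first by insub.
      by rewrite E opprD addrACA subrr add0r -opprB; insub.
    apply: (on_theta_trans G am aw ap ow); by exists th'.
  have pt : p <=m th.
    apply: (theta_modY G hth xt ap (u := s *: q + t *: x)); first by insub.
    by rewrite E opprD addrACA subrr add0r.
  by apply: (on_theta_trans G am aq ap oq); exists th.
apply: (theta_chain G al am an _ _ oln); first exact/on_theta_sym/all.
exact: all.
Qed.

(** The vertex of such a member, of rank [mv], would contain [ch x]. But [m] and [q] also lie in a
    member of Xi, whose vertex of the same rank is properly contained in [ch x], as [ch x] is not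
    inside [ch m]. *)
Let no_xi_out q q' : adj x q -> adj x q' -> ~ q <=m Wx -> ~ q' <=m Wx -> ~ on_xi x q q'.
Proof.
move=> aq aq' nq nq' o.
have [E hE] := chi_mx G Xx.
have [V1 hV1 r1] := on_xi_vertex G aq aq' o.
have rE : (\rank E <= mv)%N.
  rewrite -r1; apply: mxrankS; apply/rV_subP => u /hE hu; apply/hV1.
  by split=> //; apply: chq.
have [e [e1 e2]] := chm.
case: (theta_or_xi G am aq e1 e2) => [/on_theta_sym|o2].
  by apply: theta_ch' => //; apply: chq.
have [V2 hV2 r2] := on_xi_vertex G am aq o2.
have : (V2 < E)%MS.
  rewrite ltmxE; apply/andP; split; first by apply/rV_subP => u /hV2 [/hE].
  apply/negP => /rV_subP h; apply: e2; have /hV2 [] // : e <=m V2.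
  by apply: h; apply/hE.
by move/rank_ltmx; rewrite r2; move: rE; clear; lia.
Qed.

Let split_pair l' n' : adj x l' -> adj x n' -> on_xi x l' n' ->
  exists a b, [/\ adj x a, adj x b, a <=m Wx, ~ b <=m Wx &
    (l' <=m (a + b)%MS) /\ (n' <=m (a + b)%MS)].
Proof.
move=> a1 a2 o.
have [h1|h1] := classic (l' <=m Wx); have [h2|h2] := classic (n' <=m Wx).
- by case: (no_xi_class a1 a2 o h1 h2).
- by exists l', n'; rewrite addsmxSl addsmxSr.
- by exists n', l'; rewrite addsmxSl addsmxSr.
- by case: (no_xi_out a1 a2 h1 h2 o).
Qed.

Variables (l2 n2 : vec).
Hypotheses (al2 : adj x l2) (an2 : adj x n2) (oln2 : on_xi x l2 n2).
Hypothesis TE : (T <= x + (l + (n + (l2 + (n2 + Y)))))%MS.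

(* The lines on x equivalent to xm fill the subspace Wx of corank at most one in
   the tangent space T; a line q off Wx lies on no member of Theta, so ch x is
   contained in ch q.  Each of the two members of Xi spanning T has one line in
   Wx and one, b1 or b2, off it.  Then b1 and b2 are collinear and the line
   they span meets Wx in a point w with ch x contained in ch w, which is absurd
   as w lies on a member of Theta. *)
Lemma theta_meet_false : False.
Proof.
have [a1 [b1 [aa1 ab1 a1W b1W [h1 h2]]]] := split_pair al an oln.
have [a2 [b2 [aa2 ab2 a2W b2W [h3 h4]]]] := split_pair al2 an2 oln2.
have [TbW [rT rW]] := add_T ab1 b1W.
have /sub_addsv [s [w [wW E]]] := submx_trans (aT ab2) TbW.
have Ew : w = b2 - s *: b1 by rewrite E addrAC subrr add0r.
(* If [w] were a multiple of [x] modulo [Y], then [T] would be spanned by [x], [a1], [a2], [b1] and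
   [Y], which is one short of its rank. *)
have [iw|/(nind2 xnY) [t ht]] := classic (ind2 Y x w); last first.
  set T' := (x + (a1 + (a2 + (b1 + Y))))%MS.
  have [x' a1' a2' b1' Y'] : [/\ x <=m T', a1 <=m T', a2 <=m T', b1 <=m T' & (Y <= T')%MS].
    split; rewrite /T'.
    - exact: addsmxSl.
    - by apply: (submx_trans _ (addsmxSr _ _)); exact: addsmxSl.
    - by do 2 apply: (submx_trans _ (addsmxSr _ _)); exact: addsmxSl.
    - by do 3 apply: (submx_trans _ (addsmxSr _ _)); exact: addsmxSl.
    - by do 4 apply: (submx_trans _ (addsmxSr _ _)).
  have b2' : b2 <=m T'.
    have ht' : w - t *: x <=m T' := submx_trans ht Y'.
    by rewrite E -(subrK (t *: x) w); insub.
  have : (T <= T')%MS.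
    apply: submx_trans TE _; rewrite !addsmx_sub x' Y' andbT /=.
    have s1 : (a1 + b1 <= T')%MS by rewrite addsmx_sub a1'.
    have s2 : (a2 + b2 <= T')%MS by rewrite addsmx_sub a2'.
    by rewrite (submx_trans h1) // (submx_trans h2) // (submx_trans h3) // (submx_trans h4).
  move/mxrankS; rewrite rT.
  have := rank_addv x (a1 + (a2 + (b1 + Y)))%MS; have := rank_addv a1 (a2 + (b1 + Y))%MS.
  have := rank_addv a2 (b1 + Y)%MS; have := rank_addv b1 Y; rewrite -/T'; clear; lia.
have [_ Xb1 cb1 i1] := ab1; have [_ Xb2 cb2 i2] := ab2.
have cb : C (b1 + b2).
  apply: NNPP => nC.
  have [z [mz z1 z2]] := g_S1 G Xb1 (or_introl Xb2).
  have xz : x <=m z by apply: (convex G mz Xb1 Xb2 nC) => //; left.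
  case: mz => hz; first by apply: (no_xi_out ab1 ab2 b1W b2W); exists z.
  by apply: (theta_ch' ab1 (chq ab1 b1W) (n := b2)); exists z.
have s0 : s != 0.
  by apply/eqP => s0; apply: b2W; rewrite E s0 scale0r add0r.
have ib : ind2 Y b1 b2.
  move=> p q h; have q0 : q = 0.
    apply/eqP/negPn/negP => q0.
    have pq : p + q * s != 0 -> False.
      move=> pq; apply: b1W; apply: (subZi pq).
      have -> : (p + q * s) *: b1 = (p *: b1 + q *: b2) - q *: w.
        by rewrite E scalerDr addrA addrK scalerDl scalerA.
      by apply: addmx_sub; [exact: submx_trans YW | insub].
    have [|_ /eqP] := iw 0 q; last by rewrite (negPf q0).
    rewrite scale0r add0r.
    have -> : q *: w = (p *: b1 + q *: b2) - (p + q * s) *: b1.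
      by rewrite Ew scalerBr scalerA scalerDl opprD addrACA subrr add0r.
    have [->|/eqP//] := eqVneq (p + q * s) 0; first by rewrite scale0r subr0.
  split=> //; move: h; rewrite q0 scale0r addr0 => h.
  apply/eqP/negPn/negP => p0; apply: (g_XY G Xb1); exact: (subZi p0).
have abb : adj b1 b2 by split.
have abb' : adj (- s *: b1 + 0 *: b2) (0 *: b1 + 1 *: b2).
  by apply: (adj_comb G abb); rewrite mulr1 mul0r subr0 oppr_eq0.
move: abb'; rewrite !scale0r scale1r addr0 add0r => abb'.
have Xw : X w.
  have := adj_X G (s := - s) (t := 1) abb.
  by rewrite oner_eq0 orbT scale1r scaleNr addrC -Ew; apply.
have aw : adj x w.
  split=> //.
  have -> : x + w = - s *: b1 + b2 + x by rewrite Ew scaleNr addrC; congr (_ + _); rewrite addrC.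
  apply: (tri_C G abb' Xx); last by rewrite addrC.
  by rewrite addrC -[x]scale1r; apply: (colX G).
have [e [e1 e2]] := on_theta_ch G aw (on_theta_sym (class_in aw wW)).
apply: e2; rewrite Ew addrC -scaleNr -[b2]scale1r.
apply: (ch_triangle G abb); [exact: chq | exact: chq | by rewrite oner_eq0 orbT].
Qed.
End Top.
End Meet.

(** * Ranks at a point on two members of Theta *)

Section Star.
Variables (K : fieldType) (N : nat).
Local Notation vec := 'rV[K]_(N.+1).
Local Notation sub := 'M[K]_(N.+1).
Variables (X Z : vec -> Prop) (Y : sub) (Xi Theta : sub -> Prop).
Variables (mv mv' r' : nat).
Hypothesis G : geom X Z Y Xi Theta mv mv' r'.
Local Notation ch := (ch X Y).
Local Notation adj := (adj X Y).
Local Notation on_theta := (on_theta Theta).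
Local Notation on_xi := (on_xi X Y Xi).
Local Notation ch_sub_theta := (ch_sub_theta G).

Lemma tangent_space x m : adj x m -> exists T : sub,
  [/\ (\rank T <= 5 + \rank Y)%N, (Y <= T)%MS, x <=m T & forall p, adj x p -> p <=m T].
Proof.
move=> am; have [l1 [n1 [l2 [n2 [_ _ _ _ hT]]]]] := tangent_pairs G am.
exists <<(x + (l1 + (n1 + (l2 + (n2 + Y)))))%MS>>%MS; split; rewrite ?genmxE.
- have := rank_addv x (l1 + (n1 + (l2 + (n2 + Y))))%MS.
  have := rank_addv l1 (n1 + (l2 + (n2 + Y)))%MS.
  have := rank_addv n1 (l2 + (n2 + Y))%MS; have := rank_addv l2 (n2 + Y)%MS.
  have := rank_addv n2 Y; clear; lia.
- by do 5 apply: (submx_trans _ (addsmxSr _ _)).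
- exact: addsmxSl.
- by move=> p /hT; rewrite genmxE.
Qed.

Lemma theta_meet x m th1 th2 : Theta th1 -> Theta th2 -> x <=m th1 -> x <=m th2 ->
  m <=m th1 -> m <=m th2 -> adj x m -> (th1 == th2)%MS.
Proof.
move=> ht1 ht2 xt1 xt2 mt1 mt2 am; apply/negPn/negP => /negP ne.
have [l1 [n1 [l2 [n2 [[al1 an1] o1 [al2 an2] o2 hT]]]]] := tangent_pairs G am.
apply: (theta_meet_false G ht1 ht2 xt1 xt2 mt1 mt2 am ne
  (T := <<(x + (l1 + (n1 + (l2 + (n2 + Y)))))%MS>>%MS) _ _ _ _ al1 an1 o1 al2 an2 o2); rewrite ?genmxE //.
- have := rank_addv x (l1 + (n1 + (l2 + (n2 + Y))))%MS.
  have := rank_addv l1 (n1 + (l2 + (n2 + Y)))%MS.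
  have := rank_addv n1 (l2 + (n2 + Y))%MS; have := rank_addv l2 (n2 + Y)%MS.
  have := rank_addv n2 Y; clear; lia.
- by move=> p /hT; rewrite genmxE.
- by do 5 apply: (submx_trans _ (addsmxSr _ _)).
- exact: addsmxSl.
Qed.

Lemma adj_exists th x : Theta th -> x <=m th -> X x -> exists l : vec, l <=m th /\ adj x l.
Proof.
move=> hth xt Xx; have [H [V [S D]]] := g_th G hth.
have [u [ut nu]] : exists u : vec, u <=m th /\ ~ u <=m (x + Y)%MS.
  apply: NNPP => h.
  have : (th + Y <= x + Y)%MS.
    rewrite addsmx_sub addsmxSr andbT; apply/rV_subP => u ut.
    by apply: NNPP => nu; apply: h; exists u.
  move/mxrankS; rewrite (th_rank_sum D); have := rank_addv x Y; have := g_r G; clear; lia.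
have [y [yt yY a]] := th_adj D xt ut Xx (ind2_notin (g_XY G Xx) nu).
by exists (u + y); split=> //; insub.
Qed.

(** A point of [ch x] off some [ch l] lies in a member of Theta on [x] and [l], which is [th] by
    [theta_meet]. Thus the members of Theta on [x] all contain [ch x], where they can be
    compared. *)
Lemma ch_in_theta th x d : Theta th -> x <=m th -> X x -> ch x d -> d <=m th.
Proof.
move=> hth xt Xx hd; have [l [lt al]] := adj_exists hth xt Xx.
have [hl|hl] := classic (ch l d); first exact: (ch_sub_theta hth xt lt al hd hl).
have [th' [hth' xt' lt' dt']] := ch_theta G al hd hl.
by have /eqmxP e := theta_meet hth hth' xt xt' lt lt' al; rewrite e.
Qed.

Lemma rank_hyper (S E : sub) e : (E <= S)%MS -> e <=m S -> ~ e <=m E ->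
  (forall u : vec, u <=m S -> exists c, u - c *: e <=m E) -> \rank S = (\rank E).+1.
Proof.
move=> ES eS eE h.
have sub1 : (S <= e + E)%MS.
  apply/rV_subP => u /h [c hc]; apply/sub_addsv; exists c, (u - c *: e).
  by split=> //; rewrite [RHS]addrC subrK.
have sub2 : (e + E <= S)%MS by rewrite addsmx_sub eS.
have := mxrankS sub1; have := mxrankS sub2; have := rank_addv e E; have := rank_addv_gt eE.
clear; lia.
Qed.

Lemma rank_chi th x (E : sub) : Theta th -> x <=m th -> X x ->
  (forall u, u <=m E <-> ch x u) -> \rank E = (r' + mv')%N.
Proof.
move=> hth xt Xx hE; have [H [V [S D]]] := g_th G hth.
have [e [et eY be]] := th_solve1 D xt (g_XY G Xx) 1.
have : \rank (Y :&: th)%MS = (\rank E).+1.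
  apply: (@rank_hyper _ _ e).
  - apply/rV_subP => u /hE hu; rewrite sub_capmx; have [-> _] := hu.
    exact: (ch_in_theta hth xt Xx hu).
  - by rewrite sub_capmx eY.
  - by move/hE/(th_ch G D Xx xt et eY)/eqP; rewrite be oner_eq0.
  - move=> u; rewrite sub_capmx => /andP [uY ut]; exists (bf H x u).
    apply/hE/(th_ch G D) => //; try by insub.
    by rewrite !formE be mulr1 subrr.
rewrite (th_rankY D); clear; lia.
Qed.

Lemma rank_chi2 th x l (E F : sub) : Theta th -> x <=m th -> l <=m th -> adj x l ->
  (forall u, u <=m E <-> ch x u) -> (forall u, u <=m F <-> ch x u /\ ch l u) ->
  \rank E = (\rank F).+1.
Proof.
move=> hth xt lt a hE hF; have [H [V [S D]]] := g_th G hth.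
have [Xx Xl _ i] := a.
have [e [et eY bx bl]] := th_solve2 D xt lt i 0 1.
apply: (@rank_hyper _ _ e).
- by apply/rV_subP => u /hF [/hE].
- by apply/hE/(th_ch G D).
- by move/hF => [_ /(th_ch G D Xl lt et eY)/eqP]; rewrite bl oner_eq0.
- move=> u /hE hu; have ut := ch_in_theta hth xt Xx hu; have [uY _] := hu.
  exists (bf H l u); apply/hF; split; apply/(th_ch G D) => //; try by insub.
    by rewrite !formE bx mulr0 subr0; apply/(th_ch G D).
  by rewrite !formE bl mulr1 subrr.
Qed.

Lemma ch2_mx x l : X x -> X l -> exists F : sub, forall u, u <=m F <-> ch x u /\ ch l u.
Proof.
move=> Xx Xl; have [E hE] := chi_mx G Xx; have [F hF] := chi_mx G Xl.
exists (E :&: F)%MS => u; rewrite sub_capmx; split.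
  by move=> /andP [/hE ? /hF].
by move=> [/hE -> /hF].
Qed.

Lemma no_common_theta x l n th1 th2 : Theta th1 -> Theta th2 -> ~ (th1 == th2)%MS ->
  x <=m th1 -> x <=m th2 -> l <=m th1 -> n <=m th2 -> adj x l -> adj x n ->
  ~ on_theta x l n.
Proof.
move=> ht1 ht2 ne xt1 xt2 lt nt al an [th [hth xt lt' nt']].
have /eqmxP e1 := theta_meet hth ht1 xt xt1 lt' lt al.
have /eqmxP e2 := theta_meet hth ht2 xt xt2 nt' nt an.
by apply: ne; apply/eqmxP; apply: eqmx_trans (eqmx_sym e1) e2.
Qed.

Lemma xi_between x l n th1 th2 : Theta th1 -> Theta th2 -> ~ (th1 == th2)%MS ->
  x <=m th1 -> x <=m th2 -> l <=m th1 -> n <=m th2 -> adj x l -> adj x n ->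
  on_xi x l n.
Proof.
move=> ht1 ht2 ne xt1 xt2 lt nt al an.
have [e [e1 e2]] : exists e, ch x e /\ ~ ch l e.
  by apply: (on_theta_ch G al (n := l)); exists th1.
have [o|//] := theta_or_xi G al an e1 e2.
by case: (no_common_theta ht1 ht2 ne xt1 xt2 lt nt al an o).
Qed.

Section Two.
Variables (x : vec) (th1 th2 : sub).
Hypotheses (Xx : X x) (ht1 : Theta th1) (ht2 : Theta th2) (ne : ~ (th1 == th2)%MS)
  (xt1 : x <=m th1) (xt2 : x <=m th2).

(** Modulo [Y] the two members have rank [r' + 1], share only [x] by [theta_meet], and lie in a
    tangent space of rank at most 5; hence [2 (r' + 1) - 1 <= 5]. *)
Lemma theta_r : r' = 2%N.
Proof.
have [l [lt al]] := adj_exists ht1 xt1 Xx.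
have [T [rT YT xT aT]] := tangent_space al.
have [H1 [V1 [S1 D1]]] := g_th G ht1; have [H2 [V2 [S2 D2]]] := g_th G ht2.
have le : ((th1 + Y) :&: (th2 + Y) <= x + Y)%MS.
  apply/rV_subP => g; rewrite sub_capmx => /andP [/sub_addsmxP [[a b] /= E1] /sub_addsmxP [[c d] /= E2]].
  apply: NNPP => ng; apply: ne.
  have [b' c' d' e'] : [/\ b *m Y <=m Y, a *m th1 <=m th1, c *m th2 <=m th2 & d *m Y <=m Y].
    by split; exact: submxMl.
  have i : ind2 Y x (a *m th1).
    apply: (ind2_modS (u := g)); last exact: ind2_notin (g_XY G Xx) ng.
    by rewrite E1 addrAC subrr add0r.
  have [y [yt yY am]] := th_adj D1 xt1 c' Xx i.
  apply: (theta_meet ht1 ht2 xt1 xt2 _ _ am); first by insub.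
  apply: (theta_modY G ht2 xt2 am d').
  have -> : a *m th1 + y - c *m th2 = d *m Y - b *m Y + y.
    have -> : a *m th1 = g - b *m Y by rewrite E1 addrK.
    by rewrite E2; vecring.
  by insub.
have := mxrankS le; have := rank_addv x Y.
have := mxrank_sum_cap (th1 + Y)%MS (th2 + Y)%MS.
have : ((th1 + Y) + (th2 + Y) <= T)%MS.
  by rewrite !addsmx_sub YT (theta_sub G ht1 xt1 Xx xT YT aT) (theta_sub G ht2 xt2 Xx xT YT aT).
move/mxrankS; rewrite (th_rank_sum D1) (th_rank_sum D2); have := g_r G.
move: rT; clear; lia.
Qed.

(** For [m] in [th1] the vertex of the member of Xi on [m] and [m2] is [ch x] cut by [ch m] and
    [ch m2], and each cut should lower the rank by one. The second does so if some [d] in [ch x] and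
    [ch m] is off [ch m2]; a suitable [m] is found among two independent candidates [m1] and [k]. *)
Lemma rank_chi_vertex (E : sub) : (forall u, u <=m E <-> ch x u) -> \rank E = mv.+2.
Proof.
move=> hE.
have [m2 [mt2 am2]] := adj_exists ht2 xt2 Xx.
have [m1 [mt1 am1]] := adj_exists ht1 xt1 Xx.
have [H1 [V1 [S1 D1]]] := g_th G ht1; have [H2 [V2 [S2 D2]]] := g_th G ht2.
have [_ Xm2 _ i2] := am2.
have fin m d : m <=m th1 -> adj x m -> ch x d -> ch m d -> ~ ch m2 d -> \rank E = mv.+2.
  move=> mt am hxd hmd nd; have [_ Xm _ _] := am.
  have o := xi_between ht1 ht2 ne xt1 xt2 mt mt2 am am2.
  have [V hV <-] := on_xi_vertex G am am2 o.
  have [F hF] := ch2_mx Xx Xm.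
  rewrite (rank_chi2 ht1 xt1 mt am hE hF); congr S.
  have dt := ch_in_theta ht2 xt2 Xx hxd; have [dY _] := hxd.
  have bd : bf H2 m2 d != 0 by apply/eqP => h; apply: nd; apply/(th_ch G D2).
  apply: (@rank_hyper _ _ d).
  - by apply/rV_subP => u /hV [h1 h2 _]; apply/hF.
  - exact/hF.
  - by move/hV => [].
  - move=> u /hF [hu hm]; exists (bf H2 m2 u / bf H2 m2 d).
    have ut := ch_in_theta ht2 xt2 Xx hu; have [uY _] := hu.
    have chx c : ch x (u - c *: d) by apply: (chD G) => //; apply: (chN G) => //; apply: (chZ G).
    apply/hV; split=> //; first by apply: (chD G) => //; apply: (chN G) => //; apply: (chZ G).
    apply/(th_ch G D2) => //; try by insub.
    by rewrite !formE divfK // subrr.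
have [k [kt ak _ ik]] := th_third G D1 xt1 mt1 am1.
have [d [[dt dY] b1 b2 b3]] := th_solve3 D1 xt1 mt1 kt ik 0 1 0.
have [d' [[dt' dY'] c1 c2 c3]] := th_solve3 D1 xt1 mt1 kt ik 0 0 1.
have [_ Xk _ _] := ak; have [_ Xm1 _ _] := am1.
have hd : ch x d by apply/(th_ch G D1).
have hd' : ch x d' by apply/(th_ch G D1).
have [h|h] := classic (ch m2 d); last by apply: (fin k d) => //; apply/(th_ch G D1).
have [h'|h'] := classic (ch m2 d'); last by apply: (fin m1 d') => //; apply/(th_ch G D1).
have hdd : ch m2 (d + d') by apply: (chD G).
have [e [et he ne2]] := th_noncol G D2 xt2 mt2 Xx Xm2 i2.
have et1 := ch_in_theta ht1 xt1 Xx he; have [eY _] := he.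
(* The correction by [d] puts [e] into [ch m1], and since [d] is in [ch m2] it stays off [ch m2]. *)
pose f := e - bf H1 m1 e *: d.
apply: (fin m1 f) => //.
- by rewrite /f; apply: (chD G) => //; apply: (chN G) => //; apply: (chZ G).
- apply/(th_ch G D1) => //; rewrite /f; try by insub.
  by rewrite !formE b2 mulr1 subrr.
move=> hf; apply: ne2.
have -> : e = f + bf H1 m1 e *: d by rewrite /f subrK.
by apply: (chD G) => //; apply: (chZ G).
Qed.

(** If [ch x] were inside [ch l], then [l] and some [m1] of [th1] would lie in a member of Xi with
    vertex [ch x] cut by [ch m1] alone; that has rank [mv + 1], not [mv]. So every line on [x] lies
    in a member of Theta. *)
Lemma adj_noncol l : adj x l -> exists e, ch x e /\ ~ ch l e.
Proof.
move=> al; apply: NNPP => h.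
have hl d : ch x d -> ch l d by move=> hd; apply: NNPP => nd; apply: h; exists d.
have [m1 [mt1 am1]] := adj_exists ht1 xt1 Xx.
have [e [e1 e2]] : exists e, ch x e /\ ~ ch m1 e.
  by apply: (on_theta_ch G am1 (n := m1)); exists th1.
have [/on_theta_sym o|o] := theta_or_xi G am1 al e1 e2.
  by have [f [/hl]] := on_theta_ch G al o.
have [V hV rV] := on_xi_vertex G am1 al o.
have [E hE] := chi_mx G Xx; have rE := rank_chi_vertex hE.
have hV' u : u <=m V <-> ch x u /\ ch m1 u.
  by rewrite hV; split=> [[]|[h1 h2]]; split=> //; apply: hl.
have := rank_chi2 ht1 xt1 mt1 am1 hE hV'; rewrite rV rE; clear; lia.
Qed.
End Two.
End Star.

(** * Vertices and the set Z *)

Section Vertices.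
Variables (K : fieldType) (N : nat).
Local Notation vec := 'rV[K]_(N.+1).
Local Notation sub := 'M[K]_(N.+1).
Variables (X Z : vec -> Prop) (Y : sub) (Xi Theta : sub -> Prop).
Variables (mv mv' r' : nat).
Hypothesis G : geom X Z Y Xi Theta mv mv' r'.
Local Notation ch := (ch X Y).
Local Notation adj := (adj X Y).
Local Notation theta_data := (theta_data X Z Y mv' r').

Lemma sub_union n (A B D : 'M[K]_n) :
  (forall u : 'rV_n, u <=m A -> u <=m B \/ u <=m D) -> (A <= B)%MS \/ (A <= D)%MS.
Proof.
move=> h; have [|nB] := classic (A <= B)%MS; [by left | right].
have [u [uA uB]] : exists u : 'rV_n, u <=m A /\ ~ u <=m B.
  by apply: NNPP => h'; apply: nB; apply/rV_subP => u uA; apply: NNPP => uB; apply: h'; exists u.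
have uD : u <=m D by case: (h u uA).
apply/rV_subP => w wA; have [wB|//] := h w wA.
have : u + w <=m A by insub.
move/h => [h1|h1].
  by case: uB; rewrite -(addrK w u); insub.
by rewrite -(addKr u w) addrC; insub.
Qed.

Lemma V_sub th H V S : theta_data th H V S -> (V <= Y :&: th)%MS.
Proof. by move=> D; rewrite -(eqmxP (th_subY D)) addsmxSr. Qed.
Lemma S_sub th H V S : theta_data th H V S -> (S <= Y :&: th)%MS.
Proof. by move=> D; rewrite -(eqmxP (th_subY D)) addsmxSl. Qed.

Lemma V_ch th H V S x u : theta_data th H V S -> x <=m th -> X x -> u <=m V -> ch x u.
Proof.
move=> D xt Xx uV; have := submx_trans uV (V_sub D); rewrite sub_capmx => /andP [uY ut].
by apply/(th_ch G D) => //; rewrite bfC; apply: (th_vertex D).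
Qed.

Lemma V_charac th H V S x u : theta_data th H V S -> x <=m th -> X x -> u <=m th -> ch x u ->
  (forall l, l <=m th -> adj x l -> ch l u) -> u <=m V.
Proof.
move=> D xt Xx ut hx h; have [uY _] := hx; apply: (th_rad D) => // w wt; rewrite bfC.
have bx : bf H x u = 0 by apply/(th_ch G D).
have [i|/(nind2 (g_XY G Xx)) [s hs]] := classic (ind2 Y x w).
  have [y [yt yY a]] := th_adj D xt wt Xx i.
  have wyt : w + y <=m th by insub.
  have [_ Xw _ _] := a.
  have := h _ wyt a => /(th_ch G D Xw wyt ut uY).
  by rewrite bfDl (th_YY D yt ut yY uY) addr0.
rewrite -(subrK (s *: x) w) bfDl bfZl bx mulr0 addr0.
by apply: (th_YY D) => //; insub.
Qed.

Section Two.
Variables (x : vec) (th1 th2 H1 V1 S1 H2 V2 S2 : sub).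
Hypotheses (Xx : X x) (ht1 : Theta th1) (ht2 : Theta th2) (ne : ~ (th1 == th2)%MS)
  (xt1 : x <=m th1) (xt2 : x <=m th2)
  (D1 : theta_data th1 H1 V1 S1) (D2 : theta_data th2 H2 V2 S2).

Lemma rank_mv : mv = mv'.
Proof.
have [E hE] := chi_mx G Xx.
have := rank_chi G ht1 xt1 Xx hE; rewrite (rank_chi_vertex G Xx ht1 ht2 ne xt1 xt2 hE).
by rewrite (theta_r G Xx ht1 ht2 ne xt1 xt2); clear; lia.
Qed.

(** Otherwise [V1 = V2]. For [l] in [th1] there is a point [s] in [ch x] and [ch l] off this vertex,
    and [th_pick] finds [k] in [th2] with [s] in [ch k]. The member of Xi on [l] and [k] then has
    [s] and [V1] in its vertex, which is too large. *)
Lemma vertex_not_sub : ~ (V2 <= V1)%MS.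
Proof.
move=> le; have [E hE] := chi_mx G Xx.
have e21 : (V1 <= V2)%MS.
  by rewrite -(geq_leqif (mxrank_leqif_sup le)) (th_rankV D1) (th_rankV D2).
have [l [lt al]] := adj_exists G ht1 xt1 Xx; have [_ Xl _ _] := al.
have [F hF] := ch2_mx G Xx Xl.
have rF := rank_chi2 G ht1 xt1 lt al hE hF.
have rE := rank_chi G ht1 xt1 Xx hE.
have rE' := rank_chi_vertex G Xx ht1 ht2 ne xt1 xt2 hE.
have r2 := theta_r G Xx ht1 ht2 ne xt1 xt2.
have [s [sF nsV]] : exists s : vec, s <=m F /\ ~ s <=m V1.
  apply: NNPP => h.
  have : (F <= V1)%MS by apply/rV_subP => u uF; apply: NNPP => nu; apply: h; exists u.
  move/mxrankS; rewrite (th_rankV D1); move: rE rF; rewrite r2; clear; lia.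
have [hxs hls] := proj1 (hF s) sF.
have st2 := ch_in_theta G ht2 xt2 Xx hxs.
have [l2 [lt2 al2 nl2]] : exists l2, [/\ l2 <=m th2, adj x l2 & ~ ch l2 s].
  apply: NNPP => h; apply: nsV; apply: submx_trans le.
  apply: (V_charac D2 xt2 Xx st2 hxs) => l2 lt2 al2; apply: NNPP => hn; apply: h.
  by exists l2.
have [k [kt ak _ hks _]] := th_pick G D2 xt2 lt2 st2 al2 hxs nl2.
have [_ Xk _ _] := ak.
have o := xi_between G ht1 ht2 ne xt1 xt2 lt kt al ak.
have [W hW rW] := on_xi_vertex G al ak o.
have : (s + V1 <= W)%MS.
  rewrite addsmx_sub; apply/andP; split; first exact/hW.
  apply/rV_subP => u uV; apply/hW; split.
  - exact: (V_ch D1 xt1).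
  - exact: (V_ch D1 lt).
  - by apply: (V_ch D2 kt) => //; apply: submx_trans e21.
move/mxrankS; rewrite rW; have := rank_addv_gt nsV; rewrite (th_rankV D1).
move: rE rE'; rewrite r2; clear; lia.
Qed.

Lemma rank_SE (E : sub) : (forall u, u <=m E <-> ch x u) -> \rank (S1 :&: E)%MS = 2%N.
Proof.
move=> hE.
have rE := rank_chi G ht1 xt1 Xx hE.
have r2 := theta_r G Xx ht1 ht2 ne xt1 xt2.
have dj : ((S1 :&: E) :&: V1)%MS = 0.
  apply/eqP; rewrite -submx0; case/andP: (th_capSV D1) => h _.
  by apply: submx_trans h; apply: capmxS => //; exact: capmxSl.
have := mxrank_disjoint_sum dj.
have -> : \rank ((S1 :&: E) + V1)%MS = \rank E.
  apply/eqP; rewrite eqn_leq; apply/andP; split; apply: mxrankS.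
    rewrite addsmx_sub capmxSr; apply/rV_subP => u uV; apply/hE.
    exact: (V_ch D1 xt1).
  apply/rV_subP => u /hE hu; have ut := ch_in_theta G ht1 xt1 Xx hu; have [uY _] := hu.
  have : u <=m (S1 + V1)%MS by rewrite (eqmxP (th_subY D1)) sub_capmx uY.
  move=> /sub_addsmxP [[a b] /= Eu].
  have bV : b *m V1 <=m V1 by exact: submxMl.
  rewrite Eu; apply: addmx_sub_adds => //; rewrite sub_capmx submxMl; apply/hE.
  have -> : a *m S1 = u - b *m V1 by rewrite Eu addrK.
  by apply: (chD G) => //; apply: (chN G) => //; apply: (V_ch D1 xt1).
rewrite rE (th_rankV D1) r2; clear; lia.
Qed.

(** [ch x] lies in both members, so the trace of [Z] on it can be read off in either. *)
Lemma Z_cases u : ch x u -> u <=m V2 \/ u <=m S2 -> u <=m V1 \/ u <=m S1.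
Proof.
move=> hu h; have [->|u0] := eqVneq u 0; first by left; apply: sub0mx.
have ut1 := ch_in_theta G ht1 xt1 Xx hu; have ut2 := ch_in_theta G ht2 xt2 Xx hu.
have Zu : Z u by apply/(th_Z D2).
by have [_] := proj1 (th_Z D1 ut1) Zu.
Qed.

Lemma vertex_sub_S : (V2 <= S1)%MS.
Proof.
have h : forall u : vec, u <=m V2 -> u <=m V1 \/ u <=m S1.
  by move=> u uV; apply: Z_cases; [exact: (V_ch D2 xt2) | left].
by have [/vertex_not_sub|] := sub_union h.
Qed.
End Two.

Section Star.
Variables (x : vec) (th1 th2 H1 V1 S1 H2 V2 S2 : sub).
Hypotheses (Xx : X x) (ht1 : Theta th1) (ht2 : Theta th2) (ne : ~ (th1 == th2)%MS)
  (xt1 : x <=m th1) (xt2 : x <=m th2)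
  (D1 : theta_data th1 H1 V1 S1) (D2 : theta_data th2 H2 V2 S2).

Let ne' : ~ (th2 == th1)%MS.
Proof. by move=> /eqmxP e; apply: ne; apply/eqmxP/eqmx_sym. Qed.

(** [V2] lies in [S1 :&: E], which has rank 2, so [mv' <= 2]. The trace of [S2] on [ch x], also of
    rank 2, lies in [V1] or in [S1]; the second case would put [V1] into [S1], making it zero. *)
Lemma star_mv' : mv' = 2%N.
Proof.
have [E hE] := chi_mx G Xx.
have rS1 := rank_SE Xx ht1 ht2 ne xt1 xt2 D1 hE.
have rS2 := rank_SE Xx ht2 ht1 ne' xt2 xt1 D2 hE.
have v21 := vertex_sub_S Xx ht1 ht2 ne xt1 xt2 D1 D2.
have v12 := vertex_sub_S Xx ht2 ht1 ne' xt2 xt1 D2 D1.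
have v2E : (V2 <= S1 :&: E)%MS.
  by rewrite sub_capmx v21; apply/rV_subP => u uV; apply/hE; exact: (V_ch D2 xt2).
have := mxrankS v2E; rewrite rS1 (th_rankV D2) => le2.
have hu : forall u : vec, u <=m (S2 :&: E)%MS -> u <=m V1 \/ u <=m S1.
  move=> u; rewrite sub_capmx => /andP [uS /hE hu].
  by apply: (Z_cases Xx ht1 ht2 xt1 xt2 D1 D2) => //; right.
have [h|h] := sub_union hu.
  move/mxrankS: h; rewrite rS2 (th_rankV D1); move: le2; clear; lia.
have v1E : (V1 <= S2 :&: E)%MS.
  by rewrite sub_capmx v12; apply/rV_subP => u uV; apply/hE; exact: (V_ch D1 xt1).
have : (V1 <= S1 :&: V1)%MS by rewrite sub_capmx submx_refl (submx_trans v1E).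
case/andP: (th_capSV D1) => h1 _ /submx_trans /(_ h1); rewrite submx0 => /eqP V10.
by case: (vertex_not_sub Xx ht2 ht1 ne' xt2 xt1 D2 D1); rewrite V10 sub0mx.
Qed.

Lemma star_mv : mv = 2%N.
Proof. by rewrite (rank_mv Xx ht1 ht2 ne xt1 xt2) star_mv'. Qed.

Lemma star_V2 u : u <=m V2 <-> ch x u /\ u <=m S1.
Proof.
have [E hE] := chi_mx G Xx.
have rS1 := rank_SE Xx ht1 ht2 ne xt1 xt2 D1 hE.
have v21 := vertex_sub_S Xx ht1 ht2 ne xt1 xt2 D1 D2.
have v2E : (V2 <= S1 :&: E)%MS.
  by rewrite sub_capmx v21; apply/rV_subP => w wV; apply/hE; exact: (V_ch D2 xt2).
have le : (S1 :&: E <= V2)%MS.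
  by rewrite -(geq_leqif (mxrank_leqif_sup v2E)) rS1 (th_rankV D2) star_mv'.
split.
  by move=> uV; have := submx_trans uV v2E; rewrite sub_capmx => /andP [? /hE].
by move=> [/hE uE uS]; apply: submx_trans le; rewrite sub_capmx uS.
Qed.

Lemma star_ch u : ch x u <-> u <=m (V1 + V2)%MS.
Proof.
split=> hu.
  have ut := ch_in_theta G ht1 xt1 Xx hu; have [uY _] := hu.
  have : u <=m (S1 + V1)%MS by rewrite (eqmxP (th_subY D1)) sub_capmx uY.
  move=> /sub_addsmxP [[a b] /= Eu].
  have bV : b *m V1 <=m V1 by exact: submxMl.
  rewrite Eu addrC; apply: addmx_sub_adds => //; apply/star_V2; split; last exact: submxMl.
  have -> : a *m S1 = u - b *m V1 by rewrite Eu addrK.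
  by apply: (chD G) => //; apply: (chN G) => //; apply: (V_ch D1 xt1).
have /sub_addsmxP [[a b] /= ->] := hu.
by apply: (chD G) => //; [apply: (V_ch D1 xt1) | apply: (V_ch D2 xt2)] => //; exact: submxMl.
Qed.
End Star.

(** By [star_V2] both [V2] and [V3] are the trace of [S1] on [ch x], and [V3] is also that of [S2].
    So [V2] would lie in [S2], from which it is disjoint. *)
Lemma star_unique x th1 th2 th3 : X x -> Theta th1 -> Theta th2 -> Theta th3 ->
  ~ (th1 == th2)%MS -> x <=m th1 -> x <=m th2 -> x <=m th3 ->
  (th3 == th1)%MS \/ (th3 == th2)%MS.
Proof.
move=> Xx ht1 ht2 ht3 ne xt1 xt2 xt3.
have [|n1] := classic (th3 == th1)%MS; [by left | right].
apply/negPn/negP => /negP n2.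
have n1' : ~ (th1 == th3)%MS by move=> /eqmxP e; apply: n1; apply/eqmxP/eqmx_sym.
have n2' : ~ (th2 == th3)%MS by move=> /eqmxP e; apply: n2; apply/eqmxP/eqmx_sym.
have [H1 [V1 [S1 D1]]] := g_th G ht1; have [H2 [V2 [S2 D2]]] := g_th G ht2.
have [H3 [V3 [S3 D3]]] := g_th G ht3.
have h2 := star_V2 Xx ht1 ht2 ne xt1 xt2 D1 D2.
have h3 := star_V2 Xx ht1 ht3 n1' xt1 xt3 D1 D3.
have h23 := star_V2 Xx ht2 ht3 n2' xt2 xt3 D2 D3.
have : (V2 <= S2 :&: V2)%MS.
  rewrite sub_capmx submx_refl andbT; apply/rV_subP => u /h2 hu.
  by have [] := proj1 (h23 u) (proj2 (h3 u) hu).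
case/andP: (th_capSV D2) => h _ /submx_trans /(_ h); rewrite submx0 => /eqP V20.
by have := th_rankV D2; rewrite V20 mxrank0 (star_mv' Xx ht1 ht2 ne xt1 xt2 D1 D2).
Qed.
End Vertices.

(** * The two planes of Z *)

Section Frame.
Variables (K : fieldType) (N : nat).
Local Notation vec := 'rV[K]_(N.+1).
Local Notation sub := 'M[K]_(N.+1).
Variables (X Z : vec -> Prop) (Y : sub) (Xi Theta : sub -> Prop).
Variables (mv mv' r' : nat).
Hypothesis G : geom X Z Y Xi Theta mv mv' r'.
Local Notation theta_data := (theta_data X Z Y mv' r').

Definition dot n (a b : 'rV[K]_n) : K := (a *m b^T) 0 0.
Lemma dotC n (a b : 'rV[K]_n) : dot a b = dot b a.
Proof. by rewrite /dot -[in LHS]trace_mx11 -mxtrace_tr trmx_mul trmxK trace_mx11. Qed.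
Lemma dotDl n (a b c : 'rV[K]_n) : dot (a + b) c = dot a c + dot b c.
Proof. by rewrite /dot mulmxDl mxE. Qed.
Lemma dotZl n k (a b : 'rV[K]_n) : dot (k *: a) b = k * dot a b.
Proof. by rewrite /dot -scalemxAl mxE. Qed.
Lemma dotZr n k (a b : 'rV[K]_n) : dot a (k *: b) = k * dot a b.
Proof. by rewrite dotC dotZl dotC. Qed.
Lemma dotNl n (a b : 'rV[K]_n) : dot (- a) b = - dot a b.
Proof. by rewrite -scaleN1r dotZl mulN1r. Qed.
Lemma dot0l n (b : 'rV[K]_n) : dot 0 b = 0.
Proof. by rewrite -(scale0r (0 : 'rV_n)) dotZl mul0r. Qed.
Lemma dot_delta n (a : 'rV[K]_n) j : dot (delta_mx 0 j) a = a 0 j.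
Proof. by rewrite /dot -rowE !mxE. Qed.

Lemma dot_solve n (a : 'rV[K]_n) k : a != 0 -> exists c, dot c a = k.
Proof.
move=> /rV0Pn [j aj]; exists (k / a 0 j *: delta_mx 0 j).
by rewrite dotZl dot_delta divfK.
Qed.

Lemma dot_prop n (a a' : 'rV[K]_n) : a != 0 ->
  (forall c, dot c a = 0 -> dot c a' = 0) -> exists k, a' = k *: a.
Proof.
move=> /rV0Pn [j aj] h; exists (a' 0 j / a 0 j); apply/rowP => i.
have /h : dot (a 0 j *: delta_mx 0 i - a 0 i *: delta_mx 0 j) a = 0.
  by rewrite dotDl dotNl !dotZl !dot_delta mulrC subrr.
rewrite dotDl dotNl !dotZl !dot_delta => /eqP; rewrite subr_eq0 => /eqP e.
by apply: (mulfI aj); rewrite e mxE; field.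
Qed.

Hypothesis two : forall x, X x -> exists th1 th2,
  [/\ Theta th1, Theta th2, ~ (th1 == th2)%MS, x <=m th1 & x <=m th2].

Lemma neqmx_sym (A B : sub) : ~ (A == B)%MS -> ~ (B == A)%MS.
Proof. by move=> ne /eqmxP e; apply: ne; apply/eqmxP/eqmx_sym. Qed.

Lemma theta_data_eqS th H V S S' : (S == S')%MS -> theta_data th H V S -> theta_data th H V S'.
Proof.
move=> /eqmxP e D; case: D => d1 d2 d3 d4 d5 d6 d7 d8 d9 d10; split=> //.
- by apply/eqmxP; apply: (eqmx_trans (adds_eqmx (eqmx_sym e) (eqmx_refl V)) (eqmxP d5)).
- by apply/eqmxP; apply: (eqmx_trans (cap_eqmx (eqmx_sym e) (eqmx_refl V)) (eqmxP d6)).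
- by rewrite -e.
- by move=> u /d10 ->; rewrite e.
Qed.

Definition frame (A B : 'M[K]_(3, N.+1)) : Prop :=
  [/\ row_free (col_mx A B), (Y == A + B)%MS &
      forall u, Z u <-> u != 0 /\ (u <=m A \/ u <=m B)].

Lemma basis_mx m n (S : 'M[K]_(m, n)) k : \rank S = k ->
  exists B : 'M[K]_(k, n), row_free B /\ (B == S)%MS.
Proof.
move=> <-; exists (row_base S); split; first exact: row_base_free.
apply/eqmxP; exact: eq_row_base.
Qed.

(** A point of [Z] lies with [x] in some member. If that is in Xi, the point is in [ch x], hence in
    [th1]; otherwise the member is [th1] or [th2] by [star_unique]. In either case the description
    of [Z] in one member applies, and the vertex of each member lies in the plane of the other. *)
Lemma frame_exists x : X x -> is_span Z Y -> is_ptset Z -> exists A B, frame A B.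
Proof.
move=> Xx [ZY minY] [Z0 _]; have [th1 [th2 [ht1 ht2 ne xt1 xt2]]] := two Xx.
have [H1 [V1 [S1 D1]]] := g_th G ht1; have [H2 [V2 [S2 D2]]] := g_th G ht2.
have ne' := neqmx_sym ne.
have hV2 := star_V2 G Xx ht1 ht2 ne xt1 xt2 D1 D2.
have hV1 := star_V2 G Xx ht2 ht1 ne' xt2 xt1 D2 D1.
have r2 := theta_r G Xx ht1 ht2 ne xt1 xt2.
have S1Y := S_sub D1; have S2Y := S_sub D2.
have Zin u : Z u <-> u != 0 /\ (u <=m S1 \/ u <=m S2).
  split; last first.
    move=> [u0 [uS|uS]].
      have := submx_trans uS S1Y; rewrite sub_capmx => /andP [_ ut].
      by apply/(th_Z D1 ut); split=> //; right.
    have := submx_trans uS S2Y; rewrite sub_capmx => /andP [_ ut].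
    by apply/(th_Z D2 ut); split=> //; right.
  move=> Zu; split; first exact: Z0.
  have in1 : u <=m th1 -> u <=m S1 \/ u <=m S2.
    move=> ut; have [_ [h|h]] := proj1 (th_Z D1 ut) Zu; [right | by left].
    by case: (proj1 (hV1 u) h).
  have in2 : u <=m th2 -> u <=m S1 \/ u <=m S2.
    move=> ut; have [_ [h|h]] := proj1 (th_Z D2 ut) Zu; [left | by right].
    by case: (proj1 (hV2 u) h).
  have [z [[hz|hz] xz uz]] := g_S1 G Xx (or_intror Zu).
    have [H D] := g_xi G hz.
    by apply: in1; apply: (ch_in_theta G ht1 xt1 Xx); apply: (xi_ch G D) => //; exact: ZY.
  have [/eqmxP e|/eqmxP e] := star_unique G Xx ht1 ht2 hz ne xt1 xt2 xz.
    by apply: in1; rewrite -e.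
  by apply: in2; rewrite -e.
(* A common point in [ch x] would lie in [V2] and [S2]; one off [ch x] would determine with [x] the
   member and identify [th1] with [th2]. *)
have cap0 : (S1 :&: S2)%MS = 0.
  apply/eqP; rewrite -submx0; case/andP: (th_capSV D2) => h _.
  apply: submx_trans h; rewrite sub_capmx capmxSr /=; apply/rV_subP => u.
  rewrite sub_capmx => /andP [u1 u2]; apply/hV2; split=> //.
  have := submx_trans u1 S1Y; rewrite sub_capmx => /andP [uY ut1].
  have := submx_trans u2 S2Y; rewrite sub_capmx => /andP [_ ut2].
  apply: NNPP => nu; apply: ne.
  exact: (uniq_ch G (or_intror ht1) (or_intror ht2) Xx uY nu).
have [A [fA /eqmxP eA]] := basis_mx (th_rankS D1).
have [B [fB /eqmxP eB]] := basis_mx (th_rankS D2).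
rewrite r2 in A fA eA B fB eB *.
exists A, B; split.
- rewrite /row_free -addsmxE mxrank_disjoint_sum ?(eqP fA) ?(eqP fB) //.
  apply/eqP; rewrite -submx0 -cap0; apply: capmxS; [rewrite eA | rewrite eB]; exact: submx_refl.
- apply/andP; split.
    rewrite -(genmxE (A + B)%MS); apply: minY => u /Zin [_ h]; rewrite genmxE.
    case: h => h; [apply: submx_trans (addsmxSl _ _) | apply: submx_trans (addsmxSr _ _)].
      by rewrite eA.
    by rewrite eB.
  rewrite addsmx_sub eA eB (submx_trans S1Y) ?capmxSl // (submx_trans S2Y) ?capmxSl //.
- by move=> u; rewrite Zin eA eB.
Qed.

Lemma frame_sym A B : frame A B -> frame B A.
Proof.
case=> f e h; split.
- by rewrite /row_free -addsmxE addsmxC addsmxE.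
- by rewrite addsmxC.
- by move=> u; rewrite h; split=> -[u0 []]; split=> //; by [left|right].
Qed.
End Frame.

(** * Coordinates *)

Section Coord.
Variables (K : fieldType) (N : nat).
Local Notation vec := 'rV[K]_(N.+1).
Local Notation sub := 'M[K]_(N.+1).
Variables (X Z : vec -> Prop) (Y : sub) (Xi Theta : sub -> Prop).

Hypothesis G : geom X Z Y Xi Theta 2%N 2%N 2%N.
Local Notation ch := (ch X Y).
Local Notation theta_data := (theta_data X Z Y 2%N 2%N).
Hypothesis two : forall x, X x -> exists th1 th2,
  [/\ Theta th1, Theta th2, ~ (th1 == th2)%MS, x <=m th1 & x <=m th2].
Local Notation frame := (frame Z Y).
Implicit Types (a b : 'rV[K]_3) (A B : 'M[K]_(3, N.+1)) (u w x : vec) (th H V : sub).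

Definition coords A B x a b : Prop :=
  X x /\ forall c1 c2 : 'rV_3, ch x (c1 *m A + c2 *m B) <-> dot c1 a = 0 /\ dot c2 b = 0.

Lemma coords_sym A B x a b : coords A B x a b -> coords B A x b a.
Proof. by move=> [Xx h]; split=> // c1 c2; rewrite addrC h; split=> -[]. Qed.

Lemma frame_A A B : frame A B -> (A <= Y)%MS.
Proof. by case=> _ /eqmxP e _; rewrite e addsmxSl. Qed.
Lemma frame_B A B : frame A B -> (B <= Y)%MS.
Proof. by case=> _ /eqmxP e _; rewrite e addsmxSr. Qed.
Lemma frame_coord A B u : frame A B -> u <=m Y -> exists c1 c2 : 'rV_3, u = c1 *m A + c2 *m B.
Proof.
case=> _ /eqmxP e _; rewrite e => /sub_addsmxP [[c1 c2] /= ->]; by exists c1, c2.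
Qed.
Lemma frame_inj A B (c1 c2 d1 d2 : 'rV[K]_3) : frame A B ->
  c1 *m A + c2 *m B = d1 *m A + d2 *m B -> c1 = d1 /\ c2 = d2.
Proof.
by case=> f _ _; rewrite -!mul_row_col => /(row_free_inj f) /eq_row_mx.
Qed.
Lemma frame_sub A B (c1 c2 : 'rV[K]_3) : frame A B -> c1 *m A + c2 *m B <=m Y.
Proof.
move=> f; apply: addmx_sub; [apply: submx_trans (frame_A f) | apply: submx_trans (frame_B f)];
exact: submxMl.
Qed.
Lemma frame_rank A B : frame A B -> \rank A = 3%N /\ \rank B = 3%N.
Proof.
case=> f _ _; have := mxrank_adds_leqif A B => -[+ _].
have -> : \rank (A + B)%MS = 6%N by rewrite addsmxE; exact/eqP.
have := rank_leq_row A; have := rank_leq_row B; clear; lia.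
Qed.

Lemma theta_type A B th : frame A B -> Theta th ->
  exists H V, theta_data th H V <<A>>%MS \/ theta_data th H V <<B>>%MS.
Proof.
move=> f ht; have [H [V [S D]]] := g_th G ht; exists H, V.
have [rA rB] := frame_rank f.
have hu (u : vec) : u <=m S -> u <=m <<A>>%MS \/ u <=m <<B>>%MS.
  move=> uS; have [->|u0] := eqVneq u 0; first by left; apply: sub0mx.
  have := submx_trans uS (S_sub D); rewrite sub_capmx => /andP [_ ut].
  have : Z u by apply/(th_Z D ut); split=> //; right.
  by case: f => _ _ hZ /hZ [_]; rewrite !genmxE.
have [h|h] := sub_union hu.
- left; apply: (theta_data_eqS _ D); apply/andP; split=> //.
  by rewrite -(geq_leqif (mxrank_leqif_sup h)) (th_rankS D) genmxE rA.
- right; apply: (theta_data_eqS _ D); apply/andP; split=> //.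
  by rewrite -(geq_leqif (mxrank_leqif_sup h)) (th_rankS D) genmxE rB.
Qed.

(** Two members on [x] inducing the same plane are impossible: the vertex of one is the trace of the
    plane of the other on [ch x], hence would lie in its own plane. *)
Lemma theta_other A B th H V x : frame A B -> X x -> Theta th -> x <=m th ->
  theta_data th H V <<A>>%MS ->
  exists th' H' V', [/\ Theta th', x <=m th', theta_data th' H' V' <<B>>%MS & ~ (th == th')%MS].
Proof.
move=> f Xx ht xt D; have [th1 [th2 [ht1 ht2 ne xt1 xt2]]] := two Xx.
have [th' [ht' xt' ne']] : exists th', [/\ Theta th', x <=m th' & ~ (th == th')%MS].
  have [e|n] := classic (th == th1)%MS; last by exists th1.
  exists th2; split=> // e2; apply: ne; apply/eqmxP.
  exact: (eqmx_trans (eqmx_sym (eqmxP e)) (eqmxP e2)).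
have [H' [V' [D'|D']]] := theta_type f ht'; last by exists th', H', V'.
have h := star_V2 G Xx ht ht' ne' xt xt' D D'.
have : (V' <= <<A>> :&: V')%MS.
  by rewrite sub_capmx submx_refl andbT; apply/rV_subP => u /h [].
case/andP: (th_capSV D') => h1 _ /submx_trans /(_ h1); rewrite submx0 => /eqP V0.
by have := th_rankV D'; rewrite V0 mxrank0.
Qed.

Lemma theta_ex A B x : frame A B -> X x -> exists th H V,
  [/\ Theta th, x <=m th & theta_data th H V <<A>>%MS].
Proof.
move=> f Xx; have [th1 [_ [ht1 _ _ xt1 _]]] := two Xx.
have [H [V [D|D]]] := theta_type f ht1; first by exists th1, H, V.
have [th' [H' [V' [h1 h2 h3 _]]]] := theta_other (frame_sym f) Xx ht1 xt1 D.
by exists th', H', V'.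
Qed.

Section ThetaCoord.
Variables (A B : 'M[K]_(3, N.+1)) (th H V : sub).
Hypotheses (f : frame A B) (ht : Theta th) (D : theta_data th H V <<A>>%MS).
Let L : 'M[K]_(N.+1, 3) := (H + H^T) *m A^T.

Lemma bf_dot u (c : 'rV_3) : bf H u (c *m A) = dot c (u *m L).
Proof. by rewrite dotC /dot /bf /L trmx_mul !mulmxA. Qed.

Lemma A_th : (A <= th)%MS.
Proof.
have := S_sub D; rewrite genmxE => h; apply: submx_trans h _; exact: capmxSr.
Qed.
Lemma cA_th (c : 'rV_3) : c *m A <=m th.
Proof. exact: submx_trans (submxMl _ _) A_th. Qed.
Lemma cA_Y (c : 'rV_3) : c *m A <=m Y.
Proof. exact: submx_trans (submxMl _ _) (frame_A f). Qed.

Lemma th_kerL u : u <=m th -> u *m L = 0 -> u <=m Y.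
Proof.
move=> ut uL; apply: (th_max D) => // w wt wY.
have : w <=m (<<A>> + V)%MS by rewrite (eqmxP (th_subY D)) sub_capmx wY.
rewrite (adds_eqmx (genmxE A) (eqmx_refl V)) => /sub_addsmxP [[c d] /= ->].
rewrite bfDr bf_dot uL dotC dot0l add0r bfC; apply: (th_vertex D) => //.
exact: submxMl.
Qed.

Lemma th_YL u : u <=m th -> u <=m Y -> u *m L = 0.
Proof.
move=> ut uY; apply/rowP => i; rewrite [RHS]mxE -dot_delta -bf_dot.
by apply: (th_YY D) => //; [exact: cA_th | exact: cA_Y].
Qed.

Lemma th_section : exists g : 'M[K]_(3, N.+1), (g <= th)%MS /\ g *m L = 1%:M.
Proof.
have fr : row_free (A *m (H + H^T) *m th^T).
  rewrite -kermx_eq0; apply/eqP/row_matrixP => i; rewrite row0.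
  set c := row i _.
  have hc : c *m (A *m (H + H^T) *m th^T) = 0 by rewrite /c -row_mul mulmx_ker row0.
  have cV : c *m A <=m V.
    apply: (th_rad D); first exact: cA_th.
    move=> w /submxP [d ->]; rewrite /bf trmx_mul !mulmxA.
    by move: hc; rewrite !mulmxA => ->; rewrite mul0mx mxE.
  have : c *m A <=m (<<A>> :&: V)%MS by rewrite sub_capmx cV genmxE submxMl.
  case/andP: (th_capSV D) => h _ /submx_trans /(_ h); rewrite submx0 => /eqP cA0.
  have [r _] := frame_rank f.
  have fA : row_free A by rewrite /row_free r.
  by apply: (row_free_inj fA); rewrite cA0 mul0mx.
have /row_fullP [g hg] : row_full (A *m (H + H^T) *m th^T)^T by rewrite /row_full mxrank_tr.
exists (g *m th); split; first exact: submxMl.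
rewrite -hg !trmx_mul !trmxK linearD /= trmxK /L [H^T + H]addrC !mulmxA //.
Qed.

Lemma th_chA x c : X x -> x <=m th -> ch x (c *m A) <-> dot c (x *m L) = 0.
Proof. by move=> Xx xt; rewrite (th_ch G D Xx xt (cA_th c) (cA_Y c)) bf_dot. Qed.

Lemma th_qadd u (c1 c2 : 'rV_3) : u <=m th -> c1 *m A + c2 *m B <=m th ->
  (c2 *m B <=m V) -> qf H (u + (c1 *m A + c2 *m B)) = qf H u + dot c1 (u *m L).
Proof.
move=> ut ct cV; rewrite qfD (th_YQ D ct (frame_sub _ _ f)) addr0 bfDr bf_dot.
by rewrite (bfC H u (c2 *m B)) (th_vertex D cV ut) addr0.
Qed.
End ThetaCoord.

(** In the second clause [V] depends on [th] alone, so the second coordinate is constant on [th] up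
    to a scalar. *)
Lemma coords_theta A B th H V th' H' V' x : frame A B -> X x -> Theta th -> Theta th' ->
  x <=m th -> x <=m th' -> theta_data th H V <<A>>%MS -> theta_data th' H' V' <<B>>%MS ->
  ~ (th == th')%MS ->
  coords A B x (x *m ((H + H^T) *m A^T)) (x *m ((H' + H'^T) *m B^T)) /\
  (forall c, dot c (x *m ((H' + H'^T) *m B^T)) = 0 <-> c *m B <=m V).
Proof.
move=> f Xx ht ht' xt xt' D D' ne; have f' := frame_sym f.
have hA c := th_chA f D c Xx xt.
have hB c := th_chA f' D' c Xx xt'.
have sch := star_ch G Xx ht ht' ne xt xt' D D'.
have hV' := star_V2 G Xx ht ht' ne xt xt' D D'.
have hV := star_V2 G Xx ht' ht (neqmx_sym ne) xt' xt D' D.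
split; last first.
  move=> c; rewrite -hB hV; split=> [h|[]//]; split=> //.
  by rewrite genmxE submxMl.
split=> // c1 c2; rewrite -hA -hB; split; last by move=> [h1 h2]; apply: (chD G).
move=> h; have /sub_addsmxP [[p q] /= E] := proj1 (sch _) h.
have pV : p *m V <=m V by exact: submxMl.
have qV : q *m V' <=m V' by exact: submxMl.
have [hp] := proj1 (hV _) pV; rewrite genmxE => /submxP [d2 e2].
have [hq] := proj1 (hV' _) qV; rewrite genmxE => /submxP [d1 e1].
have [|<- <-] := @frame_inj A B d1 d2 c1 c2 f; first by rewrite E e1 e2 addrC.
by rewrite -e1 -e2.
Qed.

(* A member of Theta inducing the plane A: u *m L is the first coordinate of a
   point u of th, the second one is constantly b, and g is a section of L. *)
Record theta_one A B th H (L : 'M[K]_(N.+1, 3)) (g : 'M[K]_(3, N.+1)) b : Prop := ThetaOne {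
  t1_th : Theta th;
  t1_g : (g <= th)%MS;
  t1_gL : g *m L = 1%:M;
  t1_ker : forall u, u <=m th -> u *m L = 0 -> u <=m Y;
  t1_Y : forall u, u <=m th -> u <=m Y -> u *m L = 0;
  t1_coords : forall u, u <=m th -> X u -> coords A B u (u *m L) b;
  t1_in : forall c1 c2 : 'rV_3, c1 *m A + c2 *m B <=m th <-> dot c2 b = 0;
  t1_X : forall u, u <=m th -> ~ u <=m Y -> (X u <-> qf H u = 0);
  t1_add : forall u (c1 c2 : 'rV_3), u <=m th -> dot c2 b = 0 ->
     qf H (u + (c1 *m A + c2 *m B)) = qf H u + dot c1 (u *m L) }.

Lemma coords_eqb A B x a b b' : (forall c, dot c b = 0 <-> dot c b' = 0) ->
  coords A B x a b -> coords A B x a b'.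
Proof. by move=> h [Xx hx]; split=> // c1 c2; rewrite hx h. Qed.

Lemma theta_one_ex A B x : frame A B -> X x -> exists th H L g b,
  [/\ b != 0, theta_one A B th H L g b, x <=m th & coords A B x (x *m L) b].
Proof.
move=> f Xx; have [th [H [V [ht xt D]]]] := theta_ex f Xx.
have [th' [H' [V' [ht' xt' D' ne]]]] := theta_other f Xx ht xt D.
have [hcls hV] := coords_theta f Xx ht ht' xt xt' D D' ne.
have [g [gt gL]] := th_section f D.
set b := x *m ((H' + H'^T) *m B^T) in hcls hV.
have bV c : c *m B <=m V <-> dot c b = 0 by rewrite hV.
have inV c1 c2 : c1 *m A + c2 *m B <=m th <-> dot c2 b = 0.
  rewrite hV; split=> h.
    have : c1 *m A + c2 *m B <=m (<<A>> + V)%MS.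
      by rewrite (eqmxP (th_subY D)) sub_capmx h (frame_sub _ _ f).
    rewrite (adds_eqmx (genmxE A) (eqmx_refl V)) => /sub_addsmxP [[p q] /= E].
    have qV : q *m V <=m V by exact: submxMl.
    have [_ h2] := proj1 (star_V2 G Xx ht' ht (neqmx_sym ne) xt' xt D' D (q *m V)) qV.
    move: h2; rewrite genmxE => /submxP [d e]; rewrite e in E.
    by have [_ ->] := frame_inj f E; rewrite -e.
  apply: addmx_sub; first exact: cA_th D _.
  have := submx_trans h (V_sub D); rewrite sub_capmx => /andP [] //.
have b0 : b != 0.
  apply/eqP => b0; apply: (g_XY G Xx); apply: (th_kerL D') => //.
exists th, H, ((H + H^T) *m A^T), g, b; split=> //; split=> //.
- move=> u; exact: (th_kerL D).
- move=> u; exact: (th_YL f D).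
- move=> u ut Xu.
  have [th2 [H2 [V2 [ht2 ut2 D2 ne2]]]] := theta_other f Xu ht ut D.
  have [hc hv] := coords_theta f Xu ht ht2 ut ut2 D D2 ne2.
  by apply: coords_eqb hc => c; rewrite hv hV.
- move=> u ut nY; split; first by move=> Xu; apply: (th_XQ D).
  exact: (th_X D).
- move=> u c1 c2 ut /[dup] /(inV c1) h /bV cV; exact: (th_qadd f D).
Qed.

End Coord.

(** * Coordinates determine the points modulo Y *)

Section Points.
Variables (K : fieldType) (N : nat).
Local Notation vec := 'rV[K]_(N.+1).
Local Notation sub := 'M[K]_(N.+1).
Variables (X Z : vec -> Prop) (Y : sub) (Xi Theta : sub -> Prop).

Hypothesis G : geom X Z Y Xi Theta 2%N 2%N 2%N.
Local Notation C := (XY X Y).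
Local Notation ch := (ch X Y).
Local Notation adj := (adj X Y).
Local Notation theta_data := (theta_data X Z Y 2%N 2%N).
Hypothesis two : forall x, X x -> exists th1 th2,
  [/\ Theta th1, Theta th2, ~ (th1 == th2)%MS, x <=m th1 & x <=m th2].
Local Notation frame := (frame Z Y).
Implicit Types (a b : 'rV[K]_3) (A B : 'M[K]_(3, N.+1)) (u w x : vec) (th H V : sub).
Local Notation coords := (coords X Y).
Local Notation theta_one := (theta_one X Y Theta).
Hypothesis Xex : exists x, X x.

Definition prop n (a a' : 'rV[K]_n) := exists k, a' = k *: a.

Lemma coords_X A B x a b : coords A B x a b -> X x. Proof. by case. Qed.
Lemma coords_chA A B x a b c : coords A B x a b -> ch x (c *m A) <-> dot c a = 0.
Proof.
move=> [_ h]; have := h c 0; rewrite mul0mx addr0 dot0l => ->.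
by split=> [[]|].
Qed.
Lemma coords_chB A B x a b c : coords A B x a b -> ch x (c *m B) <-> dot c b = 0.
Proof. by move=> /coords_sym; apply: coords_chA. Qed.

Lemma prop_iff a a' : a != 0 -> a' != 0 -> prop a a' -> forall c, dot c a = 0 <-> dot c a' = 0.
Proof.
move=> a0 a0' [k e] c; have k0 : k != 0.
  by apply: contraNneq a0' => k0; rewrite e k0 scale0r.
rewrite e dotZr; split=> [->|/eqP]; first by rewrite mulr0.
by rewrite mulf_eq0 (negPf k0) => /eqP.
Qed.

Lemma coords_propA A B x a b a' b' : a != 0 -> coords A B x a b -> coords A B x a' b' -> prop a a'.
Proof.
move=> a0 h h'; apply: dot_prop a0 _ => c.
by rewrite -(coords_chA c h) (coords_chA c h').
Qed.

Lemma theta_one_eqb A B th H L g b b' : (forall c, dot c b = 0 <-> dot c b' = 0) ->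
  theta_one A B th H L g b -> theta_one A B th H L g b'.
Proof.
move=> e [h1 h2 h3 h4 h5 h6 h7 h8 h9]; split=> //.
- by move=> u ut Xu; apply: (coords_eqb e); apply: h6.
- by move=> c1 c2; rewrite h7 e.
- by move=> u c1 c2 ut /e; apply: h9.
Qed.

Lemma t1_point A B th H L g b u : frame A B -> theta_one A B th H L g b ->
  u <=m th -> u *m L != 0 -> exists c : 'rV_3,
  let x := u + c *m A in [/\ x <=m th, x *m L = u *m L & coords A B x (u *m L) b].
Proof.
move=> f D ut uL; have [c hc] := dot_solve (- qf H u) uL; exists c => /=.
have cAt : c *m A <=m th.
  by have := proj2 (t1_in D c 0) (dot0l _); rewrite mul0mx addr0.
have cAY : c *m A <=m Y by apply: submx_trans (frame_A f); exact: submxMl.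
have xt : u + c *m A <=m th by insub.
have xL : (u + c *m A) *m L = u *m L by rewrite mulmxDl (t1_Y D cAt cAY) addr0.
split=> //; rewrite -xL; apply: (t1_coords D) => //.
have nY : ~ u + c *m A <=m Y.
  by move=> h; move: uL; rewrite -xL (t1_Y D xt h) eqxx.
apply/(t1_X D xt nY).
have := t1_add D c ut (dot0l b); rewrite mul0mx addr0 => ->.
by rewrite hc subrr.
Qed.

(** A member inducing the plane [B] contains points whose second coordinate is any given [b]; the
    member inducing [A] on such a point is the required one. *)
Lemma theta_one_for A B b : frame A B -> b != 0 -> exists th H L g, theta_one A B th H L g b.
Proof.
move=> f b0; have [x0 Xx0] := Xex; have f' := frame_sym f.
have [th' [H' [L' [g' [b' [b0' D' _ _]]]]]] := theta_one_ex G two f' Xx0.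
have ut : b *m g' <=m th' by apply: submx_trans (t1_g D'); exact: submxMl.
have uL : b *m g' *m L' = b by rewrite -mulmxA (t1_gL D') mulmx1.
have [|c /= [xt xL hc]] := t1_point f' D' ut; first by rewrite uL.
rewrite uL in hc; have /coords_sym hc' := hc.
have [th [H [L [g [b2 [b20 D xt2 hc2]]]]]] := theta_one_ex G two f (coords_X hc).
exists th, H, L, g; apply: theta_one_eqb D; apply: prop_iff => //.
exact: (coords_propA b20 (coords_sym hc2) (coords_sym hc')).
Qed.

Lemma coords_ch_eq A B x x' a b : frame A B -> coords A B x a b -> coords A B x' a b ->
  forall u, ch x u -> ch x' u.
Proof.
move=> f [_ h] [_ h'] u hu; have [c1 [c2 e]] := frame_coord f (ch_Y hu).
by move: hu; rewrite e h -h'.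
Qed.

Lemma coords_uniq_theta A B th H V x x' a b : frame A B -> theta_data th H V <<A>>%MS ->
  x <=m th -> x' <=m th -> a != 0 -> coords A B x a b -> coords A B x' a b ->
  exists k, x' - k *: x <=m Y.
Proof.
move=> f D xt xt' a0 h h'; have [Xx _] := h; have [Xx' _] := h'.
set L := (H + H^T) *m A^T.
have p c : dot c (x *m L) = 0 <-> dot c a = 0.
  by rewrite -(th_chA G f D c Xx xt) (coords_chA c h).
have p' c : dot c (x' *m L) = 0 <-> dot c a = 0.
  by rewrite -(th_chA G f D c Xx' xt') (coords_chA c h').
have xL0 : x *m L != 0.
  by apply/eqP => h0; apply: (g_XY G Xx); apply: (th_kerL D).
have [|k e] := dot_prop (a := x *m L) (a' := x' *m L) xL0; first by move=> c /p /p'.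
exists k; apply: (th_kerL D); first by insub.
by rewrite mulmxBl -scalemxAl -/L e subrr.
Qed.

(** Equal coordinates mean equal sets [ch]. Collinear points, if independent modulo [Y], have
    different ones by [adj_noncol]; a member of Xi on non-collinear ones would contain [ch x], of
    rank 4, in its vertex of rank 2; in a member of Theta the form decides. *)
Lemma coords_uniq A B x x' a b : frame A B -> a != 0 -> b != 0 ->
  coords A B x a b -> coords A B x' a b -> exists k, x' - k *: x <=m Y.
Proof.
move=> f a0 b0 h h'; have [Xx _] := h; have [Xx' _] := h'.
have [i|/(nind2 (g_XY G Xx))//] := classic (ind2 Y x x').
have [th1 [th2 [ht1 ht2 ne xt1 xt2]]] := two Xx.
have [c|nC] := classic (C (x + x')).
  have ax : adj x x' by split.
  have [e [e1 e2]] := adj_noncol G Xx ht1 ht2 ne xt1 xt2 ax.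
  by case: e2; apply: (coords_ch_eq f h h').
have [z [mz xz xz']] := g_S1 G Xx (or_introl Xx').
case: (mz) => hz; last first.
  have [H [V [D|D]]] := theta_type G f hz.
    exact: (coords_uniq_theta f D xz xz' a0 h h').
  exact: (coords_uniq_theta (frame_sym f) D xz xz' b0 (coords_sym h) (coords_sym h')).
have [H D] := g_xi G hz.
have [E hE] := chi_mx G Xx.
have rE := rank_chi_vertex G Xx ht1 ht2 ne xt1 xt2 hE.
have : (E <= Y :&: z)%MS.
  apply/rV_subP => u /hE hu; rewrite sub_capmx; have hu' := coords_ch_eq f h h' hu.
  have [uY Xu] := hu; have [_ Xu'] := hu'; rewrite uY /=.
  apply: (convex G mz Xx Xx' nC) => //; first by right.
  - by rewrite addrC; left.
  - by rewrite addrC; left.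
by move/mxrankS; rewrite rE (xi_rankV D).
Qed.

Lemma coords_adj_theta A B th H V x x' a b a' b' : frame A B -> Theta th ->
  theta_data th H V <<A>>%MS -> x <=m th -> x' <=m th -> b != 0 ->
  coords A B x a b -> coords A B x' a' b' -> prop b b'.
Proof.
move=> f ht D xt xt' b0 h h'; have [Xx _] := h; have [Xx' _] := h'.
have [t1 [H1 [V1 [ht1 xt1 D1 ne1]]]] := theta_other G two f Xx ht xt D.
have [t2 [H2 [V2 [ht2 xt2 D2 ne2]]]] := theta_other G two f Xx' ht xt' D.
have [hc1 e1] := coords_theta G f Xx ht ht1 xt xt1 D D1 ne1.
have [hc2 e2] := coords_theta G f Xx' ht ht2 xt' xt2 D D2 ne2.
apply: dot_prop b0 _ => c; rewrite -(coords_chB c h) -(coords_chB c h').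
by rewrite (coords_chB c hc1) (coords_chB c hc2) e1 e2.
Qed.

(** By [adj_noncol] adjacent points lie in a member of Theta, along which one of the coordinates is
    constant. *)
Lemma coords_adj A B x x' a b a' b' : frame A B -> a != 0 -> b != 0 ->
  coords A B x a b -> coords A B x' a' b' -> adj x x' -> prop a a' \/ prop b b'.
Proof.
move=> f a0 b0 h h' ax; have [Xx _] := h; have [Xx' _] := h'.
have [th1 [th2 [ht1 ht2 ne xt1 xt2]]] := two Xx.
have [e [e1 e2]] := adj_noncol G Xx ht1 ht2 ne xt1 xt2 ax.
have [th [ht xt xt' _]] := ch_theta G ax e1 e2.
have [H [V [D|D]]] := theta_type G f ht; [right|left].
  exact: (coords_adj_theta f ht D xt xt' b0 h h').
exact: (coords_adj_theta (frame_sym f) ht D xt xt' a0 (coords_sym h) (coords_sym h')).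
Qed.

Lemma coords_scaleA A B x a b k : k != 0 -> coords A B x (k *: a) b <-> coords A B x a b.
Proof.
move=> k0; have e c : dot c (k *: a) = 0 <-> dot c a = 0.
  rewrite dotZr; split=> [/eqP|->]; last by rewrite mulr0.
  by rewrite mulf_eq0 (negPf k0) => /eqP.
by split=> -[Xx h]; split=> // c1 c2; rewrite h e.
Qed.

Lemma coords_move A B x x' a b k : k != 0 -> X x' -> x' - k *: x <=m Y ->
  coords A B x a b -> coords A B x' a b.
Proof.
move=> k0 Xx' hY [Xx h]; split=> // c1 c2; rewrite -h.
have Xkx : X (k *: x) by apply: (g_XZ G).
have E : x' = k *: x + (x' - k *: x) by rewrite addrC subrK.
have hk : ch (k *: x) (x' - k *: x) by split; rewrite -?E.
by rewrite E (ch_shift G _ Xkx hk) (ch_scale G _ k0 Xx).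
Qed.

Section Pt.
Variables (A B : 'M[K]_(3, N.+1)).
Hypothesis f : frame A B.

(* u projects from Y to the point with coordinates (a, b). *)
Definition pt a b u := exists x, coords A B x a b /\ u - x <=m Y.

Lemma pt_nY a b u : pt a b u -> ~ u <=m Y.
Proof.
move=> [x [[Xx _] h]] uY; apply: (g_XY G Xx).
by rewrite -[x](subKr u); insub.
Qed.

Lemma pt_modY a b u u' : pt a b u -> u' - u <=m Y -> pt a b u'.
Proof.
move=> [x [h1 h2]] h; exists x; split=> //.
have -> : u' - x = (u' - u) + (u - x) by rewrite addrA subrK.
by insub.
Qed.

Lemma ptZ k a b u : k != 0 -> pt a b u -> pt a b (k *: u).
Proof.
move=> k0 [x [h1 h2]]; exists (k *: x); split; last by rewrite -scalerBr; insub.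
by apply: (coords_move k0 _ _ h1); [apply: (g_XZ G) => //; case: h1 | rewrite subrr; insub].
Qed.

Lemma pt_scaleA k a b u : k != 0 -> pt (k *: a) b u -> pt a b u.
Proof. by move=> k0 [x [/(coords_scaleA _ _ _ _ _ k0) h1 h2]]; exists x. Qed.

Lemma pt_uniq a b u u' : a != 0 -> b != 0 -> pt a b u -> pt a b u' ->
  exists k, k != 0 /\ u' - k *: u <=m Y.
Proof.
move=> a0 b0 [x [h1 h2]] [x' [h1' h2']].
have [k hk] := coords_uniq f a0 b0 h1 h1'; exists k; split.
  apply/eqP => k0; move: hk; rewrite k0 scale0r subr0; apply: (g_XY G); exact: coords_X h1'.
have -> : u' - k *: u = (u' - x') + (x' - k *: x) - k *: (u - x).
  by vecring.
by insub.
Qed.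

Lemma pt_diff a b a' b' u u' k : a != 0 -> b != 0 -> pt a b u -> pt a' b' u' ->
  k != 0 -> u' - k *: u <=m Y -> prop a a' /\ prop b b'.
Proof.
move=> a0 b0 [x [h1 h2]] [x' [h1' h2']] k0 h.
have hc : coords A B x' a b.
  apply: (coords_move k0 (coords_X h1') _ h1).
  have -> : x' - k *: x = (u' - k *: u) - (u' - x') + k *: (u - x) by vecring.
  by insub.
split; first exact: (coords_propA a0 hc h1').
exact: (coords_propA b0 (coords_sym hc) (coords_sym h1')).
Qed.

(** The kernels of two non-proportional functionals are distinct hyperplanes and together span the
    space. *)
Lemma dot_split a a' c : ~ prop a a' -> a != 0 -> exists c1 c2 : 'rV_3,
  [/\ c = c1 + c2, dot c1 a = 0 & dot c2 a' = 0].
Proof.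
move=> np a0; have [d [d1 d2]] : exists d : 'rV_3, dot d a = 0 /\ dot d a' != 0.
  apply: NNPP => h; apply: np; apply: dot_prop a0 _ => d hd; apply/eqP/negPn/negP => hn.
  by apply: h; exists d.
exists ((dot c a' / dot d a') *: d), (c - (dot c a' / dot d a') *: d); split.
- by rewrite addrC subrK.
- by rewrite dotZl d1 mulr0.
- by rewrite dotDl dotNl dotZl divfK // subrr.
Qed.

(* If the sum of two points of X lies over a point of X, their representatives
   can be moved so that the sum lies in X, whence they are collinear. *)
Lemma pt_add a b a' b' a'' b'' u u' : a != 0 -> b != 0 ->
  pt a b u -> pt a' b' u' -> pt a'' b'' (u + u') -> prop a a' \/ prop b b'.
Proof.
move=> a0 b0 p [x' [h1' h2']] [x'' [[Xx'' _] h2'']].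
have [x [h1 h2]] := p.
apply: NNPP => /not_or_and [na nb].
set y := x'' - (x + x').
have yY : y <=m Y.
  have -> : y = (u - x) + (u' - x') - (u + u' - x'') by rewrite /y; vecring.
  by insub.
have [c1 [c2 ey]] := frame_coord f yY.
have [p1 [p2 [e1 q1 q1']]] := dot_split c1 na a0.
have [r1 [r2 [e2 q2 q2']]] := dot_split c2 nb b0.
have [Xx hx] := h1; have [Xx' hx'] := h1'.
have hy1 : ch x (p1 *m A + r1 *m B) by apply/hx.
have hy2 : ch x' (p2 *m A + r2 *m B) by apply/hx'.
set y1 := p1 *m A + _ in hy1; set y2 := p2 *m A + _ in hy2.
have ey2 : y = y1 + y2.
  by rewrite ey e1 e2 /y1 /y2 !mulmxDl addrACA.
have c : C (x + y1 + (x' + y2)).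
  by left; rewrite addrACA -ey2 /y addrC subrK.
have [y1Y Xy1] := hy1; have [y2Y Xy2] := hy2.
have h3 : coords A B (x + y1) a b.
  by apply: (coords_move (oner_neq0 _) Xy1 _ h1); rewrite scale1r addrAC subrr add0r.
have h3' : coords A B (x' + y2) a' b'.
  by apply: (coords_move (oner_neq0 _) Xy2 _ h1'); rewrite scale1r addrAC subrr add0r.
have i : ind2 Y (x + y1) (x' + y2).
  apply: NNPP => /(nind2 (g_XY G Xy1)) [s hs].
  have s0 : s != 0.
    by apply/eqP => s0; apply: (g_XY G Xy2); move: hs; rewrite s0 scale0r subr0.
  have hc := coords_move s0 Xy2 hs h3.
  by apply: na; apply: (coords_propA a0 hc h3').
by have [] := coords_adj f a0 b0 h3 h3' (And4 Xy1 Xy2 c i).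
Qed.

Lemma pt_row b : b != 0 -> exists g : 'M[K]_(3, N.+1), forall a, a != 0 -> pt a b (a *m g).
Proof.
move=> b0; have [th [H [L [g D]]]] := theta_one_for f b0; exists g => a a0.
have ut : a *m g <=m th by apply: submx_trans (t1_g D); exact: submxMl.
have uL : a *m g *m L = a by rewrite -mulmxA (t1_gL D) mulmx1.
have [|c /= [xt xL hc]] := t1_point f D ut; first by rewrite uL.
exists (a *m g + c *m A); rewrite uL in hc; split=> //.
rewrite opprD addrA subrr sub0r; apply: oppmx_sub.
by apply: submx_trans (frame_A f); exact: submxMl.
Qed.
End Pt.

Lemma pt_sym A B a b u : pt A B a b u -> pt B A b a u.
Proof. by move=> [x [/coords_sym h1 h2]]; exists x. Qed.
End Points.

(** * The Segre variety *)

Section Segre.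
Variables (K : fieldType) (N : nat).
Local Notation vec := 'rV[K]_(N.+1).
Local Notation sub := 'M[K]_(N.+1).
Variables (X Z : vec -> Prop) (Y : sub) (Xi Theta : sub -> Prop).

Hypothesis G : geom X Z Y Xi Theta 2%N 2%N 2%N.
Hypothesis two : forall x, X x -> exists th1 th2,
  [/\ Theta th1, Theta th2, ~ (th1 == th2)%MS, x <=m th1 & x <=m th2].
Local Notation frame := (frame Z Y).
Implicit Types (a b : 'rV[K]_3) (A B : 'M[K]_(3, N.+1)) (u w x : vec) (th H V : sub).
Hypothesis Xex : exists x, X x.
Variables (A B : 'M[K]_(3, N.+1)).
Hypothesis f : frame A B.
Local Notation pt := (pt X Y A B).
Local Notation e j := (delta_mx 0 j : 'rV[K]_3).

Lemma delta_nprop (i j : 'I_3) : i != j -> ~ prop (e i) (e j).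
Proof.
move=> ij [k /rowP /(_ j)]; rewrite !mxE !eqxx /= eq_sym (negPf ij) mulr0 => /eqP.
by rewrite oner_eq0.
Qed.
Lemma delta_n0 (i : 'I_3) : e i != 0.
Proof. by apply/eqP => /rowP /(_ i)/eqP; rewrite !mxE !eqxx oner_eq0. Qed.

Lemma pt_col a : a != 0 -> exists h : 'M[K]_(3, N.+1), forall b, b != 0 -> pt a b (b *m h).
Proof.
move=> a0; have [h hh] := pt_row G two Xex (frame_sym f) a0.
by exists h => b /hh /pt_sym.
Qed.

Section Rows.
Variable g : 'I_3 -> 'M[K]_(3, N.+1).
Hypothesis hg : forall j a, a != 0 -> pt a (e j) (a *m g j).

Lemma rows_indep2 (i j : 'I_3) a1 a2 : i != j ->
  a1 *m g i + a2 *m g j <=m Y -> a1 = 0 /\ a2 = 0.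
Proof.
move=> ij h.
have [a10|a10] := eqVneq a1 0.
  split=> //; apply/eqP/negPn/negP => a20; apply: (pt_nY G (hg j a20)).
  by move: h; rewrite a10 mul0mx add0r.
have [a20|a20] := eqVneq a2 0.
  by case: (pt_nY G (hg i a10)); move: h; rewrite a20 mul0mx addr0.
case: (delta_nprop ij).
have [||_ //] := pt_diff G (k := -1) a10 (delta_n0 i) (hg i a10) (hg j a20) _ _.
- by rewrite oppr_eq0 oner_eq0.
- by rewrite scaleN1r opprK addrC.
Qed.

(** In a relation between nonzero terms, the first two add up to a point over [e k], so [pt_add]
    makes [a1] and [a2] proportional. Then the sum lies over a combination of [e i] and [e j], which
    is not proportional to [e k]. *)
Lemma rows_indep3 (i j k : 'I_3) a1 a2 a3 : i != j -> i != k -> j != k ->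
  a1 *m g i + a2 *m g j + a3 *m g k <=m Y -> [/\ a1 = 0, a2 = 0 & a3 = 0].
Proof.
move=> ij ik jk h.
have [a10|a10] := eqVneq a1 0.
  by move: h; rewrite a10 mul0mx add0r => /(rows_indep2 jk) [-> ->].
have [a20|a20] := eqVneq a2 0.
  by move: h; rewrite a20 mul0mx addr0 => /(rows_indep2 ik) [-> ->].
have [a30|a30] := eqVneq a3 0.
  by move: h; rewrite a30 mul0mx addr0 => /(rows_indep2 ij) [-> ->].
exfalso; set u := a1 *m g i in h; set u' := a2 *m g j in h; set u3 := a3 *m g k in h.
have p1 : pt a1 (e i) u := hg i a10.
have p2 : pt a2 (e j) u' := hg j a20.
have m1 : (-1 : K) != 0 by rewrite oppr_eq0 oner_eq0.
have p3 := ptZ G m1 (hg k a30); rewrite -/u3 in p3.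
have p4 : pt a3 (e k) (u + u').
  by apply: pt_modY p3 _; rewrite scaleN1r opprK.
have [[t et]|/(delta_nprop ij)//] := pt_add G two f a10 (delta_n0 i) p1 p2 p4.
have t0 : t != 0 by apply: contraNneq a20 => t0; rewrite et t0 scale0r.
have p2' : pt a1 (e j) u' by apply: (pt_scaleA t0); rewrite -et.
have [h0 hh0] := pt_col a10.
have [s1 [s10 hs1]] := pt_uniq G two f a10 (delta_n0 i) (hh0 _ (delta_n0 i)) p1.
have [s2 [s20 hs2]] := pt_uniq G two f a10 (delta_n0 j) (hh0 _ (delta_n0 j)) p2'.
set b := s1 *: e i + s2 *: e j.
have b0 : b != 0.
  apply/eqP => /rowP /(_ i); rewrite !mxE !eqxx /= (negPf ij) mulr1 mulr0 addr0.
  by apply/eqP.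
have p5 : pt a1 b (u + u').
  apply: pt_modY (hh0 _ b0) _.
  have -> : u + u' - b *m h0 = (u - s1 *: (e i *m h0)) + (u' - s2 *: (e j *m h0)).
    by rewrite /b mulmxDl -!scalemxAl opprD addrACA.
  by insub.
have [|_ [t' /rowP /(_ k)/eqP]] := pt_diff G (k := 1) a10 b0 p5 p4 (oner_neq0 _).
  by rewrite scale1r subrr; insub.
rewrite !mxE !eqxx /= ![k == _]eq_sym (negPf ik) (negPf jk) !mulr0 addr0 mulr0.
by rewrite oner_eq0.
Qed.

Lemma rows_indep (c : 'I_3 -> 'rV[K]_3) :
  \sum_j c j *m g j <=m Y -> forall j, c j = 0.
Proof.
rewrite !big_ord_recl big_ord0 addr0 addrA => /rows_indep3 [] // h0 h1 h2 j.
case: (unliftP ord0 j) => [j1|] -> //; case: (unliftP ord0 j1) => [j2|] -> //.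
by rewrite (ord1 j2).
Qed.
End Rows.

Lemma row_e b (h : 'M[K]_(3, N.+1)) : b *m h = \sum_j b 0 j *: (e j *m h).
Proof. by rewrite mulmx_sum_row; apply: eq_bigr => j _; rewrite rowE. Qed.

Lemma sum_subY I (r : seq I) (P : pred I) (F : I -> vec) : (forall i, P i -> F i <=m Y) ->
  \sum_(i <- r | P i) F i <=m Y.
Proof.
move=> h; apply: (big_ind (fun u : vec => u <=m Y)) => //; first exact: sub0mx.
by move=> u w; apply: addmx_sub.
Qed.

(* With respect to the three rows g j over the basis of the second factor, a
   row over (1,1,1) has coordinates that do not depend on the first factor;
   scaling the g j by them makes the parametrization bilinear. *)
Lemma segre_linear : exists g : 'I_3 -> 'M[K]_(3, N.+1),
  (forall a b, a != 0 -> b != 0 -> pt a b (\sum_j b 0 j *: (a *m g j))) /\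
  (forall c : 'I_3 -> 'rV[K]_3, \sum_j c j *m g j <=m Y -> forall j, c j = 0).
Proof.
have [g hg] : exists g : 'I_3 -> 'M[K]_(3, N.+1), forall j a, a != 0 -> pt a (e j) (a *m g j).
  have := fun j => pt_row G two Xex f (delta_n0 j); exact: fin_all_exists.
pose one : 'rV[K]_3 := const_mx 1.
have one0 : one != 0 by apply/eqP => /rowP /(_ 0)/eqP; rewrite !mxE oner_eq0.
have [g0 hg0] := pt_row G two Xex f one0.
have oneh (h : 'M[K]_(3, N.+1)) : one *m h = \sum_j e j *m h.
  by rewrite row_e; apply: eq_bigr => j _; rewrite mxE scale1r.
have coord a : a != 0 -> exists nu : 'I_3 -> K,
    (forall j, nu j != 0) /\ a *m g0 - \sum_j nu j *: (a *m g j) <=m Y.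
  move=> a0; have [h hh] := pt_col a0.
  have [s hs] : exists s : 'I_3 -> K, forall j, s j != 0 /\ a *m g j - s j *: (e j *m h) <=m Y.
    have := fun j => pt_uniq G two f a0 (delta_n0 j) (hh _ (delta_n0 j)) (hg j a a0).
    exact: fin_all_exists.
  have [s0 [s00 hs0]] := pt_uniq G two f a0 one0 (hh _ one0) (hg0 a a0).
  exists (fun j => s0 / s j); split.
    by move=> j; have [sj _] := hs j; rewrite mulf_neq0 ?invr_eq0.
  have -> : a *m g0 - \sum_j (s0 / s j) *: (a *m g j) = (a *m g0 - s0 *: (one *m h))
      - \sum_j (s0 / s j) *: (a *m g j - s j *: (e j *m h)).
    have -> : \sum_j (s0 / s j) *: (a *m g j - s j *: (e j *m h))
        = \sum_j (s0 / s j) *: (a *m g j) - s0 *: (one *m h).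
      rewrite oneh scaler_sumr -sumrB; apply: eq_bigr => j _.
      by rewrite scalerBr scalerA divfK //; have [] := hs j.
    by rewrite opprB addrA subrK.
  apply: addmx_sub => //; apply/oppmx_sub/sum_subY => j _.
  by have [_] := hs j => h1; insub.
have [ka [ka0 hka]] := coord one one0.
have [nu hnu] : exists nu : 'I_3 -> 'I_3 -> K,
    forall i, (forall j, nu i j != 0) /\ e i *m g0 - \sum_j nu i j *: (e i *m g j) <=m Y.
  have := fun i => coord (e i) (delta_n0 i); exact: fin_all_exists.
(* [one] is the sum of the [e i]; expanding [one *m g0] directly and termwise gives two expressions,
   compared by [rows_indep]. *)
have kanu i j : nu i j = ka j.
  have : \sum_j (ka j *: one - \sum_i nu i j *: e i) *m g j <=m Y.
    have -> : \sum_j (ka j *: one - \sum_i nu i j *: e i) *m g j =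
        \sum_i (e i *m g0 - \sum_j nu i j *: (e i *m g j))
        - (one *m g0 - \sum_j ka j *: (one *m g j)).
      rewrite sumrB -oneh opprB addrC -!addrA addKr.
      rewrite (eq_bigr (fun j => ka j *: (one *m g j) - \sum_i nu i j *: (e i *m g j))).
        by rewrite sumrB [in RHS]exchange_big.
      move=> j' _; rewrite mulmxBl -scalemxAl; congr (_ - _).
      by rewrite mulmx_suml; apply: eq_bigr => i' _; rewrite -scalemxAl.
    apply: addmx_sub; last exact: oppmx_sub.
    by apply: sum_subY => i' _; have [] := hnu i'.
  move/(rows_indep hg)/(_ j) => /rowP /(_ i).
  rewrite !mxE summxE mulr1 (bigD1 i) //= big1 => [|i' ne].
    by rewrite !mxE !eqxx mulr1 addr0 => /eqP; rewrite subr_eq0 => /eqP.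
  by rewrite !mxE eqxx eq_sym (negPf ne) mulr0.
have hall a : a *m g0 - \sum_j ka j *: (a *m g j) <=m Y.
  have -> : a *m g0 - \sum_j ka j *: (a *m g j) =
      \sum_i a 0 i *: (e i *m g0 - \sum_j nu i j *: (e i *m g j)).
    rewrite (row_e a g0) -sumrN.
    rewrite [RHS](eq_bigr (fun i => a 0 i *: (e i *m g0)
       - \sum_j ka j *: (a 0 i *: (e i *m g j)))); last first.
      move=> i _; rewrite scalerBr scaler_sumr; congr (_ - _); apply: eq_bigr => j _.
      by rewrite kanu !scalerA mulrC.
    rewrite sumrB sumrN exchange_big; congr (_ - _); apply: eq_bigr => j _.
    by rewrite (row_e a (g j)) scaler_sumr.
  by apply: sum_subY => i _; have [_ h] := hnu i; insub.
exists (fun j => ka j *: g j); split; last first.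
  move=> c h j; apply/eqP; have : ka j *: c j = 0.
    apply: (rows_indep hg (c := fun j => ka j *: c j)).
    rewrite (eq_bigr (fun j => c j *m (ka j *: g j))) // => j' _.
    by rewrite -scalemxAl -scalemxAr.
  by move/eqP; rewrite scaler_eq0 (negPf (ka0 j)).
move=> a b a0 b0; have [h hh] := pt_col a0.
have [s hs] : exists s : 'I_3 -> K, forall j, s j != 0 /\
    ka j *: (a *m g j) - s j *: (e j *m h) <=m Y.
  have := fun j => pt_uniq G two f a0 (delta_n0 j) (hh _ (delta_n0 j)) (ptZ G (ka0 j) (hg j a a0)).
  exact: fin_all_exists.
have [s0 [s00 hs0]] := pt_uniq G two f a0 one0 (hh _ one0) (hg0 a a0).
(* Otherwise the vector [d] of the differences [s0 - s j] is nonzero, and yet [d *m h] lies in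
   [Y]. *)
have ss j : s j = s0.
  apply/eqP; rewrite eq_sym -subr_eq0; apply/negPn/negP => n0.
  set d : 'rV[K]_3 := \row_j (s0 - s j).
  have d0 : d != 0.
    by apply: contraNneq n0 => /rowP /(_ j); rewrite !mxE => ->.
  apply: (pt_nY G (hh _ d0)).
  have -> : d *m h = \sum_j (ka j *: (a *m g j) - s j *: (e j *m h))
      + (a *m g0 - \sum_j ka j *: (a *m g j)) - (a *m g0 - s0 *: (one *m h)).
    rewrite row_e oneh scaler_sumr sumrB.
    rewrite (eq_bigr (fun j => s0 *: (e j *m h) - s j *: (e j *m h))); last first.
      by move=> j' _; rewrite !mxE scalerBl.
    by rewrite sumrB; vecring.
  by have ha := hall a; insub; apply: sum_subY => j' _; have [] := hs j'.
apply: (pt_modY (ptZ G s00 (hh _ b0))).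
have -> : \sum_j b 0 j *: (a *m (ka j *: g j)) - s0 *: (b *m h) =
    \sum_j b 0 j *: (ka j *: (a *m g j) - s j *: (e j *m h)).
  rewrite (row_e b h) scaler_sumr -sumrB; apply: eq_bigr => j _.
  by rewrite ss scalerBr -scalemxAr !scalerA mulrC [s0 * _]mulrC.
by apply: sum_subY => j _; have [_ h1] := hs j; insub.
Qed.
End Segre.

(** * Moving the bilinear section into X *)

Section Normal.
Variables (K : fieldType) (N : nat).
Local Notation vec := 'rV[K]_(N.+1).
Local Notation sub := 'M[K]_(N.+1).
Variables (X Z : vec -> Prop) (Y : sub) (Xi Theta : sub -> Prop).

Hypothesis G : geom X Z Y Xi Theta 2%N 2%N 2%N.
Local Notation ch := (ch X Y).
Hypothesis two : forall x, X x -> exists th1 th2,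
  [/\ Theta th1, Theta th2, ~ (th1 == th2)%MS, x <=m th1 & x <=m th2].
Local Notation frame := (frame Z Y).
Implicit Types (a b : 'rV[K]_3) (A B : 'M[K]_(3, N.+1)) (u w x : vec) (th H V : sub).
Hypothesis Xex : exists x, X x.
Local Notation coords := (coords X Y).
Local Notation theta_one := (theta_one X Y Theta).
Local Notation pt := (pt X Y).
Local Notation e j := (delta_mx 0 j : 'rV[K]_3).

(** [th] has a point with the same coordinates, equal to [x] modulo [Y] up to a scalar, and [th]
    contains the whole fibre over it by [ch_in_theta]. *)
Lemma t1_all A B th H L g a b x : frame A B -> theta_one A B th H L g b ->
  a != 0 -> b != 0 -> coords A B x a b -> x <=m th.
Proof.
move=> f D a0 b0 hx; have [Xx _] := hx.
have ut : a *m g <=m th by apply: submx_trans (t1_g D); exact: submxMl.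
have uL : a *m g *m L = a by rewrite -mulmxA (t1_gL D) mulmx1.
have [|c /= [xt xL hc]] := t1_point f D ut; first by rewrite uL.
rewrite uL in hc; set x' := a *m g + c *m A in xt hc.
have [k hk] := coords_uniq G two f a0 b0 hc hx; have [Xx' _] := hc.
have k0 : k != 0.
  by apply/eqP => k0; move: hk; rewrite k0 scale0r subr0; apply: (g_XY G).
have hch : ch x' (x - k *: x').
  apply/(ch_scale G _ k0 Xx'); split=> //; by rewrite addrC subrK.
have := ch_in_theta G (t1_th D) xt Xx' hch => h.
by rewrite -(subrK (k *: x') x); insub.
Qed.

Lemma eigen_scalar (M : 'M[K]_3) : (forall a, a != 0 -> exists k, a *m M = k *: a) ->
  exists k, M = k%:M.
Proof.
move=> h; pose one : 'rV[K]_3 := const_mx 1.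
have one0 : one != 0 by apply/eqP => /rowP /(_ 0)/eqP; rewrite !mxE oner_eq0.
have [k hk] := h one one0; exists k.
have [nu hnu] : exists nu : 'I_3 -> K, forall i, e i *m M = nu i *: e i.
  have := fun i => h (e i) (delta_n0 K i); exact: fin_all_exists.
have off i j : M i j = nu i * (i == j)%:R.
  by have /rowP /(_ j) := hnu i; rewrite -rowE !mxE eqxx /= eq_sym => ->.
apply/matrixP => i j; rewrite off !mxE.
have /rowP /(_ j) := hk; rewrite !mxE (bigD1 j) //= big1 => [|i' ne].
  rewrite !mxE off eqxx !mulr1 addr0 mul1r => <-.
  by have [->|] := eqVneq i j; rewrite ?mulr1 ?mulr0.
by rewrite off (negPf ne) !mulr0.
Qed.

Lemma pt_X A B a b u : frame A B -> pt A B a b u ->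
  exists c1 c2 : 'rV_3, coords A B (u + (c1 *m A + c2 *m B)) a b.
Proof.
move=> f [x [hx hu]]; have [|c1 [c2 e]] := frame_coord (u := x - u) f.
  by rewrite -opprB; insub.
by exists c1, c2; rewrite -e addrC subrK.
Qed.

Lemma X_coords A B a b u x : frame A B -> pt A B a b u -> x - u <=m Y -> X x -> coords A B x a b.
Proof.
move=> f [x' [hx' hu]] h Xx; apply: (coords_move G (oner_neq0 _) Xx _ hx').
have -> : x - 1 *: x' = (x - u) + (u - x') by rewrite scale1r addrA subrK.
by insub.
Qed.

Lemma rows_of (P : 'I_3 -> 'rV[K]_3 -> 'rV[K]_3 -> Prop) :
  (forall i, exists c1 c2, P i c1 c2) ->
  exists C1 C2 : 'M[K]_3, forall i, P i (row i C1) (row i C2).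
Proof.
move=> h; have [c1 h1] := fin_all_exists h; have [c2 h2] := fin_all_exists h1.
exists (\matrix_i c1 i), (\matrix_i c2 i) => i; by rewrite !rowK.
Qed.

(* [dot c1 a] measures how far X is from the section g; within the member of
   Theta over b this is minus the quadratic form along g, up to a scalar. *)
Lemma deviation_quad A B b (g : 'M[K]_(3, N.+1)) : frame A B -> b != 0 ->
  (forall a, a != 0 -> pt A B a b (a *m g)) ->
  exists Q : 'M[K]_3, forall a (c1 c2 : 'rV_3), a != 0 ->
    X (a *m g + (c1 *m A + c2 *m B)) -> dot c1 a = dot (a *m Q) a.
Proof.
move=> f b0 hg; have [th [H [L [gt D]]]] := theta_one_for G two Xex f b0.
have [C1 [C2 hC]] := rows_of (fun i => pt_X f (hg _ (delta_n0 K i))).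
(* The rows of [g] lie in [th] only modulo [Y]; those of [S] are points of [X] over the same places,
   hence in [th]. *)
pose S := g + (C1 *m A + C2 *m B).
have St : (S <= th)%MS.
  apply/row_subP => i; apply: (t1_all f D (delta_n0 K i) b0 (a := e i)).
  by rewrite /S !linearD /= !row_mul (rowE i g); apply: hC.
have aSt a : a *m S <=m th by apply: submx_trans St; exact: submxMl.
have aS a : a *m S = a *m g + (a *m C1 *m A + a *m C2 *m B).
  by rewrite /S !mulmxDr !mulmxA.
have aSpt a : a != 0 -> pt A B a b (a *m S).
  move=> a0; apply: (pt_modY (hg a a0)).
  by rewrite aS addrAC subrr add0r (frame_sub _ _ f).
have aSL a : a != 0 -> a *m S *m L != 0.
  move=> a0; apply/eqP => h; apply: (pt_nY G (aSpt a a0)); exact: (t1_ker D).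
have [la hla] : exists k, S *m L = k%:M.
  apply: eigen_scalar => a a0; rewrite mulmxA.
  have [c /= [xt xL hc]] := t1_point f D (aSt a) (aSL a a0).
  have hc' : coords A B (a *m S + c *m A) a b.
    apply: (X_coords f (aSpt a a0)); last by case: hc.
    by rewrite addrAC subrr add0r; apply: submx_trans (frame_A f); exact: submxMl.
  exact: (coords_propA a0 hc' hc).
have la0 : la != 0.
  apply: contraNneq (aSL _ (delta_n0 K 0)) => la0.
  by rewrite -mulmxA hla la0 scalar_mx_0 mulmx0.
(* A point of [X] over [a] satisfies [qf H (a *m S) + la * dot (c1 - a *m C1) a = 0]; solving for
   [dot c1 a] gives this matrix. *)
exists (C1 - la^-1 *: (S *m H *m S^T)) => a c1 c2 a0 Xx.
have hx : coords A B (a *m g + (c1 *m A + c2 *m B)) a b.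
  by apply: (X_coords f (hg a a0)) => //; rewrite addrAC subrr add0r (frame_sub _ _ f).
have xt := t1_all f D a0 b0 hx.
have E : a *m g + (c1 *m A + c2 *m B)
    = a *m S + ((c1 - a *m C1) *m A + (c2 - a *m C2) *m B).
  rewrite aS !mulmxBl.
  by move: (a *m g) (c1 *m A) (c2 *m B) (a *m C1 *m A) (a *m C2 *m B) => *; vecring.
have zt : (c1 - a *m C1) *m A + (c2 - a *m C2) *m B <=m th.
  have -> : (c1 - a *m C1) *m A + (c2 - a *m C2) *m B
     = (a *m g + (c1 *m A + c2 *m B)) - a *m S by rewrite E addrAC subrr add0r.
  by have h := aSt a; insub.
have db := proj1 (t1_in D _ _) zt.
have q0 : qf H (a *m g + (c1 *m A + c2 *m B)) = 0.
  by apply/(t1_X D xt) => //; apply: (g_XY G).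
move: q0; rewrite E (t1_add D _ (aSt a) db) -mulmxA hla mul_mx_scalar dotZr => q0.
have -> : dot (a *m (C1 - la^-1 *: (S *m H *m S^T))) a
    = dot (a *m C1) a - la^-1 * qf H (a *m S).
  rewrite mulmxBr -scalemxAr dotDl dotNl dotZl; congr (_ - _ * _).
  by rewrite /dot /qf trmx_mul !mulmxA.
move: q0; rewrite dotDl dotNl => q0.
have -> : qf H (a *m S) = - (la * (dot c1 a - dot (a *m C1) a)).
  by apply/eqP; rewrite -addr_eq0; apply/eqP.
by field.
Qed.

(** For fixed [a] all points lie in the member inducing [B], whose points of [Y] have their [A] part
    in the kernel of [a]. Comparison with a linear section inside this member gives
    [dot c1 a = dot (b *m C1) a]. *)
Lemma deviation_lin A B a (h : 'M[K]_(3, N.+1)) : frame A B -> a != 0 ->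
  (forall b, b != 0 -> pt A B a b (b *m h)) ->
  exists l : 'rV[K]_3, forall b (c1 c2 : 'rV_3), b != 0 ->
    X (b *m h + (c1 *m A + c2 *m B)) -> dot c1 a = dot b l.
Proof.
move=> f a0 hh; have f' := frame_sym f.
have [th [H [L [gt D]]]] := theta_one_for G two Xex f' a0.
have [C1 [C2 hC]] := rows_of (fun i => pt_X f (hh _ (delta_n0 K i))).
pose S := h + (C1 *m A + C2 *m B).
have St : (S <= th)%MS.
  apply/row_subP => i; apply: (t1_all f' D (delta_n0 K i) a0 (a := e i)).
  by apply: coords_sym; rewrite /S !linearD /= !row_mul (rowE i h); apply: hC.
exists (a *m C1^T) => b c1 c2 b0 Xx.
have hx : coords A B (b *m h + (c1 *m A + c2 *m B)) a b.
  by apply: (X_coords f (hh b b0)) => //; rewrite addrAC subrr add0r (frame_sub _ _ f).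
have xt := t1_all f' D b0 a0 (coords_sym hx).
have bSt : b *m S <=m th by apply: submx_trans St; exact: submxMl.
have zt : (c2 - b *m C2) *m B + (c1 - b *m C1) *m A <=m th.
  have -> : (c2 - b *m C2) *m B + (c1 - b *m C1) *m A
     = (b *m h + (c1 *m A + c2 *m B)) - b *m S.
    rewrite /S !mulmxBl !mulmxDr !mulmxA.
    by move: (b *m h) (c1 *m A) (c2 *m B) (b *m C1 *m A) (b *m C2 *m B) => *; vecring.
  by insub.
have := proj1 (t1_in D _ _) zt; rewrite dotDl dotNl => /eqP; rewrite subr_eq0 => /eqP ->.
by rewrite /dot trmx_mul trmxK !mulmxA.
Qed.

Definition bilin (g : 'I_3 -> 'M[K]_(3, N.+1)) a b := \sum_j b 0 j *: (a *m g j).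

Lemma bilin_delta g a j : bilin g a (e j) = a *m g j.
Proof.
rewrite /bilin (bigD1 j) //= big1 => [|i ne]; first by rewrite mxE !eqxx scale1r addr0.
by rewrite mxE (negPf ne) andbF scale0r.
Qed.

(** For fixed [a] the function is linear in [b], so its values at the [e j], which are quadratic in
    [a], determine it. *)
Lemma deviation A B g : frame A B ->
  (forall a b, a != 0 -> b != 0 -> pt A B a b (bilin g a b)) ->
  exists Q : 'I_3 -> 'M[K]_3, forall a b (c1 c2 : 'rV_3), a != 0 -> b != 0 ->
    X (bilin g a b + (c1 *m A + c2 *m B)) -> dot c1 a = dot (\sum_j b 0 j *: (a *m Q j)) a.
Proof.
move=> f hg.
have [Q hQ] : exists Q : 'I_3 -> 'M[K]_3, forall j a (c1 c2 : 'rV_3), a != 0 ->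
    X (a *m g j + (c1 *m A + c2 *m B)) -> dot c1 a = dot (a *m Q j) a.
  have hj j : exists Q : 'M[K]_3, forall a (c1 c2 : 'rV_3), a != 0 ->
      X (a *m g j + (c1 *m A + c2 *m B)) -> dot c1 a = dot (a *m Q) a.
    apply: (deviation_quad f (delta_n0 K j)) => a a0.
    by rewrite -bilin_delta; apply: hg => //; exact: delta_n0.
  exact: (fin_all_exists hj).
exists Q => a b c1 c2 a0 b0.
pose h : 'M[K]_(3, N.+1) := \matrix_j (a *m g j).
have bh b' : b' *m h = bilin g a b'.
  by rewrite mulmx_sum_row; apply: eq_bigr => j _; rewrite rowK.
have hh b' : b' != 0 -> pt A B a b' (b' *m h) by move=> b0'; rewrite bh; apply: hg.
have [l hl] := deviation_lin f a0 hh.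
rewrite -bh => /(hl _ _ _ b0) ->.
have lj j : l 0 j = dot (a *m Q j) a.
  have [d1 [d2 [Xd _]]] := pt_X f (hh _ (delta_n0 K j)).
  rewrite -dot_delta -(hl _ _ _ (delta_n0 K j) Xd).
  by apply: (hQ j a d1 d2 a0); move: Xd; rewrite bh bilin_delta.
rewrite /dot mulmx_suml summxE mxE; apply: eq_bigr => j _.
by rewrite mxE lj -scalemxAl mxE.
Qed.

Lemma normal_form A B : frame A B -> exists w : 'I_3 -> 'I_3 -> vec,
  (forall a b (c1 c2 : 'rV_3), a != 0 -> b != 0 ->
     (X (\sum_i \sum_j (a 0 i * b 0 j) *: w i j + (c1 *m A + c2 *m B)) <->
      dot c1 a = 0 /\ dot c2 b = 0)) /\
  [/\ (forall t : 'I_3 -> 'I_3 -> K, \sum_i \sum_j t i j *: w i j <=m Y ->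
         forall i j, t i j = 0) &
      forall x, X x -> exists a b, [/\ a != 0, b != 0 &
        x - \sum_i \sum_j (a 0 i * b 0 j) *: w i j <=m Y]].
Proof.
move=> f; have f' := frame_sym f.
have [g [hg ind]] := segre_linear G two Xex f.
have hg1 a b : a != 0 -> b != 0 -> pt A B a b (bilin g a b) by exact: hg.
(* [g] with its two factors exchanged, to which [deviation] applies for the frame [B], [A]. *)
pose g' (i : 'I_3) : 'M[K]_(3, N.+1) := \matrix_j row i (g j).
have expand a b : bilin g a b = \sum_i \sum_j (a 0 i * b 0 j) *: row i (g j).
  rewrite exchange_big; apply: eq_bigr => j _.
  rewrite mulmx_sum_row scaler_sumr; apply: eq_bigr => i _.
  by rewrite scalerA mulrC.
have gg' a b : bilin g' b a = bilin g a b.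
  rewrite expand; apply: eq_bigr => i _.
  rewrite mulmx_sum_row scaler_sumr; apply: eq_bigr => j _.
  by rewrite rowK scalerA.
have hg2 a b : a != 0 -> b != 0 -> pt B A a b (bilin g' a b).
  by move=> a0 b0; rewrite gg'; apply: pt_sym; apply: hg1.
have [Q1 hQ1] := deviation f hg1; have [Q2 hQ2] := deviation f' hg2.
(* The corrections [t1] and [t2] have the same deviations as the points of [X] over the section, so
   adding them lands in [X]; being bilinear, they can be absorbed into the vectors [w i j]. *)
pose w i j := row i (g j) + (row i (Q1 j) *m A + row j (Q2 i) *m B).
pose t1 a b := \sum_j b 0 j *: (a *m Q1 j).
pose t2 a b := \sum_i a 0 i *: (b *m Q2 i).
have wE a b : \sum_i \sum_j (a 0 i * b 0 j) *: w i j
    = bilin g a b + (t1 a b *m A + t2 a b *m B).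
  rewrite expand.
  have -> : t1 a b *m A = \sum_i \sum_j (a 0 i * b 0 j) *: (row i (Q1 j) *m A).
    rewrite mulmx_suml exchange_big; apply: eq_bigr => j _.
    rewrite (mulmx_sum_row a (Q1 j)) scaler_sumr mulmx_suml; apply: eq_bigr => i _.
    by rewrite scalerA -scalemxAl mulrC.
  have -> : t2 a b *m B = \sum_i \sum_j (a 0 i * b 0 j) *: (row j (Q2 i) *m B).
    rewrite mulmx_suml; apply: eq_bigr => i _.
    rewrite (mulmx_sum_row b (Q2 i)) scaler_sumr mulmx_suml; apply: eq_bigr => j _.
    by rewrite scalerA -scalemxAl.
  rewrite -!big_split /=; apply: eq_bigr => i _.
  by rewrite -!big_split /=; apply: eq_bigr => j _; rewrite !scalerDr.
have Xw a b : a != 0 -> b != 0 -> coords A B (\sum_i \sum_j (a 0 i * b 0 j) *: w i j) a b.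
  move=> a0 b0; rewrite wE.
  have [c1 [c2 hc]] := pt_X f (hg1 _ _ a0 b0); have [Xc hch] := hc.
  have e1 := hQ1 _ _ _ _ a0 b0 Xc.
  have Xc' : X (bilin g' b a + (c2 *m B + c1 *m A)) by rewrite gg' addrC [c2 *m B + _]addrC addrC.
  have e2 := hQ2 _ _ _ _ b0 a0 Xc'.
  have hd : ch (bilin g a b + (c1 *m A + c2 *m B)) ((t1 a b - c1) *m A + (t2 a b - c2) *m B).
    by apply/hch; rewrite !dotDl !dotNl e1 e2 !subrr.
  have E : bilin g a b + (t1 a b *m A + t2 a b *m B) = bilin g a b + (c1 *m A + c2 *m B)
      + ((t1 a b - c1) *m A + (t2 a b - c2) *m B).
    rewrite !mulmxBl.
    by move: (bilin g a b) (c1 *m A) (c2 *m B) (t1 a b *m A) (t2 a b *m B) => *; vecring.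
  have [dY Xd] := hd; rewrite E.
  apply: (coords_move G (oner_neq0 _) Xd _ hc).
  by rewrite scale1r addrAC subrr add0r.
exists w; split; last split.
- move=> a b c1 c2 a0 b0; have [Xx hch] := Xw a b a0 b0.
  rewrite -hch; split=> [h|[]//]; split=> //; exact: (frame_sub _ _ f).
- move=> t h i j.
  have hY : \sum_i \sum_j t i j *: (row i (Q1 j) *m A + row j (Q2 i) *m B) <=m Y.
    by apply: sum_subY => i' _; apply: sum_subY => j' _; have h0 := frame_sub (row i' (Q1 j')) (row j' (Q2 i')) f; insub.
  have h' : \sum_j (\row_i t i j) *m g j <=m Y.
    have -> : \sum_j (\row_i t i j) *m g j = \sum_i \sum_j t i j *: w i j
        - \sum_i \sum_j t i j *: (row i (Q1 j) *m A + row j (Q2 i) *m B).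
      rewrite -sumrB.
      rewrite (eq_bigr (fun j => \sum_i t i j *: row i (g j))); last first.
        move=> j' _; rewrite mulmx_sum_row; apply: eq_bigr => i' _; by rewrite mxE.
      rewrite exchange_big; apply: eq_bigr => i' _; rewrite -sumrB.
      by apply: eq_bigr => j' _; rewrite -scalerBr addrK.
    by insub.
  by have /rowP /(_ i) := ind _ h' j; rewrite !mxE.
- move=> x Xx.
  have [th [H [L [g0 [b [b0 D xt hx]]]]]] := theta_one_ex G two f Xx.
  set a := x *m L in hx.
  have a0 : a != 0 by apply/eqP => a0; apply: (g_XY G Xx); apply: (t1_ker D).
  have [k hk] := coords_uniq G two f a0 b0 (Xw a b a0 b0) hx.
  have k0 : k != 0.
    by apply/eqP => k0; move: hk; rewrite k0 scale0r subr0; apply: (g_XY G).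
  (* Coordinates are only defined up to scalars, so the factor [k] is put into [a]. *)
  exists (k *: a), b; split=> //; first by rewrite scaler_eq0 (negPf k0).
  have -> : \sum_i \sum_j ((k *: a) 0 i * b 0 j) *: w i j
     = k *: (\sum_i \sum_j (a 0 i * b 0 j) *: w i j) by
    rewrite scaler_sumr; apply: eq_bigr => i _; rewrite scaler_sumr; apply: eq_bigr => j _;
    by rewrite mxE scalerA mulrA.
  exact: hk.
Qed.
End Normal.

(** * Conclusion *)

Section FromAxioms.
Variables (K : fieldType) (N : nat).
Local Notation vec := 'rV[K]_(N.+1).
Local Notation sub := 'M[K]_(N.+1).
Variables (v : int) (r' : nat) (v' : int) (X Z : vec -> Prop) (Y : sub) (Xi Theta : sub -> Prop).
Hypothesis hK : exists a : K, a != 0 /\ a != 1.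
Hypothesis hS : dual_split_veronese X Z Y Xi Theta 1 v r' v'.
Hypothesis two : forall x, X x -> exists theta1 theta2,
      [/\ Theta theta1, Theta theta2, ~ (theta1 == theta2)%MS,
          (x <= theta1)%MS & (x <= theta2)%MS].

Lemma XuY_XY (u : vec) : u != 0 -> XuY X Y u <-> XY X Y u.
Proof. by move=> u0; split=> [[|[]]|[]] h; [left|right|left|right]. Qed.

Lemma dsv_theta th : Theta th -> exists H V S, theta_data X Z Y (natp1 v') r' th H V S.
Proof.
move=> ht; have [_ _ _ hT _] := hS; have [rth [Vt [M [S []]]]] := hT th ht.
move=> cone [[Mth Msing _] eM] [SM rS cSV sSV] hZ hX.
have [H [_ [q rad vert VW rV]]] := cone_form cone.
have qd u : u <=m th -> XY X Y u <-> qf H u = 0.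
  move=> ut; have [->|u0] := eqVneq u 0.
    by rewrite qf0; split=> // _; right; apply: sub0mx.
  by rewrite -(q u ut u0) -XuY_XY //; split=> [|[]].
have Mq u : u <=m M -> qf H u = 0.
  move=> uM; have ut := submx_trans uM Mth; apply/qd => //; right.
  by move: uM; rewrite -(eqmxP eM) sub_capmx => /andP [].
have Mb u w : u <=m M -> w <=m M -> bf H u w = 0.
  move=> uM wM; have := Mq _ (addmx_sub uM wM); by rewrite qfD !Mq // !add0r.
have Sth := submx_trans SM Mth.
have eSV : (S + Vt == Y :&: th)%MS.
  by apply/eqmxP; apply: (eqmx_trans (eqmxP sSV)); apply/eqmx_sym/eqmxP.
have rM : \rank M = (r'.+1 + natp1 v')%N.
  rewrite -(eqmxP sSV) -rS -rV; apply: mxrank_disjoint_sum.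
  by apply/eqP; rewrite -submx0; case/andP: cSV.
have bS (w : vec) j : (w *m ((H + H^T) *m S^T)) 0 j = bf H w (row j S).
  by rewrite /bf tr_row colE !mulmxA -colE [RHS]mxE.
exists H, Vt, S; split=> //.
- move=> u ut hu.
  (* [O] is the orthogonal complement of [S] in [th]. As [S] misses the radical, [O] has corank
     [r' + 1], the rank of [M]; since [O] contains [M], the two coincide. *)
  set O := (th :&: kermx ((H + H^T) *m S^T))%MS.
  have uO : u <=m O.
    rewrite sub_capmx ut; apply/sub_kermxP; apply/rowP => j.
    rewrite bS [RHS]mxE; apply: hu; first exact: submx_trans (row_sub _ _) Sth.
    apply: submx_trans (row_sub _ _) _; apply: submx_trans SM _.
    by rewrite -(eqmxP eM) capmxSl.
  have MO : (M <= O)%MS.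
    apply/rV_subP => w wM; rewrite sub_capmx (submx_trans wM Mth).
    apply/sub_kermxP/rowP => j; rewrite bS [RHS]mxE; apply: Mb => //.
    exact: submx_trans (row_sub _ _) SM.
  have rk1 := mxrank_mul_ker th ((H + H^T) *m S^T).
  have rk2 := mxrank_mul_ker S ((H + H^T) *m th^T).
  have c0 : (S :&: kermx ((H + H^T) *m th^T))%MS = 0.
    apply/eqP; rewrite -submx0; case/andP: cSV => h _; apply: submx_trans h.
    rewrite sub_capmx capmxSl; apply/rV_subP => s; rewrite sub_capmx => /andP [sS /sub_kermxP hs].
    apply: rad; first exact: submx_trans Sth.
    by move=> w /submxP [d ->]; rewrite /bf trmx_mul !mulmxA; move: hs; rewrite !mulmxA => ->; rewrite mul0mx mxE.
  rewrite c0 mxrank0 addn0 rS in rk2.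
  have e : \rank (th *m ((H + H^T) *m S^T)) = r'.+1.
    rewrite -rk2 -mxrank_tr !trmx_mul trmxK linearD /= trmxK addrC.
    by rewrite mulmxA.
  have OM : (O <= M)%MS.
    rewrite -(geq_leqif (mxrank_leqif_sup MO)) rM; move: rk1; rewrite e rth -/O; clear; lia.
  have := submx_trans uO OM; rewrite -(eqmxP eM) sub_capmx => /andP [] //.
- by move=> u ut; rewrite -hZ; split=> [|[]].
Qed.

Lemma dsv_geom : geom X Z Y Xi Theta (natp1 v) (natp1 v') r'.
Proof.
have [[[_ r1 _ _] [[X0 XZ] [Z0 _] _ _]] _ hXi hT [S1 S2 S3]] := hS.
split=> //.
(* That [X] misses [Y] is read off in a member of Theta on [u], where [X] avoids the generator cut
   out by [Y]. *)
- move=> u Xu uY; have [th [_ [ht _ _ ut _]]] := two Xu.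
  have [_ [Vt [M [S [_ [_ eM] _ _ hX]]]]] := hT th ht.
  have [_] := proj1 (hX u) (conj Xu ut); apply.
  by rewrite -(eqmxP eM) sub_capmx uY.
- move=> xi hxi; have [rxi cone hX] := hXi xi hxi.
  have [H [tan [q rad vert VW rV]]] := cone_form cone.
  exists H; split=> //.
  + move=> u ut; have [->|u0] := eqVneq u 0.
      by rewrite qf0; split=> // _; right; apply: sub0mx.
    by rewrite -(q u ut u0) -XuY_XY //; split=> [|[]].
  + by move=> u ut h; have := rad u ut h; rewrite sub_capmx => /andP [].
  + by move=> u w ut uY wt; apply: vert => //; rewrite sub_capmx uY.
  + move=> u ut nY; have [|l [lt ql bl il]] := tan u isT ut.
      by rewrite sub_capmx => /andP [].
    exists l; split=> // s t h; apply: il.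
    by rewrite sub_capmx h; insub.
- exact: dsv_theta.
- move=> p q Xp hq; have [rk|rk] := eqVneq (\rank (col_mx p q)) 2%N.
    have [z [hz [pz qz]]] := S1 p q (or_introl Xp) hq rk; by exists z.
  (* If [p] and [q] are the same projective point, (S1) says nothing, but any member on [p] will
     do. *)
  have [th [_ [ht _ _ pt _]]] := two Xp; exists th; split=> //; first by right.
  have rp : \rank p = 1%N by rewrite rank_rV X0.
  have psub : (p <= col_mx p q)%MS by rewrite -addsmxE addsmxSl.
  have : (col_mx p q <= p)%MS.
    rewrite -(geq_leqif (mxrank_leqif_sup psub)) rp.
    by have := rank_leq_row (col_mx p q); move: rk; clear; lia.
  by rewrite col_mx_sub => /andP [_ /submx_trans]; apply.
- move=> z z' hz hz' ne u uz uz'; have [->|u0] := eqVneq u 0; first by right; apply: sub0mx.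
  by apply/XuY_XY => //; apply: (S2 z z' hz hz' ne) => //; rewrite sub_capmx uz.
Qed.
End FromAxioms.

Section Assembly.
Variables (K : fieldType) (N : nat).
Local Notation vec := 'rV[K]_(N.+1).
Variables (w : 'I_3 -> 'I_3 -> vec) (A B : 'M[K]_(3, N.+1)).

(** The linear map that takes the vectorized elementary matrix at [i], [j] to [w i j]. *)
Definition tensor_mx : 'M[K]_(3 * 3, N.+1) :=
  \sum_i \sum_j (mxvec (delta_mx i j : 'M[K]_3))^T *m w i j.

Lemma tensor_mxE (t : 'M[K]_3) : mxvec t *m tensor_mx = \sum_i \sum_j t i j *: w i j.
Proof.
rewrite /tensor_mx mulmx_sumr; apply: eq_bigr => i _.
rewrite mulmx_sumr; apply: eq_bigr => j _; rewrite mulmxA.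
have -> : mxvec t *m (mxvec (delta_mx i j : 'M_3))^T = (t i j)%:M.
  rewrite mxvec_delta trmx_delta -colE; apply/matrixP => a b.
  by rewrite [LHS]mxE [RHS]mxE (ord1 a) (ord1 b) eqxx mulr1n mxvecE.
by rewrite mul_scalar_mx.
Qed.

Definition frame_mx : 'M[K]_(3 * 3 + (3 + 3), N.+1) := col_mx tensor_mx (col_mx A B).

Lemma frame_mxE (t : 'M[K]_3) (c1 c2 : 'rV[K]_3) :
  row_mx (mxvec t) (row_mx c1 c2) *m frame_mx
  = \sum_i \sum_j t i j *: w i j + (c1 *m A + c2 *m B).
Proof. by rewrite !mul_row_col tensor_mxE. Qed.
End Assembly.

Lemma natp1_inj (v : int) : -1 <= v -> natp1 v = 2%N -> v = 1.
Proof. rewrite /natp1; lia. Qed.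

Theorem theorem5p34 (K : fieldType) (N : nat) (v : int) (r' : nat) (v' : int)
  (X Z : 'rV[K]_(N.+1) -> Prop) (Y : 'M[K]_(N.+1))
  (Xi Theta : 'M[K]_(N.+1) -> Prop) :
  (exists a : K, a != 0 /\ a != 1) ->
  dual_split_veronese X Z Y Xi Theta 1 v r' v' ->
  (exists theta, Theta theta) ->
  (forall x, X x -> exists theta1 theta2,
      [/\ Theta theta1, Theta theta2, ~ (theta1 == theta2)%MS,
          (x <= theta1)%MS & (x <= theta2)%MS]) ->
  (forall y : 'rV[K]_(N.+1), y != 0 -> (y <= Y)%MS ->
      ~ (forall x, X x -> collinear X Y y x)) ->
  [/\ r' = 2%N, v = 1, v' = 1 &
      exists (A : 'M[K]_(N.+1, 2.+1 * 2.+1 + (2.+1 + 2.+1)))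
             (Z1b : 'M[K]_(2.+1, 2.+1 + 2.+1)) (Z2b : 'M[K]_(2.+1, 2.+1 + 2.+1))
             (D1 D2 : 'M[K]_(2.+1)),
        [/\ row_free A && row_full A, DS_data Z1b Z2b D1 D2,
            (forall u, X u <-> DS_pts Z1b Z2b D1 D2 (u *m A)),
            (forall u, (u <= Y)%MS <-> DS_Y (u *m A)) &
            (forall u, Z u <-> DS_Z Z1b Z2b (u *m A))]].
Proof.
move=> hK hS [th0 hth0] two _.
have G := dsv_geom hK hS two.
have [[[_ _ hv hv'] [_ Zpt spanXZ spanZ]] _ _ _ _] := hS.
(* By ranks a member of Theta has a vector outside [Y], and adding a suitable vector of [Y] puts it
   on the quadric. *)
have [x0 Xx0] : exists x, X x.
  have [H [V [S D]]] := g_th G hth0.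
  have [u [ut nu]] : exists u : 'rV_(N.+1), u <=m th0 /\ ~ u <=m Y.
    apply: NNPP => h.
    have : (th0 <= Y :&: th0)%MS.
      rewrite sub_capmx submx_refl andbT; apply/rV_subP => u ut.
      by apply: NNPP => nu; apply: h; exists u.
    move/mxrankS; rewrite (th_rankY D) (th_rank D); clear; lia.
  have [y [yt yY b]] := th_solve1 D ut nu (- qf H u).
  exists (u + y); apply: (th_X D); first by insub.
    by move=> h; apply: nu; rewrite -(addrK y u); insub.
  by rewrite qfD (th_YQ D yt yY) b addr0 subrr.
have [th1 [th2 [ht1 ht2 ne xt1 xt2]]] := two x0 Xx0.
have [H1 [V1 [S1 D1]]] := g_th G ht1; have [H2 [V2 [S2 D2]]] := g_th G ht2.
have r2 := theta_r G Xx0 ht1 ht2 ne xt1 xt2.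
have m2 := star_mv G Xx0 ht1 ht2 ne xt1 xt2 D1 D2.
have m2' := star_mv' G Xx0 ht1 ht2 ne xt1 xt2 D1 D2.
have [A [B fr]] := frame_exists G two Xx0 spanZ Zpt.
have Xex : exists x, X x by exists x0.
move: (G); rewrite r2 m2 m2' => G'.
have [w [hX [ind cover]]] := normal_form G' two Xex fr.
split=> //; [exact: natp1_inj hv m2 | exact: natp1_inj hv' m2' |].
set P := frame_mx w A B.
have PE t c1 c2 : row_mx (mxvec t) (row_mx c1 c2) *m P
    = \sum_i \sum_j t i j *: w i j + (c1 *m A + c2 *m B) := frame_mxE w A B t c1 c2.
have tens (a b c1 c2 : 'rV[K]_3) : row_mx (mxvec (a^T *m b)) (row_mx c1 c2) *m P
    = \sum_i \sum_j (a 0 i * b 0 j) *: w i j + (c1 *m A + c2 *m B).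
  rewrite PE; congr (_ + _); apply: eq_bigr => i _; apply: eq_bigr => j _.
  by congr (_ *: _); rewrite mxE big_ord1 mxE.
have YE (c1 c2 : 'rV[K]_3) : row_mx 0 (row_mx c1 c2) *m P = c1 *m A + c2 *m B.
  by rewrite /P /frame_mx !mul_row_col mul0mx add0r.
have Pfree : row_free P.
  rewrite -kermx_eq0; apply/eqP/row_matrixP => i; rewrite row0.
  set k := row i _; have : k *m P = 0 by rewrite /k -row_mul mulmx_ker row0.
  rewrite -[k]hsubmxK -[rsubmx k]hsubmxK -[lsubmx k]vec_mxK.
  move: (vec_mx (lsubmx k)) (lsubmx (rsubmx k)) (rsubmx (rsubmx k)) => t c1 c2 h.
  have t0 : t = 0.
    apply/matrixP => a b; rewrite mxE; apply: (ind (fun a b => t a b)).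
    have -> : \sum_i \sum_j t i j *: w i j = - (c1 *m A + c2 *m B).
      by apply/eqP; rewrite -addr_eq0 -PE h.
    by apply/oppmx_sub/(frame_sub _ _ fr).
  move: h; rewrite t0 linear0 YE => h.
  have [|-> ->] := frame_inj (d1 := 0) (d2 := 0) fr (c1 := c1) (c2 := c2).
    by rewrite h !mul0mx addr0.
  by rewrite !row_mx0.
have coverP u : X u -> exists a b c1 c2 : 'rV[K]_3,
    [/\ a != 0, b != 0 & u = row_mx (mxvec (a^T *m b)) (row_mx c1 c2) *m P].
  move=> Xu; have [a [b [a0 b0 hY]]] := cover u Xu.
  have [c1 [c2 e]] := frame_coord fr hY.
  by exists a, b, c1, c2; rewrite tens -e addrC subrK.
have Pfull : row_full P.
  have [_ /(_ <<P>>%MS)] := spanXZ.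
  rewrite !genmxE -sub1mx; apply => u; rewrite genmxE => -[/coverP|].
    by move=> [a [b [c1 [c2 [_ _ ->]]]]]; exact: submxMl.
  move=> Zu; have [ZY _] := spanZ; have [c1 [c2 ->]] := frame_coord fr (ZY u Zu).
  by rewrite -YE submxMl.
set Q := pinvmx P.
have PQ : P *m Q = 1%:M by apply: mulmxVp.
have QP : Q *m P = 1%:M by apply: mulVpmx.
have uQ (u : 'rV_(N.+1)) (c : 'rV_(3 * 3 + (3 + 3))) : u *m Q = c <-> u = c *m P.
  by split=> [<-|->]; rewrite -mulmxA ?QP ?PQ mulmx1.
(* [Q] takes coordinates with respect to the frame; there the two planes are coordinate planes and,
   [ch] being given by dot products, both dualities are the identity. *)
exists Q, (row_mx 1%:M 0), (row_mx 0 1%:M), 1%:M, 1%:M.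
have ZZ (c1 c2 : 'rV[K]_3) : c1 *m row_mx 1%:M 0 + c2 *m row_mx 0 1%:M = row_mx c1 c2.
  by rewrite !mul_mx_row !mulmx1 !mulmx0 add_row_mx addr0 add0r.
have dot0 (c a : 'rV[K]_3) : c *m 1%:M *m a^T = 0 <-> dot c a = 0.
  rewrite mulmx1 /dot; split=> [->|h]; first by rewrite mxE.
  by rewrite [c *m a^T]mx11_scalar h scalar_mx_0.
split.
- by apply/andP; split; [apply/row_freeP; exists P | apply/row_fullP; exists P].
- split; rewrite ?unitmx1 //.
  by rewrite -block_mxEv -scalar_mx_block unitmx1.
- move=> u; split.
    move=> Xu; have [a [b [c1 [c2 [a0 b0 e]]]]] := coverP u Xu.
    have := Xu; rewrite e tens => /hX [] // d1 d2.
    exists a, b, c1, c2; split=> //; try exact/dot0.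
    by rewrite ZZ; apply/uQ.
  move=> [a [b [c1 [c2 [a0 b0 /dot0 d1 /dot0 d2]]]]].
  by rewrite ZZ => /uQ ->; rewrite tens; apply/hX.
- move=> u; split.
    move=> uY; have [c1 [c2 e]] := frame_coord fr uY.
    by exists (row_mx c1 c2); apply/uQ; rewrite YE.
  move=> [y /uQ ->]; rewrite -[y]hsubmxK YE; exact: (frame_sub _ _ fr).
- have [_ _ hZ] := fr; move=> u; rewrite hZ /DS_Z.
  have u0 : (u *m Q != 0) = (u != 0).
    by congr (~~ _); apply/eqP/eqP => [/uQ ->|->]; rewrite mul0mx.
  rewrite u0.
  have inA : u <=m A <-> exists c1, u *m Q = row_mx 0 (c1 *m row_mx 1%:M 0).
    split=> [/submxP [c ->]|[c /uQ ->]].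
      exists c; apply/uQ; have := ZZ c 0; rewrite mul0mx addr0 => ->.
      by rewrite YE mul0mx addr0.
    by have := ZZ c 0; rewrite mul0mx addr0 => ->; rewrite YE mul0mx addr0 submxMl.
  have inB : u <=m B <-> exists c2, u *m Q = row_mx 0 (c2 *m row_mx 0 1%:M).
    split=> [/submxP [c ->]|[c /uQ ->]].
      exists c; apply/uQ; have := ZZ 0 c; rewrite mul0mx add0r => ->.
      by rewrite YE mul0mx add0r.
    by have := ZZ 0 c; rewrite mul0mx add0r => ->; rewrite YE mul0mx add0r submxMl.
  by rewrite inA inB.
Qed.
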